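(* Let $\mathcal{C}\subset\mathbb{P}^2$ be a plus-one generated reduced curve with exponents $(d_2,d_3)$ and level $d$. Suppose there is a line $L\subset\mathbb{P}^2$ which is an irreducible component of $\mathcal{C}$, so $\mathcal{C}=\mathcal{C}'\cup L$ with $L$ not contained in $\mathcal{C}'$, such that $|\mathcal{C}''|+\epsilon(\mathcal{C}',L)=d+1$, where $\mathcal{C}''=\mathcal{C}'\cap L$. Then $\mathcal{C}'$ is free with exponents $(d_2-1,d_3-1)$.
   Context: $S=\mathbb{C}[x,y,z]$ with standard grading. A reduced curve $\mathcal{C}\subset\mathbb{P}^2$ is given by a reduced homogeneous $f_{\mathcal{C}}\in S$. A derivation $\theta=\sum f_i\partial_i$ is homogeneous of degree $k$ if all $f_i$ are homogeneous of degree $k$; $\theta_E=x\partial_x+y\partial_y+z\partial_z$. $D(\mathcal{C})=\{\theta\in\mathrm{Der}(S):\theta(f_{\mathcal{C}})\in Sf_{\mathcal{C}}\}$, $D_0(\mathcal{C})=\{\theta:\theta(f_{\mathcal{C}})=0\}$, and $D(\mathcal{C})=D_0(\mathcal{C})\oplus S\theta_E$. $\mathcal{C}$ is free if $D_0(\mathcal{C})$ is a free $S$-module (necessarily of rank 2); its exponents are the degrees of a homogeneous basis of $D_0(\mathcal{C})$ (an unordered pair). $\mathcal{C}$ is plus-one generated if $D(\mathcal{C})$ has a minimal set of homogeneous generators $\{\theta_E,\theta_2,\theta_3,\psi\}$ with a unique relation $f_1\theta_E+f_2\theta_2+f_3\theta_3+\alpha\psi=0$, $f_i\in S$, $\deg\alpha=1$;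 exponents $(\deg\theta_2,\deg\theta_3)$, level $\deg\psi$. $\mathcal{E}_{\mathcal{C}}$ is the sheafification of $D_0(\mathcal{C})$ (a rank 2 vector bundle on $\mathbb{P}^2$). $|\mathcal{C}''|$ is the number of distinct points of $\mathcal{C}'\cap L$. For a reduced curve $\mathcal{C}'$ and a line $L\not\subset\mathcal{C}'$, $\epsilon(\mathcal{C}',L)\in\mathbb{Z}$ is the integer defined by A. Dimca, which measures the failure of the singularities of $\mathcal{C}'\cup L$ on $L$ to be quasi-homogeneous (it is $0$ if all these singularities are quasi-homogeneous), and for which there is an exact sequence of vector bundles $0\to\mathcal{E}_{\mathcal{C}'}(-1)\xrightarrow{\alpha_L}\mathcal{E}_{\mathcal{C}'\cup L}\to\mathcal{O}_L(1-|\mathcal{C}'\cap L|-\epsilon(\mathcal{C}',L))\to0$, $\alpha_L$ being a linear form defining $L$. *)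

(* Defs.v *)
From mathcomp Require Import all_boot all_algebra.
From mathcomp Require Import reals.
From mathcomp.real_closed Require Export complex.
From mathcomp Require Export mpoly.

Set Implicit Arguments.
Unset Strict Implicit.
Unset Printing Implicit Defensive.
Import GRing.Theory.
Local Open Scope ring_scope.

Section Curves.
Variable K : fieldType.
Local Notation P := {mpoly K[3]}.

(* derivations sum_i th_i d_i of S, given by their three components *)
Definition der := 'I_3 -> P.

Definition apply_der (th : der) (f : P) : P := \sum_(i < 3) th i * f^`M(i).

Definition homog_der (k : nat) (th : der) : Prop := forall i, th i \is k.-homog.

Definition euler_der : der := fun i => 'X_i.

Definition in_D (f : P) (th : der) : Prop := exists g : P, apply_der th f = g * f.
Definition in_D0 (f : P) (th : der) : Prop := apply_der th f = 0.

Definition lincomb (m : nat) (g : 'I_m -> P) (ths : 'I_m -> der) : der :=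
  fun i => \sum_(j < m) g j * ths j i.

Definition reduced_curve (f : P) : Prop :=
  f != 0 /\ (exists k : nat, (0 < k)%N /\ f \is k.-homog) /\
  (forall g h : P, f = g * g * h -> (msize g <= 1)%N).

Definition free_with_exponents (f : P) (a b : nat) : Prop :=
  exists th1 th2 : der,
    [/\ in_D0 f th1 /\ in_D0 f th2, homog_der a th1 /\ homog_der b th2,
        (forall th, in_D0 f th ->
           exists g1 g2 : P, forall i, th i = g1 * th1 i + g2 * th2 i) &
        (forall g1 g2 : P, (forall i, g1 * th1 i + g2 * th2 i = 0) ->
           g1 = 0 /\ g2 = 0)].

Definition four_gens (th2 th3 psi : der) : 'I_4 -> der :=
  fun k => match val k with
           | 0 => euler_der | 1 => th2 | 2 => th3 | _ => psi end.

Definition plus_one_generated (f : P) (d2 d3 d : nat) : Prop :=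
  exists th2 th3 psi : der,
    let G := four_gens th2 th3 psi in
    [/\ in_D f th2 /\ in_D f th3 /\ in_D f psi,
        homog_der d2 th2 /\ homog_der d3 th3 /\ homog_der d psi,
        (forall th, in_D f th -> exists g : 'I_4 -> P, forall i, th i = lincomb g G i),
        (forall k : 'I_4, ~ exists g : 'I_4 -> P,
              g k = 0 /\ forall i, G k i = lincomb g G i) &
        exists r : 'I_4 -> P,
          [/\ r (inord 3) \is 1.-homog, r (inord 3) != 0,
              (forall i, lincomb r G i = 0) &
              forall s : 'I_4 -> P, (forall i, lincomb s G i = 0) ->
                exists h : P, forall j, s j = h * r j]].

Definition pt := 'I_3 -> K.
Definition pt0 : pt := fun _ => 0.
Definition nonzero_pt (p : pt) : Prop := exists i, p i != 0.
Definition proportional (p q : pt) : Prop :=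
  exists c : K, c != 0 /\ forall i, q i = c * p i.

Definition points_list (Q : pt -> Prop) (ps : seq pt) : Prop :=
  [/\ (forall i, (i < size ps)%N -> nonzero_pt (nth pt0 ps i) /\ Q (nth pt0 ps i)),
      (forall i j, (i < size ps)%N -> (j < size ps)%N -> i <> j ->
          ~ proportional (nth pt0 ps i) (nth pt0 ps j)) &
      (forall q, nonzero_pt q -> Q q ->
          exists2 i, (i < size ps)%N & proportional (nth pt0 ps i) q)].

Definition num_points (Q : pt -> Prop) (m : nat) : Prop :=
  exists ps, points_list Q ps /\ size ps = m.

Definition meet_pts (f' alpha : P) (p : pt) : Prop :=
  f'.@[p] = 0 /\ alpha.@[p] = 0.

(* h/u (h, u homogeneous of the same degree, u(p) != 0) lies in the ideal of
   the local ring O_{P^2,p} generated by the (dehomogenized) homogeneous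
   polynomials G: some homogeneous w with w(p) != 0 has w*h in the ideal (G) *)
Definition loc_mem (p : pt) (G : seq P) (h : P) : Prop :=
  exists (w : P) (k : nat), [/\ w \is k.-homog, w.@[p] != 0 &
    exists c : nat -> P, w * h = \sum_(j < size G) c j * G`_j].

(* dim_K O_{P^2,p} / (G) = n, with the elements of O_{P^2,p} written as
   fractions h/u of homogeneous polynomials of equal degree, u(p) != 0 *)
Definition colength (p : pt) (G : seq P) (n : nat) : Prop :=
  exists h u : nat -> P,
    [/\ (forall i, (i < n)%N ->
           (exists k, h i \is k.-homog /\ u i \is k.-homog) /\ (u i).@[p] != 0),
        (* the classes of h_i/u_i are linearly independent *)
        (forall c : nat -> K,
           loc_mem p G (\sum_(i < n) c i *: (h i * \prod_(j < n | j != i) u j)) ->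
           forall i, (i < n)%N -> c i = 0) &
        (* ... and span O_{P^2,p}/(G) *)
        (forall (hh uu : P) (k : nat), hh \is k.-homog -> uu \is k.-homog ->
           uu.@[p] != 0 ->
           exists c : nat -> K,
             loc_mem p G (hh * \prod_(j < n) u j -
                          uu * \sum_(i < n) c i *: (h i * \prod_(j < n | j != i) u j)))].

Definition chart (p : pt) : 'I_3 :=
  if p (inord 0) != 0 then inord 0 else if p (inord 1) != 0 then inord 1 else inord 2.

Definition tjurina (p : pt) (g : P) (n : nat) : Prop :=
  colength p [:: g; g^`M(inord 0); g^`M(inord 1); g^`M(inord 2)] n.

(* Milnor number mu(C, p) = dim O_p/(partial derivatives of the local equation
   in the affine chart {x_k = 1}, k = chart p) *)
Definition milnor (p : pt) (g : P) (n : nat) : Prop :=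
  colength p [seq g^`M(j) | j <- enum 'I_3 & j != chart p] n.

Definition epsilon_CL (f' alpha : P) (e : int) : Prop :=
  exists ps, points_list (meet_pts f' alpha) ps /\
  exists mC tC mC' tC' : nat -> nat,
    (forall i, (i < size ps)%N ->
       [/\ milnor (nth pt0 ps i) (f' * alpha) (mC i),
           tjurina (nth pt0 ps i) (f' * alpha) (tC i),
           milnor (nth pt0 ps i) f' (mC' i) &
           tjurina (nth pt0 ps i) f' (tC' i)]) /\
    e = \sum_(i < size ps) (((mC i)%:Z - (tC i)%:Z) - ((mC' i)%:Z - (tC' i)%:Z)).

End Curves.

(* Main.v *)
(** Write [L] for the line [alpha = 0] and [F = f' alpha]. For [theta] in [D(F)] the bivector
    [theta_E /\ theta] restricts to [L] as a binary form [Om theta] of degree [deg theta + 1].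
    At a point of [C' /\ L] this form vanishes to order at least
    [1 + (mu - tau)(F) - (mu - tau)(f')]. In coordinates where [L] is [x = 0] and [g] is the
    local equation of [C'], this reduces to two bounds: a lower bound of [tau(x g)], which
    involves the order of [theta] along [L], and an upper bound of [mu(x g)], which follows from
    comparing the intersection numbers of the polar curve [g_y = 0] with [g + x g_x = 0] and
    with [x g_x = 0]. Tate's residue calculus on the polar curve replaces Puiseux series.

    Since [|C''| + epsilon = d + 1], the form [Om theta] is zero if [deg theta < d], and the forms
    of the derivations of degree [d] are proportional. The three generators besides [theta_E] have
    degree at most [d], so after subtracting constant multiples of one of them, [T_k] of degree
    [d], the other two have zero form and are, modulo [theta_E], of the shape [alpha phi] with
    [phi] in [D_0(f')]. On [L] the relation says that the coefficient of [T_k], which is linear, is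
    a multiple of [alpha]. Dividing the relation by [alpha] expresses [T_k] through the two
    [phi], which therefore form a basis of [D_0(f')]. *)

Require Import Defs.
From Stdlib Require Import Classical ClassicalEpsilon.
From HB Require Import structures.
From mathcomp Require Import all_boot all_algebra.
From mathcomp Require Import reals.
From mathcomp.real_closed Require Import complex.
From mathcomp Require Import mpoly.
From mathcomp Require Import ring zify.
Set Implicit Arguments.
Unset Strict Implicit.
Unset Printing Implicit Defensive.
Import GRing.Theory.
Local Open Scope ring_scope.

(** * Codimension of subspaces *)

(** Write [i + 1] for the intersection number of the line with [g = 0] at the point. The bounds are
    [mu(x g) <= mu(g) + 2 i + 1] and [tau(x g) >= tau(g) + i + 1 + q], where [q] is also the defect
    in the order [i + 1 - q] guaranteed for [theta]; their difference, increased by one, is this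
    order. The delicate bound is that of [mu]: nothing may cancel in [g + x g_x] on the polar curve,
    that is, [T = x g_x / g] must avoid [-1]. Instead of following branches, one blows up
    [(g, x g_x)] on the polar curve and looks at the point [T = -1] over the origin. There
    [dg / g = T dx / x], so its residue would be both a dimension and minus a dimension, which
    characteristic zero excludes unless the curve misses this point. Then [g + x g_x] generates a
    reduction of [(g, x g_x)], and a comparison of colengths concludes. Local rings are never built:
    ideals are contracted to the polynomial ring and compared through dimensions of quotients. On
    [L], counting degrees of binary forms replaces the exact sequence of bundles. *)

Lemma ex_max_nat (P : nat -> Prop) (n0 N : nat) :
  P n0 -> (forall n, P n -> (n <= N)%N) ->
  exists m, P m /\ forall n, P n -> (n <= m)%N.
Proof.
move=> Pn0; elim: N => [|N IH] hN.
  by exists n0; split=> // n /hN; lia.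
case: (classic (P N.+1)) => [hP|nP]; first by exists N.+1.
by apply: IH => n Pn; have := hN _ Pn; rewrite leq_eqVlt => /orP[/eqP e|//]; rewrite e in Pn.
Qed.

Lemma ex_min_nat (P : nat -> Prop) (n0 : nat) :
  P n0 -> exists m, P m /\ forall n, P n -> (m <= n)%N.
Proof.
elim/ltn_ind: n0 => n0 IH Pn0.
case: (classic (exists n, P n /\ (n < n0)%N)) => [[n [Pn lt]]|no]; first exact: IH Pn.
exists n0; split=> // n Pn; rewrite leqNgt; apply/negP => lt; apply: no; by exists n.
Qed.

Section Linear.
Variables (K : fieldType) (V W : lmodType K) (f : V -> W).
Hypothesis lf : linear f.

Lemma linear_lincomb n (c : 'I_n -> K) (h : 'I_n -> V) :
  f (\sum_i c i *: h i) = \sum_i c i *: f (h i).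
Proof.
have f0 : f 0 = 0.
  by have := lf (-1) 0 0; rewrite scaleN1r oppr0 addr0 scaleN1r addNr.
elim/big_rec2: _ => // i x y _ <-; exact: lf.
Qed.

Lemma linear_0 : f 0 = 0.
Proof. by have := lf (-1) 0 0; rewrite scaleN1r oppr0 addr0 scaleN1r addNr. Qed.

Lemma linear_B u v : f (u - v) = f u - f v.
Proof. by rewrite addrC -scaleN1r lf scaleN1r addrC. Qed.

End Linear.

Section Codim.
Variables (K : fieldType) (V : lmodType K).
Implicit Types J : V -> Prop.

Definition subspace J := J 0 /\ forall (c : K) u v, J u -> J v -> J (c *: u + v).

Lemma subspaceD J u v : subspace J -> J u -> J v -> J (u + v).
Proof. by case=> _ h hu hv; rewrite -[u]scale1r; apply: h. Qed.

Lemma subspaceZ J c u : subspace J -> J u -> J (c *: u).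
Proof. by case=> h0 h hu; rewrite -[_ *: _]addr0; apply: h. Qed.

Lemma subspaceN J u : subspace J -> J u -> J (- u).
Proof. by move=> sJ hu; rewrite -scaleN1r; apply: subspaceZ. Qed.

Lemma subspaceB J u v : subspace J -> J u -> J v -> J (u - v).
Proof. by move=> sJ hu hv; apply: subspaceD => //; apply: subspaceN. Qed.

Lemma subspace_sum J (I : Type) (r : seq I) (P : pred I) (F : I -> V) :
  subspace J -> (forall i, P i -> J (F i)) -> J (\sum_(i <- r | P i) F i).
Proof.
move=> sJ h; elim/big_rec: _ => [|i x Pi hx]; first by case: sJ.
by apply: subspaceD => //; apply: h.
Qed.

(* [p] identifies [V / J] with row vectors of length [n]. *)
Definition coords J n (p : V -> 'rV[K]_n) :=
  [/\ linear p, (forall w, exists v, p v = w) & (forall v, J v <-> p v = 0)].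

Definition codim J n := exists p : V -> 'rV[K]_n, coords J p.

Lemma factor_mx J n (p : V -> 'rV[K]_n) k (f : V -> 'rV[K]_k) :
  coords J p -> linear f -> (forall v, J v -> f v = 0) ->
  exists F : 'M[K]_(n, k), forall v, f v = p v *m F.
Proof.
move=> [lp sp kp] lf kf.
have [e he] : exists e : 'I_n -> V, forall i, p (e i) = delta_mx 0 i.
  by exists (fun i => proj1_sig (constructive_indefinite_description _ (sp (delta_mx 0 i))))
     => i; case: constructive_indefinite_description.
exists (\matrix_i f (e i)) => v.
have pe : p (\sum_i p v 0 i *: e i) = p v.
  by rewrite linear_lincomb // {2}[p v]row_sum_delta; apply: eq_bigr => i _; rewrite he.
have : f (v - \sum_i p v 0 i *: e i) = 0 by apply/kf/kp; rewrite linear_B // pe subrr.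
rewrite linear_B // => /subr0_eq ->; rewrite linear_lincomb // mulmx_sum_row.
by apply: eq_bigr => i _; rewrite rowK.
Qed.

Lemma subspace_matrix N (U : 'rV[K]_N -> Prop) :
  U 0 -> (forall c u v, U u -> U v -> U (c *: u + v)) ->
  exists A : 'M[K]_N, forall u, U u <-> (u <= A)%MS.
Proof.
move=> U0 UD.
have Uin m (A : 'M[K]_(m, N)) : (forall i, U (row i A)) -> forall u, (u <= A)%MS -> U u.
  move=> hA u /submxP[w ->]; rewrite mulmx_sum_row.
  by elim/big_rec: _ => // i x _ hx; apply: UD.
pose P r := exists A : 'M[K]_N, (forall i, U (row i A)) /\ \rank A = r.
have P0 : P 0%N by exists 0; split; [move=> i; rewrite row0 | rewrite mxrank0].
have [r [[A [hA rA]] rmax]] : exists m, P m /\ forall n, P n -> (n <= m)%N.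
  by apply: (@ex_max_nat P 0%N N P0) => n [A [_ <-]]; exact: rank_leq_col.
exists A => u; split; last exact: Uin.
move=> Uu; have hB : forall v, (v <= A + u)%MS -> U v.
  move=> v; rewrite addsmxE; apply: Uin => i; rewrite -(splitK i).
  by case: (split i) => j /=; rewrite ?rowKu ?rowKd // row_id.
have /rmax : P (\rank (A + u)%MS).
  by exists (A + u)%MS; split=> // i; apply: hB; exact: row_sub.
rewrite -rA => le; have : (A + u <= A)%MS.
  by rewrite -(geq_leqif (mxrank_leqif_sup (addsmxSl A u))).
by rewrite addsmx_sub => /andP[].
Qed.

(** The relations modulo [J] among the [s i] form the row space of a matrix [A]; a column basis of
    [cokermx A] supplies the coordinates on the quotient. *)
Lemma span_codim J N (s : 'I_N -> V) :
  subspace J -> (forall v, exists c : 'rV[K]_N, J (v - \sum_i c 0 i *: s i)) ->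
  exists n, (n <= N)%N /\ codim J n.
Proof.
move=> sJ hs.
pose c v := proj1_sig (constructive_indefinite_description _ (hs v)).
have hc v : J (v - \sum_i c v 0 i *: s i) by rewrite /c; case: constructive_indefinite_description.
pose t (w : 'rV[K]_N) := \sum_i w 0 i *: s i.
have lt : linear t.
  move=> a u v; rewrite /t scaler_sumr -big_split /=; apply: eq_bigr => i _.
  by rewrite !mxE scalerDl scalerA.
have t0 : t 0 = 0 by exact: (linear_0 lt).
have [A hA] : exists A : 'M[K]_N, forall u, J (t u) <-> (u <= A)%MS.
  apply: subspace_matrix => [|a u v hu hv]; first by rewrite t0; case: sJ.
  by rewrite lt; case: sJ => _; apply.
pose B := col_base (cokermx A).
have hB u : J (t u) <-> u *m B = 0.
  rewrite hA submxE -{1}(mulmx_base (cokermx A)) mulmxA.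
  split=> [/eqP h|->]; last by rewrite mul0mx.
  by apply: (row_free_inj (row_base_free (cokermx A))); rewrite h mul0mx.
have cB u v : J (u - v) -> c u *m B = c v *m B.
  move=> huv; apply/subr0_eq; rewrite -mulmxBl; apply/hB; rewrite linear_B //.
  rewrite -[t (c u) - t (c v)](subKr (u - v)).
  have -> : u - v - (t (c u) - t (c v)) = (u - t (c u)) - (v - t (c v)).
    by rewrite !opprB addrACA [RHS]addrACA; congr (_ + _); exact: addrC.
  by apply: subspaceB => //; apply: subspaceB.
exists (\rank (cokermx A)); split; first exact: rank_leq_col.
exists (fun v => c v *m B); split.
- move=> a u v; rewrite /= scalemxAl -mulmxDl; apply/subr0_eq; rewrite -mulmxBl.
  apply/hB; rewrite linear_B // lt.
  rewrite -[t _ - _](subKr (a *: u + v - (a *: u + v))).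
  have -> : a *: u + v - (a *: u + v) - (t (c (a *: u + v)) - (a *: t (c u) + t (c v))) =
     ((a *: u + v) - t (c (a *: u + v))) - (a *: (u - t (c u)) + (v - t (c v))).
    rewrite scalerBr [in RHS]addrACA -opprD opprB [in RHS]opprB addrACA [RHS]addrACA.
    by congr (_ + _); exact: addrC.
  apply: subspaceB => //; first by rewrite subrr; case: sJ.
  by apply: subspaceB => //; case: sJ => _; apply.
- move=> w; have /row_fullP[C hC] := col_base_full (cokermx A).
  exists (t (w *m C)).
  have : J (t (c (t (w *m C)) - w *m C)).
    by rewrite linear_B // -opprB; apply: subspaceN => //; apply: hc.
  by move/hB; rewrite mulmxBl => /subr0_eq ->; rewrite -mulmxA hC mulmx1.
- move=> v; rewrite -hB; split=> h.
    by rewrite -[t _](subKr v); apply: subspaceB => //; apply: hc.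
  by rewrite -[v](subrK (t (c v))); apply: subspaceD => //; apply: hc.
Qed.

Definition indep J m (h : 'I_m -> V) :=
  forall c : 'rV[K]_m, J (\sum_i c 0 i *: h i) -> c = 0.

Lemma indep_le J n m (h : 'I_m -> V) : codim J n -> indep J h -> (m <= n)%N.
Proof.
move=> [p [lp _ kp]] ih.
have : row_free (\matrix_i p (h i)).
  apply: inj_row_free => c; rewrite mulmx_sum_row => hc; apply: ih; apply/kp.
  by rewrite linear_lincomb // -[RHS]hc; apply: eq_bigr => i _; rewrite rowK.
by move=> /eqP <-; exact: rank_leq_col.
Qed.

Lemma codim_indep J n : codim J n -> exists h : 'I_n -> V, indep J h.
Proof.
move=> [p [lp sp kp]].
exists (fun i => proj1_sig (constructive_indefinite_description _ (sp (delta_mx 0 i)))).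
move=> c /kp; rewrite linear_lincomb // => hc; rewrite [c]row_sum_delta -[RHS]hc.
by apply: eq_bigr => i _; case: constructive_indefinite_description => /= x ->.
Qed.

(** A maximal independent family spans, since a vector outside its span would extend it. *)
Lemma bounded_codim J N : subspace J ->
  (forall m (h : 'I_m -> V), indep J h -> (m <= N)%N) ->
  exists n, (n <= N)%N /\ codim J n.
Proof.
move=> sJ hN.
pose P m := exists h : 'I_m -> V, indep J h.
have P0 : P 0%N by exists (fun _ => 0) => c _; apply/rowP => -[].
have [m [[h ih] mmax]] : exists m, P m /\ forall n, P n -> (n <= m)%N.
  by apply: (@ex_max_nat P 0%N N P0) => n [h]; exact: hN.
have [n [le cn]] : exists n, (n <= m)%N /\ codim J n; last first.
  by exists n; split=> //; apply: leq_trans le (hN _ _ ih).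
apply: (span_codim (s := h)) => // v.
apply: NNPP => no.
have : P (1 + m)%N.
  exists (fun i => match split i with inl _ => v | inr j => h j end) => c.
  rewrite big_split_ord /= big_ord1.
  have -> : split (lshift m (0 : 'I_1)) = inl 0 by exact: (unsplitK (inl _)).
  under eq_bigr => j _ do rewrite (unsplitK (inr j)).
  move=> hc; have c0 : c 0 (lshift m 0) = 0.
    apply/eqP; apply/negP => /negP nz; apply: no.
    exists (- (c 0 (lshift m 0))^-1 *: rsubmx c).
    have := subspaceZ ((c 0 (lshift m 0))^-1) sJ hc.
    rewrite scalerDr scalerA mulVf // scale1r; congr J; congr (_ + _).
    rewrite scaler_sumr -sumrN; apply: eq_bigr => j _.
    by rewrite !mxE scalerA mulNr scaleNr opprK.
  have : rsubmx c = 0.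
    apply: ih; move: hc; rewrite c0 scale0r add0r; congr J.
    by apply: eq_bigr => j _; rewrite !mxE.
  move=> hr; rewrite -[c]hsubmxK hr; apply/rowP => i; rewrite !mxE.
  case: splitP => j e; rewrite !mxE //.
  by move: c0; rewrite ord1; congr (_ = _).
by move/mmax; lia.
Qed.

Lemma codimS J J' n : subspace J' -> (forall v, J v -> J' v) -> codim J n ->
  exists n', (n' <= n)%N /\ codim J' n'.
Proof.
move=> sJ' sub cJ; apply: bounded_codim => // m h ih.
by apply: (indep_le (h := h) cJ) => c hc; apply: ih; apply: sub.
Qed.

Lemma codim_mono J J' n n' : (forall v, J v -> J' v) -> codim J n -> codim J' n' ->
  (n' <= n)%N.
Proof.
move=> sub cJ /codim_indep[h ih].
by apply: (indep_le (h := h) cJ) => c hc; apply: ih; apply: sub.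
Qed.

(** [V / J''] maps onto the image of [f] in [V / J], and [V / J'] onto its cokernel. Finiteness for
    [J] is part of the conclusion: the two families of lifts together span. *)
Lemma codim_sub_additive J J' J'' n' n'' (f : V -> V) :
  subspace J -> linear f ->
  (forall v, J' v -> exists u, J (v - f u)) -> (forall v, J'' v -> J (f v)) ->
  codim J' n' -> codim J'' n'' -> exists n, (n <= n' + n'')%N /\ codim J n.
Proof.
move=> sJ lf hJ' hJ'' [p' [lp' sp' kp']] [p'' [lp'' sp'' kp'']].
pose e' i := proj1_sig (constructive_indefinite_description _ (sp' (delta_mx 0 i))).
pose e'' i := proj1_sig (constructive_indefinite_description _ (sp'' (delta_mx 0 i))).
have he' i : p' (e' i) = delta_mx 0 i by rewrite /e'; case: constructive_indefinite_description.
have he'' i : p'' (e'' i) = delta_mx 0 i.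
  by rewrite /e''; case: constructive_indefinite_description.
apply: (span_codim (s := fun i => match split i with inl j => e' j | inr j => f (e'' j) end)) => // v.
have [u hu] : exists u, J (v - \sum_i p' v 0 i *: e' i - f u).
  apply: hJ'; apply/kp'; rewrite linear_B // linear_lincomb //.
  by under eq_bigr => i _ do rewrite he'; rewrite -row_sum_delta subrr.
have hu2 : J (f (u - \sum_i p'' u 0 i *: e'' i)).
  apply: hJ''; apply/kp''; rewrite linear_B // linear_lincomb //.
  by under eq_bigr => i _ do rewrite he''; rewrite -row_sum_delta subrr.
exists (row_mx (p' v) (p'' u)); rewrite big_split_ord /=.
under eq_bigr => j _ do rewrite (unsplitK (inl j)) row_mxEl.
rewrite [X in _ - (_ + X)](eq_bigr (fun j => p'' u 0 j *: f (e'' j))); last first.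
  by move=> j _; rewrite (unsplitK (inr j)) row_mxEr.
move: (subspaceD sJ hu hu2); congr J; rewrite (linear_B lf) (linear_lincomb lf).
by rewrite addrA subrK opprD addrA.
Qed.

(** [f] embeds [V / J''] into [V / J], with image killed in [V / J']. In coordinates, an injective
    and a surjective matrix compose to zero, so their ranks add up to at most [n]. *)
Lemma codim_super_additive J J' J'' n n' n'' (f : V -> V) :
  linear f -> (forall v, J v -> J' v) -> (forall v, J' (f v)) ->
  (forall v, J'' v <-> J (f v)) ->
  codim J n -> codim J' n' -> codim J'' n'' -> (n' + n'' <= n)%N.
Proof.
move=> lf sub hf hJ'' [p cp] [p' cp'] [p'' cp''].
have [lp sp kp] := cp; have [lp' sp' kp'] := cp'; have [lp'' sp'' kp''] := cp''.
have [Q hQ] : exists Q : 'M_(n, n'), forall v, p' v = p v *m Q.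
  by apply: (factor_mx cp) => // v /sub /kp'.
have [F hF] : exists F : 'M_(n'', n), forall v, p (f v) = p'' v *m F.
  apply: (factor_mx cp'') => [a u v|v /hJ'' /kp //]; by rewrite lf lp.
have rF : row_free F.
  apply: inj_row_free => w; have [v <-] := sp'' w; rewrite -hF => h.
  by apply/kp''/hJ''/kp.
have rQ : row_full Q.
  rewrite /row_full -mxrank_tr -[_ == _]/(row_free Q^T).
  rewrite -row_leq_rank mxrank_tr; apply/idP.
  have -> : \rank Q = \rank (1%:M : 'M[K]_n').
    apply/eqP; rewrite eqn_leq mxrank1 rank_leq_col /= -{1}(mxrank1 K n').
    apply: mxrankS; apply/row_subP => i; rewrite row1.
    by have [v <-] := sp' (delta_mx 0 i); rewrite hQ submxMl.
  by rewrite mxrank1.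
have FQ : F *m Q = 0.
  apply/row_matrixP => i; rewrite row0 rowE mulmxA.
  by have [v <-] := sp'' (delta_mx 0 i); rewrite -hF -hQ; apply/kp'.
have := mulmx0_rank_max FQ; rewrite (eqP rF) (eqP rQ); by rewrite addnC.
Qed.

End Codim.

(** * Ideals localized at a point *)

Lemma row_first_nonzero (K : fieldType) n (c : 'rV[K]_n) : c <> 0 ->
  exists2 i, c 0 i != 0 & forall j : 'I_n, (j < i)%N -> c 0 j = 0.
Proof.
move=> cn0; pose P (k : nat) := exists2 i : 'I_n, c 0 i != 0 & k = i.
have [i hi] : exists i, c 0 i != 0.
  apply: NNPP => no; apply: cn0; apply/rowP => i; rewrite mxE.
  by apply/eqP/negP => /negP h; apply: no; exists i.
have [|k [[j cj ->] kmin]] := @ex_min_nat P i; first by exists i.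
exists j => // l lt; apply/eqP/negP => /negP h.
by have := kmin l; rewrite leqNgt lt => /(_ _)/notF; apply; exists l.
Qed.

Section LocalIdeals.
Variables (K : fieldType) (R : comAlgType K) (ev : {rmorphism R -> K}).
Hypothesis evZ : forall c a, ev (c *: a) = c * ev a.
Implicit Types (J : R -> Prop) (a b h s : R).

Definition ideal J := [/\ J 0, forall u v, J u -> J v -> J (u + v) & forall a u, J u -> J (a * u)].

Lemma idealM J a u : ideal J -> J u -> J (a * u).
Proof. by case=> _ _; apply. Qed.

Lemma idealMr J a u : ideal J -> J u -> J (u * a).
Proof. by rewrite mulrC; apply: idealM. Qed.

Lemma idealD J u v : ideal J -> J u -> J v -> J (u + v).
Proof. by case=> _ h _; apply: h. Qed.

Lemma ideal0 J : ideal J -> J 0.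
Proof. by case. Qed.

Lemma idealN J u : ideal J -> J u -> J (- u).
Proof. by move=> iJ hu; rewrite -mulN1r; apply: idealM. Qed.

Lemma idealB J u v : ideal J -> J u -> J v -> J (u - v).
Proof. by move=> iJ hu hv; apply: idealD => //; apply: idealN. Qed.

Lemma idealZ J c u : ideal J -> J u -> J (c *: u).
Proof. by move=> iJ hu; rewrite -mulr_algl; apply: idealM. Qed.

Lemma ideal_subspace J : ideal J -> subspace J.
Proof.
move=> iJ; split=> [|c u v hu hv]; first exact: ideal0.
by apply: idealD => //; apply: idealZ.
Qed.

Lemma ideal_sum J (I : Type) (r : seq I) (P : pred I) (F : I -> R) :
  ideal J -> (forall i, P i -> J (F i)) -> J (\sum_(i <- r | P i) F i).
Proof. by move=> /ideal_subspace; apply: subspace_sum. Qed.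

Lemma idealBX J u v n : ideal J -> J (u - v) -> J (u ^+ n - v ^+ n).
Proof. by move=> iJ h; rewrite subrXX; apply: idealMr. Qed.

Lemma mul_linear a : linear (fun v : R => a * v).
Proof. by move=> c u v; rewrite mulrDr scalerAr. Qed.

Definition zero_ideal h := h = 0.

Lemma zero_idealP : ideal zero_ideal.
Proof.
by split=> [//|u v -> ->|a u ->]; rewrite /zero_ideal ?addr0 ?mulr0.
Qed.

(** The ideal [J + (a)]. *)
Definition adj J a h := exists q, J (h - a * q).

Lemma adj_ideal J a : ideal J -> ideal (adj J a).
Proof.
move=> iJ; split.
- by exists 0; rewrite mulr0 subr0; apply: ideal0.
- move=> u v [q hq] [r hr]; exists (q + r).
  by rewrite mulrDr opprD addrACA; apply: idealD.
- move=> b u [q hq]; exists (b * q).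
  by rewrite mulrCA -mulrBr; apply: idealM.
Qed.

Lemma adj_sub J a h : J h -> adj J a h.
Proof. by exists 0; rewrite mulr0 subr0. Qed.

Lemma adj_gen J a q : ideal J -> adj J a (a * q).
Proof. by exists q; rewrite subrr; apply: ideal0. Qed.

Lemma adj_min J J' a h : ideal J' -> (forall u, J u -> J' u) -> J' a -> adj J a h -> J' h.
Proof.
move=> iJ' sub ha [q /sub hq]; rewrite -[h](subrK (a * q)).
by apply: idealD => //; apply: idealMr.
Qed.

Lemma adj_mono J J' a h : (forall u, J u -> J' u) -> adj J a h -> adj J' a h.
Proof. by move=> sub [q /sub hq]; exists q. Qed.

(** The contraction to [R] of the extension of [J] to the local ring at the point [ev]. In finite
    codimension [R / loc J] is already the local quotient, because [local_unit] divides by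
    denominators inside [R]. *)
Definition loc J h := exists s, ev s != 0 /\ J (s * h).

Lemma loc_ideal J : ideal J -> ideal (loc J).
Proof.
move=> iJ; split.
- by exists 1; rewrite rmorph1 oner_eq0 mul1r; split=> //; apply: ideal0.
- move=> u v [s [es hs]] [t [et ht]]; exists (s * t); split; first by rewrite rmorphM mulf_neq0.
  rewrite mulrDr; apply: idealD => //; last by rewrite -mulrA; apply: idealM.
  by rewrite mulrAC; apply: idealMr.
- by move=> a u [s [es hs]]; exists s; split=> //; rewrite mulrCA; apply: idealM.
Qed.

Lemma loc_sub J h : J h -> loc J h.
Proof. by exists 1; rewrite rmorph1 oner_eq0 mul1r. Qed.

Definition local J := forall s h, ev s != 0 -> J (s * h) -> J h.

Lemma loc_local J : local (loc J).
Proof.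
move=> s h es [t [et ht]]; exists (t * s); split; first by rewrite rmorphM mulf_neq0.
by rewrite -mulrA.
Qed.

Lemma loc_min J J' h : local J' -> (forall u, J u -> J' u) -> loc J h -> J' h.
Proof. by move=> lJ' sub [s [es /sub hs]]; apply: lJ' hs. Qed.

Lemma loc_mono J J' h : (forall u, J u -> J' u) -> loc J h -> loc J' h.
Proof. by move=> sub [s [es /sub hs]]; exists s. Qed.

(** Multiplication by [s] is injective on the finite-dimensional [R / J] because [J] is local, hence
    it is surjective. *)
Lemma local_unit J n s v : ideal J -> local J -> codim J n -> ev s != 0 ->
  exists v', J (v - s * v').
Proof.
move=> iJ lJ [p cp] es; have [lp sp kp] := cp.
have [F hF] : exists F : 'M_n, forall u, p (s * u) = p u *m F.
  apply: (factor_mx (f := fun u => p (s * u)) cp) => [c u w|u hu].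
    by rewrite mulrDr -scalerAr lp.
  by apply/kp; apply: idealM.
have rF : row_free F.
  apply: inj_row_free => w; have [u <-] := sp w; rewrite -hF => h.
  by apply/kp; apply: lJ es _; apply/kp.
have uF : F \in unitmx by rewrite -row_free_unit.
have [v' hv'] := sp (p v *m invmx F); exists v'.
by apply/kp; rewrite (linear_B lp) hF hv' mulmxKV // subrr.
Qed.

(** The powers [1, x, .., x ^+ n] are dependent modulo [J]. Factoring out the lowest power of [x] in
    a relation leaves a cofactor that is nonzero at the point and therefore cancels. *)
Lemma local_nilpotent J n x : ideal J -> local J -> codim J n -> ev x = 0 ->
  exists k, J (x ^+ k).
Proof.
move=> iJ lJ cJ ex.
have [c [hc cn0]] : exists c : 'rV[K]_n.+1, J (\sum_i c 0 i *: x ^+ i) /\ c <> 0.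
  apply: NNPP => no; have := indep_le (h := fun i : 'I_n.+1 => x ^+ i) cJ.
  rewrite ltnn => /(_ _)/notF; apply=> c hc.
  by apply: NNPP => cn0; apply: no; exists c.
have [i0 ci0 hmin] := row_first_nonzero cn0; exists i0.
apply: (lJ (\sum_(i < n.+1 | (i0 <= i)%N) c 0 i *: x ^+ (i - i0))).
  rewrite (bigD1 i0) //= subnn expr0 rmorphD evZ rmorph1 mulr1 rmorph_sum /=.
  rewrite big1 ?addr0 // => i /andP[hi ni]; rewrite evZ rmorphXn /= ex expr0n.
  have lt : (i0 < i)%N by rewrite ltn_neqAle hi andbT eq_sym.
  by rewrite subn_eq0 leqNgt lt mulr0.
move: hc; rewrite mulr_suml; congr J.
rewrite [RHS]big_mkcond /=; apply: eq_bigr => i _; case: leqP => hi.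
  by rewrite -scalerAl -exprD subnK.
by rewrite hmin // scale0r.
Qed.

Lemma codim_full J : J 1 -> ideal J -> codim J 0.
Proof.
move=> h1 iJ; exists (fun _ => 0); split.
- by move=> c u v; rewrite scaler0 addr0.
- by move=> w; exists 0; rewrite [w]thinmx0.
- by move=> v; split=> // _; rewrite -[v]mulr1; apply: idealM.
Qed.

Lemma codim_max J : ideal J -> (forall h, ev h = 0 -> J h) -> exists n, (n <= 1)%N /\ codim J n.
Proof.
move=> iJ hJ; apply: (span_codim (s := fun _ : 'I_1 => 1)); first exact: ideal_subspace.
move=> v; exists (const_mx (ev v)); apply: hJ.
by rewrite big_ord1 mxE rmorphB evZ rmorph1 mulr1 subrr.
Qed.

Lemma codim_adjX J a n k : ideal J -> codim (adj J a) n ->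
  exists m, (m <= k * n)%N /\ codim (adj J (a ^+ k)) m.
Proof.
move=> iJ ca; elim: k => [|k [m [le cm]]].
  exists 0; split=> //; apply: codim_full; last exact: adj_ideal.
  by rewrite expr0 -[X in adj _ _ X](mulr1 1); apply: adj_gen.
have iS := ideal_subspace (adj_ideal (a ^+ k.+1) iJ).
have [m' [le' cm']] : exists m', (m' <= n + m)%N /\ codim (adj J (a ^+ k.+1)) m'.
  apply: (codim_sub_additive iS (mul_linear a) _ _ ca cm) => [v [q hq]|v [q hq]].
    by exists q; apply: adj_sub.
  by exists q; rewrite exprS -mulrA -mulrBr; apply: idealM.
exists m'; split=> //.
by rewrite mulSn; apply: leq_trans le' _; rewrite leq_add2l.
Qed.

Lemma codim_nilpotent J a n k : ideal J -> codim (adj J a) n -> J (a ^+ k) ->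
  exists m, (m <= k * n)%N /\ codim J m.
Proof.
move=> iJ ca hk; have [m [le cm]] := codim_adjX k iJ ca.
have [m' [le' cm']] := codimS (ideal_subspace iJ) (fun v => @adj_min J J _ v iJ (fun _ H => H) hk) cm.
by exists m'; split=> //; apply: leq_trans le.
Qed.

(** Modulo all of [L] the quotient has dimension at most one; the elements of [L], being nilpotent
    modulo [J], are then removed one at a time by filtering with their powers. *)
Lemma codim_finite J (L : seq R) : ideal J ->
  (forall a, a \in L -> exists k, J (a ^+ k)) ->
  (forall h, ev h = 0 -> foldl adj J L h) -> exists n, codim J n.
Proof.
elim: L J => [|a L IH] J iJ hL hm /=.
  by have [n [_ cn]] := codim_max iJ hm; exists n.
have [n cn] : exists n, codim (adj J a) n.
  apply: IH => //; first exact: adj_ideal.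
  move=> b hb; have [|k hk] := hL b; first by rewrite inE hb orbT.
  by exists k; apply: adj_sub.
have [k hk] := hL a (mem_head _ _).
by have [m [_ cm]] := codim_nilpotent iJ cn hk; exists m.
Qed.

(** [J'] and [J''] stand for [J + (a)] and [J : a]. They are tested before localization; finiteness
    of [J] lets [local_unit] absorb the denominators. *)
Lemma local_sub_additive J J' J'' n n' n'' a :
  ideal J -> local J -> codim J n ->
  (forall v, J' v -> exists u, J (v - a * u)) -> (forall v, J'' v -> J (a * v)) ->
  codim (loc J') n' -> codim (loc J'') n'' -> (n <= n' + n'')%N.
Proof.
move=> iJ lJ cJ h' h'' c' c''.
have [m [le cm]] : exists m, (m <= n' + n'')%N /\ codim J m; last first.
  by apply: leq_trans le; apply: codim_mono cm cJ.
apply: (codim_sub_additive (f := fun v => a * v) (J' := loc J') (J'' := loc J'')) => //.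
- exact: ideal_subspace.
- exact: mul_linear.
- move=> v [s [es /h'[u hu]]]; have [u' hu'] := local_unit u iJ lJ cJ es.
  exists u'; apply: (lJ s) => //.
  have -> : s * (v - a * u') = (s * v - a * u) + a * (u - s * u') by ring.
  by apply: idealD => //; apply: idealM.
- by move=> v [s [es /h'' hv]]; apply: (lJ s) => //; rewrite mulrCA.
Qed.

Lemma loc_adjM J a b u v : ideal J ->
  loc (adj J a) u -> loc (adj J b) v -> loc (adj J (a * b)) (u * v).
Proof.
move=> iJ [s [es [q hq]]] [t [et [r hr]]].
exists (s * t); split; first by rewrite rmorphM mulf_neq0.
exists (q * r).
have -> : s * t * (u * v) - a * b * (q * r) =
   (t * v) * (s * u - a * q) + (a * q) * (t * v - b * r) by ring.
by apply: idealD => //; apply: idealM.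
Qed.

Lemma loc_adjX J a u k : ideal J -> loc (adj J a) u -> loc (adj J (a ^+ k)) (u ^+ k).
Proof.
move=> iJ hu; elim: k => [|k IH]; last by rewrite !exprS; apply: loc_adjM.
by apply: loc_sub; rewrite !expr0 -[X in adj _ _ X](mulr1 1); apply: adj_gen.
Qed.

Lemma loc_adj_nilpotent J a t n : ideal J -> loc (adj J a) t -> loc J (a ^+ n) -> loc J (t ^+ n).
Proof.
move=> iJ /(loc_adjX n iJ) h ha; apply: loc_min h; first exact: loc_local.
by move=> v; apply: adj_min => //; [apply: loc_ideal | move=> w; apply: loc_sub].
Qed.

End LocalIdeals.

(** * Residues *)

(** A nilpotent matrix is singular, so its rank factorization [C *m B] passes through a smaller
    size; [B *m C] has the same trace and is again nilpotent. *)
Lemma mxtrace_nilpotent (K : fieldType) n (N : 'M[K]_n) k : N ^+ k = 0 -> \tr N = 0.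
Proof.
have [m] := ubnP n; elim: m n N k => // m IH n N k lt hN.
have [rN|nN] := boolP (row_free N).
  have uN : N \in unitmx by rewrite -row_free_unit.
  have uk j : N ^+ j \in unitmx.
    elim: j => [|j IHj]; first by rewrite expr0 unitmx1.
    by rewrite exprS unitmx_mul uN.
  have := uk k; rewrite hN; case: n N {lt hN rN uN uk} => [|n] N.
    by rewrite /mxtrace big_ord0.
  by rewrite unitmxE det0 unitr0.
have lr : (\rank N < n)%N by rewrite ltn_neqAle nN rank_leq_row.
rewrite -(mulmx_base N) mxtrace_mulC.
apply: (IH _ _ k.+1); first by apply: leq_trans lr _; rewrite -ltnS.
have h j : (row_base N *m col_base N) ^+ j.+1 = row_base N *m (N ^+ j) *m col_base N.
  elim: j => [|j IHj]; first by rewrite expr1 expr0 mulmx1.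
  rewrite exprS IHj exprS -[X in _ = _ *m (X * _) *m _](mulmx_base N).
  by rewrite -!mulmxE !mulmxA.
by rewrite h hN mulmx0 mul0mx.
Qed.

Lemma mderivXU (K : fieldType) n (i j : 'I_n) : ('X_i : {mpoly K[n]})^`M(j) = (i == j)%:R.
Proof.
rewrite mderivX mnm1E; case: eqP => [->|_]; last by rewrite scale0r.
rewrite scale1r; have -> : (U_(j) - U_(j) = 0)%MM by apply/mnmP=> k; rewrite mnmBE mnm0E subnn.
by rewrite mpolyX0.
Qed.

Lemma mpoly_alg_ind (K : fieldType) n (P : {mpoly K[n]} -> Prop) :
  (forall c, P c%:MP) -> (forall i, P 'X_i) ->
  (forall p q, P p -> P q -> P (p + q)) -> (forall p q, P p -> P q -> P (p * q)) ->
  forall p, P p.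
Proof.
move=> PC PX PD PM p; rewrite [p]mpolyE.
apply: (big_ind P) => [|//|m _]; first by rewrite -[0](mpolyC0 n K).
rewrite -mul_mpolyC; apply: (PM) => //; rewrite mpolyXE_id.
apply: (big_ind P) => [|//|i _]; first by rewrite -(mpolyC1 n K).
elim: (m i) => [|k IH]; first by rewrite expr0 -(mpolyC1 n K).
by rewrite exprS; apply: (PM).
Qed.

Section Residue.
Variables (K : fieldType) (R : comAlgType K) (ev : {rmorphism R -> K}).
Hypothesis evZ : forall c a, ev (c *: a) = c * ev a.
Variables (J : R -> Prop) (c : R).
Hypotheses (iJ : ideal J) (nzc : forall h, J (c * h) -> J h).
Local Notation Jl d := (loc ev (adj J d)).

Lemma loc_adj_ideal d : ideal (Jl d).
Proof. by apply: loc_ideal; apply: adj_ideal. Qed.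

Lemma loc_adj_base d h : J h -> Jl d h.
Proof. by move=> hJ; apply: loc_sub; apply: adj_sub. Qed.

Lemma loc_adj_split d J1 n h : ideal J1 -> local ev J1 -> codim J1 n ->
  (forall u, J u -> J1 u) -> Jl d h -> exists q, J1 (h - d * q).
Proof.
move=> i1 l1 c1 sub [s [es [q /sub hq]]].
have [q' hq'] := local_unit q i1 l1 c1 es; exists q'; apply: (l1 s) => //.
have -> : s * (h - d * q') = (s * h - d * q) + d * (q - s * q') by ring.
by apply: idealD => //; apply: idealM.
Qed.

Variables (n1 n2 : nat) (p1 : R -> 'rV[K]_n1) (p2 : R -> 'rV[K]_n2).
Hypotheses (cp1 : coords (Jl c) p1) (cp2 : coords (Jl (c * c)) p2).

Lemma quotient_surj n (p : R -> 'rV[K]_n) (J' : R -> Prop) k (A B : 'M[K]_(n, k)) :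
  coords J' p -> (forall m, p m *m A = p m *m B) -> A = B.
Proof.
move=> [_ sp _] h; apply/row_matrixP => i; rewrite !rowE.
by have [v <-] := sp (delta_mx 0 i).
Qed.

Lemma mul_matrix n (p : R -> 'rV[K]_n) (J' : R -> Prop) e :
  ideal J' -> coords J' p -> exists M : 'M[K]_n, forall m, p (e * m) = p m *m M.
Proof.
move=> i' cp; have [lp _ kp] := cp.
apply: (factor_mx (f := fun u => p (e * u)) cp) => [k u v|u hu].
  by rewrite mulrDr -scalerAr lp.
by apply/kp; apply: idealM.
Qed.

(** As [c] is a nonzerodivisor modulo [J], multiplication by [c] embeds the quotient by [c] into the
    quotient by [c * c]. The retraction [sigma] is only [K]-linear, and its failure to be [R]-linear
    carries the residue. *)
Lemma left_inverse_exists : exists sigma : R -> 'rV[K]_n1,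
  [/\ linear sigma, forall m, sigma (c * m) = p1 m & forall m, Jl (c * c) m -> sigma m = 0].
Proof.
have [lp1 sp1 kp1] := cp1; have [lp2 sp2 kp2] := cp2.
have [C hC] : exists C : 'M[K]_(n1, n2), forall m, p2 (c * m) = p1 m *m C.
  apply: (factor_mx (f := fun u => p2 (c * u)) cp1) => [k u v|u [s [es [q hq]]]].
    by rewrite mulrDr -scalerAr lp2.
  apply/kp2; exists s; split=> //; exists q.
  by rewrite mulrCA -mulrA -mulrBr; apply: idealM.
have rC : row_free C.
  apply: inj_row_free => w; have [v <-] := sp1 w; rewrite -hC => /kp2[s [es [q hq]]].
  apply/kp1; exists s; split=> //; exists q; apply: nzc.
  by have -> : c * (s * v - c * q) = s * (c * v) - c * c * q by ring.
exists (fun m => p2 m *m pinvmx C); split.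
- by move=> k u v /=; rewrite lp2 mulmxDl scalemxAl.
- by move=> m; rewrite hC -mulmxA mulmxVp // mulmx1.
- by move=> m /kp2 ->; rewrite mul0mx.
Qed.

Definition sigma := proj1_sig (constructive_indefinite_description _ left_inverse_exists).

Lemma sigmaP : [/\ linear sigma, forall m, sigma (c * m) = p1 m &
  forall m, Jl (c * c) m -> sigma m = 0].
Proof. by rewrite /sigma; case: constructive_indefinite_description. Qed.

Definition mulx e := proj1_sig (constructive_indefinite_description _
  (mul_matrix e (loc_adj_ideal c) cp1)).

Lemma mulxE e m : p1 (e * m) = p1 m *m mulx e.
Proof. by rewrite /mulx; case: constructive_indefinite_description. Qed.

(** The commutator of [m |-> sigma (e * m)] with multiplication by [f]. On multiples of [c] the map
    [sigma] is prescribed and commutes with multiplication, so the commutator descends to the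
    quotient by [c], where it has a trace. *)
Definition tate e f m := sigma (e * f * m) - sigma (e * m) *m mulx f.

Lemma tate_linear e f : linear (tate e f).
Proof.
have [ls _ _] := sigmaP; move=> k u v; rewrite /tate !mulrDr -!scalerAr !ls mulmxDl.
by rewrite -scalemxAl scalerBr opprD addrACA.
Qed.

Lemma tate_kill e f m : Jl c m -> tate e f m = 0.
Proof.
have [ls hs ks] := sigmaP; move=> hm.
have [q hq] : exists q, Jl (c * c) (m - c * q).
  apply: (loc_adj_split (n := n2)) hm.
  - exact: loc_adj_ideal.
  - exact: loc_local.
  - by exists p2.
  - by move=> u; apply: loc_adj_base.
have iJ2 := loc_adj_ideal (c * c).
have red e' : sigma (e' * m) = sigma (c * (e' * q)).
  apply/subr0_eq; rewrite -(linear_B ls) mulrCA -mulrBr; apply: ks.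
  exact: idealM.
rewrite /tate !red !hs -mulxE.
have -> : f * (e * q) = e * f * q by ring.
by rewrite subrr.
Qed.

Lemma tate_mx_exists e f : exists F : 'M[K]_n1, forall m, tate e f m = p1 m *m F.
Proof.
by apply: (factor_mx cp1); [exact: tate_linear | move=> v; exact: tate_kill].
Qed.

Definition tate_mx e f := proj1_sig (constructive_indefinite_description _ (tate_mx_exists e f)).

Lemma tate_mxE e f m : p1 m *m tate_mx e f = tate e f m.
Proof. by rewrite /tate_mx; case: constructive_indefinite_description. Qed.

(* Tate's residue of the differential [(e / c) df]. *)
Definition res e f := \tr (tate_mx e f).

Lemma mulx_scaleD k f f' : mulx (k *: f + f') = k *: mulx f + mulx f'.
Proof.
have [lp1 _ _] := cp1; apply: (quotient_surj cp1) => m.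
by rewrite -mulxE mulrDl -scalerAl lp1 !mulxE mulmxDr scalemxAr.
Qed.

Lemma res_linear e k f f' : res e (k *: f + f') = k * res e f + res e f'.
Proof.
have [ls _ _] := sigmaP; rewrite /res -mxtraceZ -mxtraceD; congr (\tr _).
apply: (quotient_surj cp1) => m; rewrite mulmxDr -scalemxAr !tate_mxE /tate.
rewrite mulx_scaleD mulmxDr -scalemxAr mulrDr mulrDl -scalerAr -scalerAl ls.
by rewrite scalerBr opprD addrACA.
Qed.

Lemma res_cong e e' f : J (e - e') -> res e f = res e' f.
Proof.
have [ls _ ks] := sigmaP; move=> he; rewrite /res; congr (\tr _).
apply: (quotient_surj cp1) => m; rewrite !tate_mxE /tate.
have red u : sigma (e * u) = sigma (e' * u).
  apply/subr0_eq; rewrite -(linear_B ls) -mulrBl; apply: ks; apply: loc_adj_base.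
  exact: idealMr.
by rewrite -!mulrA !red.
Qed.

Lemma res0 e f : J e -> res e f = 0.
Proof.
move=> he; rewrite (@res_cong _ 0) ?subr0 // /res.
have -> : tate_mx 0 f = 0; last by rewrite mxtrace0.
have [ls _ _] := sigmaP.
apply: (quotient_surj cp1) => m; rewrite tate_mxE /tate !mul0r (linear_0 ls).
by rewrite mul0mx subr0 mulmx0.
Qed.

Lemma resDl e e' f : res (e + e') f = res e f + res e' f.
Proof.
have [ls _ _] := sigmaP; rewrite /res -mxtraceD; congr (\tr _).
have sD u v : sigma (u + v) = sigma u + sigma v by rewrite -[u]scale1r ls !scale1r.
apply: (quotient_surj cp1) => m; rewrite mulmxDr !tate_mxE /tate.
by rewrite !mulrDl !sD mulmxDl opprD addrACA.
Qed.

(** The Leibniz rule. The commutator with a product has two terms, and cyclicity of the trace moves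
    the factor [mulx f'] of one of them inside. *)
Lemma resM e f f' : res e (f * f') = res (e * f) f' + res (e * f') f.
Proof.
have -> : res (e * f') f = \tr (tate_mx e f *m mulx f').
  rewrite mxtrace_mulC /res; congr (\tr _); apply: (quotient_surj cp1) => m.
  rewrite mulmxA -mulxE !tate_mxE /tate -!mulrA; congr (sigma (e * _) - _).
  by rewrite mulrCA.
rewrite /res -mxtraceD; congr (\tr _); apply: (quotient_surj cp1) => m.
rewrite mulmxDr mulmxA !tate_mxE /tate mulmxBl.
have -> : mulx (f * f') = mulx f *m mulx f'.
  apply: (quotient_surj cp1) => u; rewrite mulmxA -!mulxE; congr (p1 _); ring.
by rewrite !mulmxA !mulrA addrA subrK.
Qed.

Lemma resC e k : res e k%:A = 0.
Proof.
have r1 : res e 1 = 0.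
  by have := resM e 1 1; rewrite !mulr1 => h; apply: (addrI (res e 1)); rewrite -h addr0.
have := res_linear e k 1 0; rewrite addr0 r1 mulr0 add0r => ->.
by have := res_linear e (-1) 1 1; rewrite scaleN1r addNr r1 mulr0 addr0.
Qed.

(** The differential is [f da / a]. Its commutator factors through the quotient by [a], and after
    projecting back to that quotient the term ending in multiplication by [a] dies, leaving
    multiplication by [f]. *)
Lemma res_trace a b f n (p : R -> 'rV[K]_n) (N : 'M[K]_n) :
  c = a * b -> coords (Jl a) p -> (forall m, p (f * m) = p m *m N) ->
  res (f * b) a = \tr N.
Proof.
move=> cE cp hN; have [ls hs ks] := sigmaP; have [lp sp kp] := cp; have [lp1 sp1 kp1] := cp1.
have kill m : Jl a m -> tate (f * b) a m = 0.
  move=> hm; have [q hq] : exists q, Jl c (m - a * q).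
    apply: (loc_adj_split (n := n1)) hm.
    - exact: loc_adj_ideal.
    - exact: loc_local.
    - by exists p1.
    - by move=> u; apply: loc_adj_base.
  have := tate_kill (f * b) a hq; rewrite (linear_B (tate_linear _ _)) => /subr0_eq ->.
  have e u : f * b * (a * u) = c * (f * u) by rewrite cE; ring.
  rewrite /tate -[f * b * a * _]mulrA !e !hs -mulxE.
  have -> : f * (a * q) = a * (f * q) by ring.
  by rewrite subrr.
have [N' hN'] : exists N' : 'M[K]_(n, n1), forall m, tate (f * b) a m = p m *m N'.
  by apply: (factor_mx cp); [exact: tate_linear | exact: kill].
have [Q hQ] : exists Q : 'M[K]_(n1, n), forall m, p m = p1 m *m Q.
  apply: (factor_mx cp1) => // v [s [es [q hq]]]; apply/kp.
  by exists s; split=> //; exists (b * q); rewrite mulrA -cE.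
have -> : N = N' *m Q.
  apply: (quotient_surj cp) => m; rewrite mulmxA -hN' -hN /tate mulmxBl.
  have -> : f * b * a * m = c * (f * m) by rewrite cE; ring.
  rewrite hs -hQ; have [v <-] := sp1 (sigma (f * b * m)).
  rewrite -mulxE -hQ; have -> : p (a * v) = 0; last by rewrite subr0.
  by apply/kp; apply: loc_sub; apply: adj_gen.
rewrite mxtrace_mulC /res; congr (\tr _); apply: (quotient_surj cp1) => m.
by rewrite tate_mxE hN' hQ mulmxA.
Qed.

End Residue.

Section ResiduePolynomial.
Variables (K : fieldType) (R : comAlgType K) (ev : {rmorphism R -> K}).
Hypothesis evZ : forall c a, ev (c *: a) = c * ev a.
Variables (J : R -> Prop) (iota : {rmorphism {mpoly K[2]} -> R}) (G : {mpoly K[2]}) (T : R).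
Hypothesis iotaC : forall k, iota k%:MP = k%:A.
Let x := iota 'X_0.
Let g := iota G.
Hypotheses (iJ : ideal J) (nzx : forall h, J (x * h) -> J h) (nzg : forall h, J (g * h) -> J h).
Hypothesis J2 : J (iota G^`M(1)).
Hypothesis JT : J (x * iota G^`M(0) - T * g).
Local Notation Jl d := (loc ev (adj J d)).

(** The residue of [dg / g] is computed twice. As a trace it is [ng]. Since [dg = g_x dx] and
    [x g_x = T g] modulo [J], it is also the trace of [T] on the quotient by [x], which is [- nx]
    because [T + 1] is nilpotent there. *)
Lemma residue_vanishing nc ncc nx ng r : [pchar K] =i pred0 ->
  codim (Jl (x * g)) nc -> codim (Jl (x * g * (x * g))) ncc ->
  codim (Jl x) nx -> codim (Jl g) ng -> Jl x ((T + 1) ^+ r) -> nx = 0%N.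
Proof.
move=> ch [p1 cp1] [p2 cp2] [px cpx] [pg cpg] hT.
have nzc h : J (x * g * h) -> J h by rewrite -mulrA => /nzx /nzg.
pose rs := res iJ nzc cp1 cp2.
(* The chain rule [dF = F_x dx + F_y dy]. *)
have dP : forall (F : {mpoly K[2]}) e,
    rs e (iota F) = rs (e * iota F^`M(0)) x + rs (e * iota F^`M(1)) (iota 'X_1).
  apply: mpoly_alg_ind.
  - move=> k e; rewrite !mderivC iotaC /rs resC rmorph0 mulr0 !res0 ?addr0 //; exact: ideal0.
  - move=> i e; rewrite !mderivXU.
    case: i => -[|[|//]] hi; rewrite /= ?rmorph0 ?rmorph1 ?mulr1 ?mulr0.
      rewrite [X in _ + X]res0 ?addr0; last exact: ideal0.
      by congr (rs e (iota 'X__)); apply: val_inj.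
    rewrite [X in X + _]res0 ?add0r; last exact: ideal0.
    by congr (rs e (iota 'X__)); apply: val_inj.
  - move=> p q hp hq e.
    have lin u v w : rs u (v + w) = rs u v + rs u w.
      by rewrite /rs -[v]scale1r res_linear scale1r mul1r.
    rewrite rmorphD lin hp hq !mderivD !rmorphD !mulrDr /rs !resDl.
    by rewrite addrACA.
  - move=> p q hp hq e.
    rewrite rmorphM /= {1}/rs resM -/rs hp hq !mderivM !rmorphD !rmorphM /= !mulrDr /rs !resDl.
    rewrite -!/rs addrACA; congr (_ + _); rewrite addrC; congr (_ + _);
      by congr (rs _ _); ring.
have [lx sx kx] := cpx; have [lg sg kg] := cpg.
have rg : rs x g = ng%:R.
  rewrite -[X in rs X]mul1r -(mxtrace1 K ng).
  apply: (res_trace iJ nzc cp1 cp2 _ cpg); first exact: mulrC.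
  by move=> m; rewrite mul1r mulmx1.
have [N hN] : exists N : 'M[K]_nx, forall m, px (T * m) = px m *m N.
  by apply: (mul_matrix _ _ cpx); apply: loc_adj_ideal.
have rx : rs (T * g) x = \tr N by apply: (res_trace iJ nzc cp1 cp2 _ cpx hN).
have trN : \tr N = - nx%:R.
  have : (N + 1) ^+ r = 0.
    have e m k : px ((T + 1) ^+ k * m) = px m *m (N + 1) ^+ k.
      elim: k m => [|k IH] m; first by rewrite expr0 mul1r expr0 mulmx1.
      rewrite exprSr -mulrA IH mulrDl mul1r -[T * m]scale1r lx scale1r hN.
      by rewrite exprS -mulmxE mulmxA mulmxDr mulmx1.
    apply: (quotient_surj cpx) => m; rewrite -e mulmx0; apply/kx.
    by apply: idealMr => //; apply: loc_adj_ideal.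
  move/mxtrace_nilpotent; rewrite mxtraceD mxtrace1 => h.
  by rewrite -[LHS](addrK (nx%:R)) h sub0r.
have : (ng + nx)%:R = 0 :> K.
  rewrite natrD -rg dP /rs (res_cong iJ nzc cp1 cp2 _ JT) -/rs rx trN.
  rewrite [X in _ + X + _]res0; first by rewrite addr0 addNr.
  by apply: idealM.
by move/eqP; rewrite (iffLR (pcharf0P K) ch) addn_eq0 => /andP[_ /eqP].
Qed.

End ResiduePolynomial.

(** * The local ring of the plane at the origin *)

Section Plane.
Variable K : fieldType.
Local Notation A := {mpoly K[2]}.
Local Notation x := ('X_0 : A).
Local Notation y := ('X_1 : A).
Local Notation ev := (meval (fun _ : 'I_2 => @GRing.zero K)).
Local Notation Z := (@zero_ideal K A).

Definition atline (i : 'I_2) : {poly K} := if i == 0 then 0 else 'X.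

(* restriction to the line [x = 0] *)
Definition rho : A -> {poly K} := mmap (@polyC K) atline.

HB.instance Definition _ := GRing.RMorphism.copy rho (mmap (@polyC K) atline).

Definition yemb (p : {poly K}) : A := (map_poly (@mpolyC 2 K) p).[y].

Lemma yembM p q : yemb (p * q) = yemb p * yemb q.
Proof. by rewrite /yemb rmorphM hornerM. Qed.

Lemma yembD p q : yemb (p + q) = yemb p + yemb q.
Proof. by rewrite /yemb rmorphD hornerD. Qed.

Lemma yemb0 : yemb 0 = 0.
Proof. by rewrite /yemb rmorph0 horner0. Qed.

Lemma yembC c : yemb c%:P = c%:MP.
Proof. by rewrite /yemb map_polyC hornerC. Qed.

Lemma yembX : yemb 'X = y.
Proof. by rewrite /yemb map_polyX hornerX. Qed.

Lemma yembXn k : yemb 'X^k = y ^+ k.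
Proof. by rewrite /yemb rmorphXn /= map_polyX hornerXn. Qed.

Lemma rhoC c : rho c%:MP = c%:P.
Proof. exact: mmapC. Qed.

Lemma rhox : rho x = 0.
Proof. by rewrite /rho mmapX mmap1U. Qed.

Lemma rhoy : rho y = 'X.
Proof. by rewrite /rho mmapX mmap1U. Qed.

Lemma rho_yemb p : rho (yemb p) = p.
Proof.
elim/poly_ind: p => [|p b IH]; first by rewrite yemb0 rmorph0.
by rewrite yembD yembM yembX yembC rmorphD rmorphM /= rhoy rhoC IH.
Qed.

Lemma I2P (i : 'I_2) : i = 0 \/ i = 1.
Proof. by case: i => -[|[|//]] h; [left | right]; apply: val_inj. Qed.

Lemma rho_decomp h : exists q, h = x * q + yemb (rho h).
Proof.
elim/mpoly_alg_ind: h => [c|i|p q [a ha] [b hb]|p q [a ha] [b hb]].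
- by exists 0; rewrite mulr0 add0r rhoC yembC.
- case: (I2P i) => ->; last by exists 0; rewrite mulr0 add0r rhoy yembX.
  by exists 1; rewrite rhox mulr1 yemb0 addr0.
- by exists (a + b); rewrite rmorphD yembD {1}ha {1}hb; ring.
- exists (a * q + yemb (rho p) * b); rewrite rmorphM yembM.
  by move: (yemb (rho p)) (yemb (rho q)) ha hb => P Q -> ->; ring.
Qed.

Lemma rho_eq0 h : rho h = 0 -> exists q, h = x * q.
Proof. by have [q hq] := rho_decomp h => h0; exists q; rewrite {1}hq h0 yemb0 addr0. Qed.

Lemma ev_rho h : ev h = (rho h).[0].
Proof.
elim/mpoly_alg_ind: h => [c|i|p q hp hq|p q hp hq].
- by rewrite mevalC rhoC hornerC.
- by rewrite mevalXU; case: (I2P i) => ->; rewrite ?rhox ?rhoy ?horner0 ?hornerX.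
- by rewrite rmorphD /= hp hq rmorphD hornerD.
- by rewrite rmorphM /= hp hq rmorphM hornerM.
Qed.

Lemma ev_decomp h : exists q r, h = (ev h)%:MP + x * q + y * r.
Proof.
elim/mpoly_alg_ind: h => [c|i|p q [a [b hp]] [a' [b' hq]]|p q [a [b hp]] [a' [b' hq]]].
- by exists 0, 0; rewrite mevalC !mulr0 !addr0.
- rewrite mevalXU; case: (I2P i) => ->.
    by exists 1, 0; rewrite mpolyC0 add0r mulr0 mulr1 addr0.
  by exists 0, 1; rewrite mpolyC0 mulr0 mulr1 !add0r.
- by exists (a + a'), (b + b'); rewrite {1}hp {1}hq rmorphD rmorphD /=; ring.
- exists (a * q + (ev p)%:MP * a'), (b * q + (ev p)%:MP * b').
  by rewrite rmorphM rmorphM /=; move: (ev p)%:MP (ev q)%:MP hp hq => P Q -> ->; ring.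
Qed.

Lemma rho_deriv h : rho h^`M(1) = (rho h)^`().
Proof.
elim/mpoly_alg_ind: h => [c|i|p q hp hq|p q hp hq].
- by rewrite mderivC rmorph0 rhoC derivC.
- rewrite mderivXU; case: (I2P i) => ->; first by rewrite rhox rmorph0 deriv0.
  by rewrite rhoy derivX rmorph1.
- by rewrite mderivD !rmorphD /= derivD hp hq.
- by rewrite mderivM rmorphD !rmorphM /= derivM hp hq.
Qed.

Lemma evZ2 (v : 'I_2 -> K) c (a : A) : meval v (c *: a) = c * meval v a.
Proof. exact: mevalZ. Qed.

Lemma x_neq0 : x != 0.
Proof. by rewrite -msize_poly_eq0 msizeX. Qed.

(** [x] is prime and does not divide [f], so it is a nonzerodivisor modulo [f]. *)
Lemma cancel_x (f h : A) k : rho f != 0 -> adj Z f (x ^+ k * h) -> adj Z f h.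
Proof.
move=> nf; elim: k => [|k IH]; first by rewrite expr0 mul1r.
rewrite exprS -mulrA => -[q hq]; apply: IH.
have e : x * (x ^+ k * h) = f * q by apply/subr0_eq.
have : rho f * rho q = 0 by rewrite -rmorphM -e rmorphM /= rhox mul0r.
move/eqP; rewrite mulf_eq0 (negPf nf) => /eqP /rho_eq0[q' q'E].
exists q'; apply/eqP; rewrite subr_eq0; apply/eqP.
by apply: (mulfI x_neq0); rewrite e q'E mulrCA.
Qed.

Lemma adj1E (f h : A) : adj Z f h <-> exists q, h = f * q.
Proof.
by split=> [[q /subr0_eq ->]|[q ->]]; exists q => //; rewrite /zero_ideal subrr.
Qed.

Lemma adj2E (a b h : A) : adj (adj Z a) b h <-> exists q r, h = a * q + b * r.
Proof.
split=> [[r [q /subr0_eq e]]|[q [r ->]]]; first by exists q, r; rewrite -e subrK.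
by exists r, q; rewrite addrK /zero_ideal subrr.
Qed.

Lemma adj3E (a b c h : A) : adj (adj (adj Z a) b) c h <-> exists q r t, h = a * q + b * r + c * t.
Proof.
split=> [[t /adj2E[q [r e]]]|[q [r [t ->]]]]; first by exists q, r, t; rewrite -e subrK.
by exists t; apply/adj2E; exists q, r; rewrite addrK.
Qed.

Lemma Zi : ideal Z. Proof. exact: zero_idealP. Qed.

Lemma adj2i (a b : A) : ideal (adj (adj Z a) b).
Proof. by do 2 apply: adj_ideal; exact: Zi. Qed.

Lemma loc_finite J a b : ideal J -> loc ev J (x ^+ a) -> loc ev J (y ^+ b) ->
  exists n, codim (loc ev J) n.
Proof.
move=> iJ hx hy; apply: (@codim_finite _ _ (meval (fun _ => 0)) (evZ2 _) _ [:: x; y]).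
- exact: loc_ideal.
- by move=> h; rewrite !inE => /orP[]/eqP->; [exists a | exists b].
- move=> h eh /=; have [q [r ->]] := ev_decomp h; rewrite eh mpolyC0 add0r.
  have iL := loc_ideal ev iJ; exists r; rewrite addrK; exact: adj_gen.
Qed.

(* order of vanishing at the origin along [x = 0] *)
Definition ordy (f : A) j := exists2 c : {poly K}, rho f = 'X^j * c & c.[0] != 0.

Lemma ordy_neq0 f j : ordy f j -> rho f != 0.
Proof.
move=> [c -> c0]; rewrite mulf_neq0 // ?expf_neq0 ?polyX_eq0 //.
by apply: contraNneq c0 => ->; rewrite horner0.
Qed.

Lemma ordy_exists f : rho f != 0 -> exists j, ordy f j.
Proof.
move=> nz; have [j [c nr e]] := multiplicity_XsubC (rho f) 0.
by exists j, c; [rewrite e subr0 mulrC | move: nr; rewrite nz rootE].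
Qed.

Lemma ordy_pow f j : ordy f j -> loc ev (adj (adj Z x) f) (y ^+ j).
Proof.
move=> [c rf c0]; have [q hq] := rho_decomp f.
exists (yemb c); split.
  by rewrite /= ev_rho rho_yemb.
apply/adj2E; exists (- q), 1; rewrite mulr1 {1}hq rf yembM yembXn; ring.
Qed.

Lemma codim_le_ordy f j : ordy f j -> exists n, (n <= j)%N /\ codim (loc ev (adj (adj Z x) f)) n.
Proof.
move=> hf; have iZ := Zi.
have [n1 [le1 c1]] : exists n, (n <= 1)%N /\ codim (adj (adj Z x) y) n.
  apply: (@codim_max _ _ (meval (fun _ => 0)) (evZ2 _)); first exact: adj2i.
  move=> h eh; have [q [r ->]] := ev_decomp h.
  by rewrite eh mpolyC0 add0r; apply/adj2E; exists q, r.
have [n2 [le2 c2]] := codim_adjX j (adj_ideal x iZ) c1.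
have iL : ideal (loc ev (adj (adj Z x) f)) by apply: loc_ideal; exact: adj2i.
have [n3 [le3 c3]] : exists n', (n' <= n2)%N /\ codim (loc ev (adj (adj Z x) f)) n'.
  apply: codimS c2; first exact: ideal_subspace.
  move=> v; apply: adj_min => // [u hu|]; last exact: ordy_pow.
  by apply: loc_sub; apply: adj_sub.
exists n3; split=> //; apply: (leq_trans le3); apply: (leq_trans le2).
by rewrite -[X in (_ <= X)%N]muln1 leq_mul2l le1 orbT.
Qed.

(** The powers of [y] below [y ^+ j] stay independent, since their combinations restrict to
    polynomials of degree less than [j]. *)
Lemma codim_ge_ordy J n j : codim J n -> (forall h, J h -> 'X^j %| rho h) -> (j <= n)%N.
Proof.
move=> cJ hJ; apply: (indep_le (h := fun i : 'I_j => y ^+ i) cJ) => c /hJ.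
rewrite rmorph_sum /=.
have -> : \sum_(i < j) rho (c 0 i *: y ^+ i) = \poly_(i < j) (if insub i is Some k then c 0 k else 0).
  rewrite poly_def; apply: eq_bigr => i _; rewrite valK -mul_mpolyC rmorphM rmorphXn /= rhoy rhoC.
  by rewrite mul_polyC.
move=> h; apply/rowP => i; rewrite mxE.
have : (\poly_(i < j) (if insub i is Some k then c 0 k else 0))`_i = 0.
  have /eqP -> : \poly_(i < j) (if insub i is Some k then c 0 k else 0) == 0 :> {poly K}.
    apply: contraLR h => nz; rewrite gtNdvdp // size_polyXn ltnS; exact: size_poly.
  by rewrite coef0.
by rewrite coef_poly ltn_ord valK.
Qed.

End Plane.

(** * Comparison of two intersection multiplicities on the polar curve *)

Lemma frac_id (F : fieldType) (G U P S1 S2 : F) : G != 0 ->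
  G * P * (S1 + (U / G + 1) * S2) = S1 * (G * P) + (G + U) * (P * S2).
Proof. by move=> G0; field. Qed.

Lemma mulr_shuffle (F : fieldType) (a b c d : F) : a * (b * c) * d = b * (d * c * a).
Proof. by ring. Qed.

Section Polar.
Variable K : fieldType.
Hypothesis ch : [pchar K] =i pred0.
Local Notation A := {mpoly K[2]}.
Local Notation x := ('X_0 : A).
Local Notation y := ('X_1 : A).
Local Notation ev := (meval (fun _ : 'I_2 => @GRing.zero K)).
Local Notation Z := (@zero_ideal K A).
Variables (g : A) (i mu : nat).
Hypothesis og : ordy g i.+1.
Local Notation f := (g^`M(1)).
Local Notation g1 := (g^`M(0)).
Local Notation u := (x * g1).
Local Notation w := (g + u).
Local Notation J0 := (adj Z f).
Hypothesis cmu : codim (loc ev (adj J0 g1)) mu.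

Let i0 : ideal J0. Proof. by apply: adj_ideal; exact: Zi. Qed.

Lemma ordy_polar : ordy f i.
Proof.
have [c rg c0] := og; exists (c *+ i.+1 + 'X * c^`()).
  rewrite rho_deriv rg derivM derivXn /= mulrDr mulrnAl mulrnAr exprSr; congr (_ + _).
  by rewrite mulrA.
rewrite hornerD hornerMn hornerM hornerX mul0r addr0 -mulr_natr mulf_neq0 //.
by rewrite (iffLR (pcharf0P K) ch).
Qed.

Let nf : rho f != 0. Proof. exact: ordy_neq0 ordy_polar. Qed.
Let ng : g != 0.
Proof. by apply: contraTneq (ordy_neq0 og) => ->; rewrite rmorph0 eqxx. Qed.

Lemma evx : ev x = 0. Proof. by rewrite mevalXU. Qed.
Lemma evy : ev y = 0. Proof. by rewrite mevalXU. Qed.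

Lemma evg : ev g = 0.
Proof. by have [c rg _] := og; rewrite ev_rho rg hornerM hornerXn expr0n mul0r. Qed.

Lemma swap_adj (a b h : A) : adj (adj Z a) b h -> adj (adj Z b) a h.
Proof. by move=> /adj2E[q [r ->]]; apply/adj2E; exists r, q; rewrite addrC. Qed.

Lemma codim_x : exists n, (n <= i)%N /\ codim (loc ev (adj J0 x)) n.
Proof.
have [n [le cn]] := codim_le_ordy ordy_polar.
have [n' [le' cn']] : exists n', (n' <= n)%N /\ codim (loc ev (adj J0 x)) n'.
  apply: codimS cn; first by apply: ideal_subspace; apply: loc_ideal; exact: adj2i.
  by move=> v; apply: loc_mono => h; exact: swap_adj.
by exists n'; split=> //; exact: leq_trans le' le.
Qed.

Lemma powers_in J n : ideal J -> codim (loc ev J) n ->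
  exists a b, loc ev J (x ^+ a) /\ loc ev J (y ^+ b).
Proof.
move=> iJ cJ; have iL := loc_ideal ev iJ; have lL := @loc_local _ _ ev J.
have [a ha] := local_nilpotent (@evZ2 K _) iL lL cJ evx.
have [b hb] := local_nilpotent (@evZ2 K _) iL lL cJ evy.
by exists a, b.
Qed.

(** The intersection number of the polar curve with [x g1 = 0]: the factor [x] contributes at most
    [i], the order of [f] on [x = 0], and the factor [g1] contributes [mu]. *)
Lemma codim_u : exists n, (n <= i + mu)%N /\ codim (loc ev (adj J0 u)) n.
Proof.
have [n [le cn]] := codim_x.
have [a [b [ha hb]]] := powers_in (adj_ideal x i0) cn.
have [a' [b' [ha' hb']]] := powers_in (adj_ideal g1 i0) cmu.
have iu := adj_ideal u i0.
have [m cm] : exists m, codim (loc ev (adj J0 u)) m.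
  by apply: (loc_finite (a := a + a') (b := b + b')) => //; rewrite exprD; apply: loc_adjM.
exists m; split=> //.
suff : (m <= n + mu)%N by move=> h; apply: leq_trans h _; rewrite leq_add2r.
apply: (local_sub_additive (a := x) _ _ cm _ _ cn cmu).
- exact: loc_ideal.
- exact: loc_local.
- by move=> v [q hq]; exists q; apply: loc_sub; apply: adj_sub.
- move=> v [q hq]; apply: loc_sub; exists q.
  by rewrite -mulrA -mulrBr; apply: idealM.
Qed.

Lemma codim_uX k n : codim (loc ev (adj J0 u)) n ->
  exists m, (m <= k * n)%N /\ codim (loc ev (adj J0 (u ^+ k))) m.
Proof.
move=> cn; have iu := adj_ideal u i0.
have [a [b [ha hb]]] := powers_in iu cn.
have fin j : exists m, codim (loc ev (adj J0 (u ^+ j))) m.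
  apply: (loc_finite (a := a * j) (b := b * j)); first exact: adj_ideal.
    by rewrite exprM; apply: loc_adjX.
  by rewrite exprM; apply: loc_adjX.
elim: k => [|k [m [le cm]]].
  exists 0%N; split=> //; apply: codim_full; last by apply: loc_ideal; exact: adj_ideal.
  by apply: loc_sub; rewrite expr0 -[X in adj _ _ X](mulr1 1); apply: adj_gen.
have [m' cm'] := fin k.+1; exists m'; split=> //.
rewrite mulSn; suff : (m' <= n + m)%N by move=> h; apply: leq_trans h _; rewrite leq_add2l.
apply: (local_sub_additive (a := u) _ _ cm' _ _ cn cm).
- by apply: loc_ideal; exact: adj_ideal.
- exact: loc_local.
- by move=> v [q hq]; exists q; apply: loc_sub; apply: adj_sub.
- move=> v [q hq]; apply: loc_sub; exists q.
  have -> : u * v - u ^+ k.+1 * q = u * (v - u ^+ k * q) by rewrite exprS; ring.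
  exact: idealM.
Qed.

(* The affine chart [T = u / g] of the blow-up of [(u, g)] on the curve [f = 0],
   at the point [T = -1] where [w = 0]. *)
Local Notation Q := {mpoly K[3]}.
Local Notation T := ('X_(inord 2) : Q).

Definition pt3 (k : 'I_3) : K := if (k < 2)%N then 0 else -1.
Local Notation ev3 := (meval pt3).

Definition emb3t : 2.-tuple Q := [tuple 'X_(inord 0); 'X_(inord 1)].
Definition emb3 : A -> Q := comp_mpoly emb3t.
HB.instance Definition _ := GRing.RMorphism.copy emb3 (comp_mpoly emb3t).

Lemma emb3C c : emb3 c%:MP = c%:MP. Proof. exact: comp_mpolyC. Qed.
Lemma emb3x : emb3 x = 'X_(inord 0).
Proof. by rewrite /emb3 comp_mpolyXU. Qed.
Lemma emb3y : emb3 y = 'X_(inord 1).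
Proof. by rewrite /emb3 comp_mpolyXU. Qed.

Lemma ev3_emb3 h : ev3 (emb3 h) = ev h.
Proof.
elim/mpoly_alg_ind: h => [c|j|p q hp hq|p q hp hq].
- by rewrite emb3C !mevalC.
- by case: (I2P j) => ->; rewrite ?emb3x ?emb3y !mevalXU /pt3 inordK.
- by rewrite [emb3 _]rmorphD !mevalD hp hq.
- by rewrite [emb3 _]rmorphM !mevalM hp hq.
Qed.

Lemma I3P (k : 'I_3) : [\/ k = inord 0, k = inord 1 | k = inord 2].
Proof.
by case: k => -[|[|[|//]]] h; [constructor 1|constructor 2|constructor 3];
   apply: val_inj; rewrite /= inordK.
Qed.

Lemma ev3T : ev3 T = -1.
Proof. by rewrite mevalXU /pt3 inordK. Qed.

Lemma T_decomp (h : Q) : exists h1 h2, h = emb3 h1 + (T + 1) * h2.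
Proof.
elim/mpoly_alg_ind: h => [c|j|p q [a [b hp]] [a' [b' hq]]|p q [a [b hp]] [a' [b' hq]]].
- by exists c%:MP, 0; rewrite mulr0 addr0 emb3C.
- case: (I3P j) => ->.
  + by exists x, 0; rewrite mulr0 addr0 emb3x.
  + by exists y, 0; rewrite mulr0 addr0 emb3y.
  + by exists (-1), 1; rewrite rmorphN rmorph1 mulr1 addrCA addNr addr0.
- by exists (a + a'), (b + b'); rewrite hp hq rmorphD; ring.
- exists (a * a'), (b * q + emb3 a * b'); rewrite rmorphM hp hq; ring.
Qed.

Lemma ev3_decomp (h : Q) : exists q r t,
  h = (ev3 h)%:MP + emb3 x * q + emb3 y * r + (T + 1) * t.
Proof.
have [h1 [h2 e]] := T_decomp h; have [q [r e1]] := ev_decomp h1.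
exists (emb3 q), (emb3 r), h2; rewrite {1}e {1}e1 !rmorphD !rmorphM /= emb3C.
congr (_ %:MP + _ + _ + _); rewrite e mevalD mevalM ev3_emb3 mevalD ev3T meval1 addNr mul0r.
by rewrite addr0.
Qed.

Lemma ev3Z c (a : Q) : ev3 (c *: a) = c * ev3 a.
Proof. exact: mevalZ. Qed.

Local Notation Zq := (@zero_ideal K Q).
Local Notation B0 := (adj (adj Zq (emb3 f)) (emb3 u - T * emb3 g)).

Let iB0 : ideal B0. Proof. by do 2 apply: adj_ideal; exact: zero_idealP. Qed.

(** The ideal of the strict transform at the point [(0, 0, -1)]. Saturating by [x g] makes [x] and
    [g] nonzerodivisors, as the residue calculus requires. *)
Definition chart_ideal (h : Q) := exists s j,
  ev3 s != 0 /\ B0 (s * emb3 (x * g) ^+ j * h).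
Local Notation bb := chart_ideal.

Lemma chart_ideal_ideal : ideal bb.
Proof.
split.
- by exists 1, 0%N; rewrite meval1 oner_eq0 mulr0; split=> //; apply: ideal0.
- move=> a b [s [j [es hs]]] [t [k [et ht]]].
  exists (s * t), (j + k)%N; split; first by rewrite mevalM mulf_neq0.
  have -> : s * t * emb3 (x * g) ^+ (j + k) * (a + b) =
    t * emb3 (x * g) ^+ k * (s * emb3 (x * g) ^+ j * a) +
    s * emb3 (x * g) ^+ j * (t * emb3 (x * g) ^+ k * b) by rewrite exprD; ring.
  by apply: idealD => //; apply: idealM.
- move=> a b [s [j [es hs]]]; exists s, j; split=> //.
  by rewrite mulrCA; apply: idealM.
Qed.

Lemma chart_ideal_local : local ev3 bb.
Proof.
move=> s h es [t [j [et ht]]]; exists (t * s), j; split; first by rewrite mevalM mulf_neq0.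
by have -> : t * s * emb3 (x * g) ^+ j * h = t * emb3 (x * g) ^+ j * (s * h) by ring.
Qed.

Lemma chart_ideal_nz (a b h : A) (h' : Q) : a * b = x * g -> bb (emb3 a * h') -> bb h'.
Proof.
move=> e [s [j [es hs]]]; exists s, j.+1; split=> //.
have -> : s * emb3 (x * g) ^+ j.+1 * h' = emb3 b * (s * emb3 (x * g) ^+ j * (emb3 a * h')).
  by rewrite exprSr -e rmorphM /=; ring.
exact: idealM.
Qed.

Lemma chart_ideal_base h : B0 h -> bb h.
Proof. by exists 1, 0%N; rewrite meval1 oner_eq0 expr0 !mul1r. Qed.

Lemma chart_ideal_f : bb (emb3 f).
Proof.
apply: chart_ideal_base; apply: adj_sub; rewrite -[X in adj _ _ X]mulr1; apply: adj_gen.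
exact: zero_idealP.
Qed.

Lemma chart_ideal_T : bb (emb3 u - T * emb3 g).
Proof.
apply: chart_ideal_base; rewrite -[X in adj _ _ X]mulr1; apply: adj_gen.
by apply: adj_ideal; exact: zero_idealP.
Qed.

Lemma chart_ideal_J0 h : J0 h -> bb (emb3 h).
Proof. by move=> /adj1E[q ->]; rewrite rmorphM; apply: idealMr; [exact: chart_ideal_ideal | exact: chart_ideal_f]. Qed.

Lemma loc_emb3 d h : loc ev (adj J0 d) h -> loc ev3 (adj bb (emb3 d)) (emb3 h).
Proof.
move=> [s [es [q hq]]]; exists (emb3 s); split; first by rewrite /= ev3_emb3.
by exists (emb3 q); rewrite -!rmorphM -rmorphB; apply: chart_ideal_J0.
Qed.

Local Notation Jxy := (loc ev3 (adj (adj bb (emb3 x)) (emb3 y))).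

Definition Temb (p : {poly K}) : Q := (map_poly (@mpolyC 3 K) p).[T].

Lemma ev3_Temb p : ev3 (Temb p) = p.[-1].
Proof.
rewrite /Temb; elim/poly_ind: p => [|p c IH]; first by rewrite rmorph0 !horner0 meval0.
by rewrite rmorphD rmorphM /= map_polyX map_polyC !hornerE mevalD mevalM IH ev3T mevalC.
Qed.

Lemma emb3_max h : ev h = 0 -> adj (adj bb (emb3 x)) (emb3 y) (emb3 h).
Proof.
have ib := chart_ideal_ideal.
move=> eh; have [q [r ->]] := ev_decomp h; rewrite eh mpolyC0 add0r rmorphD !rmorphM.
by exists (emb3 r); rewrite addrK; apply: adj_gen.
Qed.

(** Finiteness of the fibre of the blow-up over the origin. The [k * k] products of powers of [g]
    and [u] outnumber the colength of [u ^+ (k + k)], so they are dependent; dividing a relation by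
    the power of [g] given by its lowest total degree yields a nonzero polynomial in [T] that
    vanishes on the fibre. *)
Lemma T_nilpotent : exists r, Jxy ((T + 1) ^+ r).
Proof.
have ib := chart_ideal_ideal.
have ixy : ideal (adj (adj bb (emb3 x)) (emb3 y)) by do 2 apply: adj_ideal.
have [n [_ cn]] := codim_u.
(* [k > 2 n] gives [(k + k) * n < k * k]. The exponent [k + k] exceeds the total degree of every
   product, so the term in [u ^+ (k + k)] keeps a factor [g] after the division. *)
pose k := (n + n).+1; have [m [lem cm]] := codim_uX (k + k) cn.
pose F (t : 'I_(k * k)) := g ^+ (t %/ k) * u ^+ (t %% k).
have [c [hc cn0]] : exists c : 'rV[K]_(k * k),
    loc ev (adj J0 (u ^+ (k + k))) (\sum_t c 0 t *: F t) /\ c <> 0.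
  apply: NNPP => no; have := indep_le (h := F) cm.
  have -> : (k * k <= m)%N = false.
    apply/negbTE; rewrite -ltnNge; apply: leq_ltn_trans lem _.
    by rewrite /k; nia.
  move=> /(_ _)/notF; apply=> c hc.
  by apply: NNPP => cn0; apply: no; exists c.
pose D (t : 'I_(k * k)) := (t %/ k + t %% k)%N.
have [t1 ct1 _] := row_first_nonzero cn0.
have [|D0 [[t0 ct0 D0E] Dmin]] :=
  @ex_min_nat (fun d => exists2 t, c 0 t != 0 & d = D t) (D t1); first by exists t1.
have ltD t : (D t < k + k)%N.
  have k0 : (0 < k)%N by [].
  have := ltn_pmod t k0; have : (t %/ k < k)%N by rewrite ltn_divLR.
  by rewrite /D; lia.
pose e : Q := \sum_(t | c 0 t != 0) (c 0 t)%:MP * (T ^+ (t %% k) * emb3 g ^+ (D t - D0)).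
move: hc => [s [es [q hq]]].
have h1 : bb (emb3 s * e - emb3 g ^+ (k + k - D0) * (T ^+ (k + k) * emb3 q)).
  have gX j h : bb (emb3 g ^+ j * h) -> bb h.
    elim: j => [|j IH]; first by rewrite expr0 mul1r.
    by rewrite exprS -mulrA => /(@chart_ideal_nz g x 0) -/(_ (mulrC _ _)); exact: IH.
  apply: (gX D0).
  have uX j : bb (emb3 u ^+ j - (T * emb3 g) ^+ j) by apply: idealBX => //; exact: chart_ideal_T.
  have := chart_ideal_J0 hq; rewrite rmorphB !rmorphM rmorph_sum rmorphXn /= => hb.
  have hF : bb (\sum_t emb3 (c 0 t *: F t) - emb3 g ^+ D0 * e).
    rewrite /e mulr_sumr [X in _ - X]big_mkcond /= -sumrB; apply: ideal_sum => // t _.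
    have [c0|cnz] := eqVneq (c 0 t) 0; first by rewrite c0 scale0r rmorph0 subr0; apply: ideal0.
    have leD : (D0 <= D t)%N by apply: Dmin; exists t.
    have -> : emb3 (c 0 t *: F t) - emb3 g ^+ D0 * ((c 0 t)%:MP * (T ^+ (t %% k) * emb3 g ^+ (D t - D0)))
      = (c 0 t)%:MP * emb3 g ^+ (t %/ k) * (emb3 u ^+ (t %% k) - (T * emb3 g) ^+ (t %% k)).
      have -> : emb3 g ^+ D0 * ((c 0 t)%:MP * (T ^+ (t %% k) * emb3 g ^+ (D t - D0))) =
         (c 0 t)%:MP * T ^+ (t %% k) * emb3 g ^+ D t.
        by rewrite -[in RHS](subnKC leD) exprD; ring.
      rewrite -mul_mpolyC rmorphM /= emb3C /F rmorphM !rmorphXn /= /D exprD exprMn; ring.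
    exact: idealM.
  have leD0 : (D0 <= k + k)%N by rewrite D0E ltnW.
  have -> : emb3 g ^+ D0 * (emb3 s * e - emb3 g ^+ (k + k - D0) * (T ^+ (k + k) * emb3 q)) =
    (emb3 s * (\sum_t emb3 (c 0 t *: F t)) - emb3 u ^+ (k + k) * emb3 q)
    - emb3 s * (\sum_t emb3 (c 0 t *: F t) - emb3 g ^+ D0 * e)
    + emb3 q * (emb3 u ^+ (k + k) - (T * emb3 g) ^+ (k + k)).
    have -> : (T * emb3 g) ^+ (k + k) = T ^+ (k + k) * (emb3 g ^+ D0 * emb3 g ^+ (k + k - D0)).
      by rewrite exprMn -[in RHS]exprD subnKC.
    move: (emb3 g ^+ D0) (emb3 g ^+ (k + k - D0)) (T ^+ (k + k)) (emb3 u ^+ (k + k)) (\sum_t _).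
    by move=> *; ring.
  apply: idealD => //; last exact: idealM.
  apply: idealB => //; last exact: idealM.
have gxy : adj (adj bb (emb3 x)) (emb3 y) (emb3 g) by apply: emb3_max; exact: evg.
(* The initial form of the relation. In the fixed degree [D0] the exponent of [u] determines the
   product, so no two coefficients merge and [P] is nonzero. *)
pose P : {poly K} := \sum_(t | (c 0 t != 0) && (D t == D0)) c 0 t *: 'X^(t %% k).
have h2 : Jxy (Temb P).
  exists (emb3 s); split; first by rewrite /= ev3_emb3.
  have -> : emb3 s * Temb P = (emb3 s * e - emb3 g ^+ (k + k - D0) * (T ^+ (k + k) * emb3 q))
     + emb3 g ^+ (k + k - D0) * (T ^+ (k + k) * emb3 q) - emb3 s * (e - Temb P) by ring.
  have pw j : (0 < j)%N -> adj (adj bb (emb3 x)) (emb3 y) (emb3 g ^+ j).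
    by case: j => // j _; rewrite exprS; apply: idealMr.
  apply: idealB => //; last first.
    apply: idealM => //.
    have -> : Temb P = \sum_(t | c 0 t != 0) if D t == D0 then (c 0 t)%:MP * T ^+ (t %% k) else 0.
      rewrite /Temb /P -big_mkcondr rmorph_sum horner_sum; apply: eq_bigr => t _.
      by rewrite -mul_polyC rmorphM /= map_polyC rmorphXn /= map_polyX hornerM hornerC hornerXn.
    rewrite /e -sumrB; apply: ideal_sum => // t ct.
    case: eqP => [->|neD].
      by rewrite subnn expr0 mulr1 subrr; apply: ideal0.
    rewrite subr0; apply: idealM => //; apply: idealM => //; apply: pw.
    have : (D0 <= D t)%N by apply: Dmin; exists t.
    by move: neD; lia.
  apply: idealD => //; first by do 2 apply: adj_sub.
  apply: idealMr => //; apply: pw; rewrite subn_gt0 D0E; exact: ltD.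
have P0 : P != 0.
  apply/eqP => /(congr1 (fun p : {poly K} => p`_(t0 %% k))); rewrite coef0 coef_sum.
  rewrite (bigD1 t0) /=; last by rewrite ct0 D0E eqxx.
  rewrite coefZ coefXn eqxx mulr1 big1 ?addr0; first exact/eqP.
  move=> t /andP[/andP[_ /eqP Dt] ne]; rewrite coefZ coefXn.
  case: eqP => [e0|]; last by rewrite mulr0.
  case/negP: ne; apply/eqP; apply: val_inj => /=.
  by rewrite (divn_eq t k) (divn_eq t0 k) e0; move: Dt; rewrite D0E /D -e0; lia.
(* The cofactor of the power of [T + 1] is nonzero at the point [T = -1], so it cancels. *)
have [r [P' nr PE]] := multiplicity_XsubC P (-1); rewrite P0 /= rootE in nr.
exists r; apply: (loc_local (s := Temb P')); first by rewrite /= ev3_Temb.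
move: h2; rewrite PE /Temb rmorphM hornerM rmorphXn /= rmorphB /= map_polyX map_polyC /=.
by rewrite horner_exp hornerD hornerN hornerX hornerC mpolyCN mpolyC1 opprK.
Qed.

Lemma chart_finite (J1 : Q -> Prop) a b : ideal J1 -> (forall h, bb h -> J1 h) ->
  loc ev3 J1 (emb3 x ^+ a) -> loc ev3 J1 (emb3 y ^+ b) ->
  (exists r, loc ev3 J1 ((T + 1) ^+ r)) /\ exists n, codim (loc ev3 J1) n.
Proof.
move=> i1 sub hx hy.
have hT : exists r, loc ev3 J1 ((T + 1) ^+ r).
  have [r hr] := T_nilpotent; exists (r * b * a)%N.
  have h1 : loc ev3 (adj (adj J1 (emb3 x)) (emb3 y)) ((T + 1) ^+ r).
    by apply: loc_mono hr => v; apply: adj_mono => v1; apply: adj_mono => v2; exact: sub.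
  have h2 : loc ev3 (adj J1 (emb3 x)) ((T + 1) ^+ (r * b)).
    rewrite exprM; apply: loc_adj_nilpotent h1 _; first exact: adj_ideal.
    by apply: loc_mono hy => v; exact: adj_sub.
  by rewrite exprM; apply: loc_adj_nilpotent h2 _.
split=> //; have [r hr] := hT.
apply: (@codim_finite _ _ (meval pt3) ev3Z _ [:: emb3 x; emb3 y; T + 1]).
- exact: loc_ideal.
- by move=> h; rewrite !inE => /or3P[]/eqP->; [exists a | exists b | exists r].
- move=> h eh /=; have [q [r' [t ->]]] := ev3_decomp h.
  have iL := loc_ideal ev3 i1.
  rewrite /= in eh; rewrite eh mpolyC0 add0r; exists t; rewrite addrK.
  by exists r'; rewrite addrK; exact: adj_gen.
Qed.

(** By [residue_vanishing] the quotient by [x] is zero, so the ideal contains some [s - x q] that is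
    nonzero at the point: the strict transform misses it. The rest provides the finite colengths
    needed for the residues. *)
Lemma chart_trivial : bb 1.
Proof.
have ib := chart_ideal_ideal.
have [n [_ cn]] := codim_x; have [a [b [ha hb]]] := powers_in (adj_ideal x i0) cn.
have [n' [_ cn']] := codim_u; have [a' [b' [ha' hb']]] := powers_in (adj_ideal u i0) cn'.
(* In the chart [u = T g], so the powers of [x] and [y] known to lie in the ideal of [u] also lie in
   that of [g]. *)
have subu h : loc ev3 (adj bb (emb3 u)) h -> loc ev3 (adj bb (emb3 g)) h.
  apply: loc_mono => v [q hq]; exists (T * q).
  have -> : v - emb3 g * (T * q) = (v - emb3 u * q) + (emb3 u - T * emb3 g) * q by ring.
  by apply: idealD => //; apply: idealMr => //; exact: chart_ideal_T.
have X d k (h : A) : loc ev (adj J0 d) (h ^+ k) -> loc ev3 (adj bb (emb3 d)) (emb3 h ^+ k).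
  by move=> /loc_emb3; rewrite rmorphXn.
have /X hax := ha; have /X hbx := hb.
have /X/subu hag := ha'; have /X/subu hbg := hb'.
have fin d k l : loc ev3 (adj bb d) (emb3 x ^+ k) -> loc ev3 (adj bb d) (emb3 y ^+ l) ->
  (exists r, loc ev3 (adj bb d) ((T + 1) ^+ r)) /\ exists n, codim (loc ev3 (adj bb d)) n.
  by apply: chart_finite; [exact: adj_ideal | move=> h; exact: adj_sub].
have [[r hr] [nx cx]] := fin _ _ _ hax hbx.
have [_ [ng' cg]] := fin _ _ _ hag hbg.
have hac : loc ev3 (adj bb (emb3 x * emb3 g)) (emb3 x ^+ (a + a')).
  by rewrite exprD; exact: (loc_adjM ib hax hag).
have hbc : loc ev3 (adj bb (emb3 x * emb3 g)) (emb3 y ^+ (b + b')).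
  by rewrite exprD; exact: (loc_adjM ib hbx hbg).
have [_ [nc cc]] := fin _ _ _ hac hbc.
have hacc := loc_adjM ib hac hac; have hbcc := loc_adjM ib hbc hbc.
rewrite -exprD in hacc; rewrite -exprD in hbcc.
have [_ [ncc ccc]] := fin _ (a + a' + (a + a'))%N (b + b' + (b + b'))%N (hacc) (hbcc).
have nx0 : nx = 0%N.
  apply: (@residue_vanishing _ _ (meval pt3) bb emb3 g T _ ib _ _ _ _ nc ncc nx ng' r) => //.
  - by move=> k; rewrite /= emb3C alg_mpolyC.
  - by move=> h; apply: (@chart_ideal_nz x g 0).
  - by move=> h; apply: (@chart_ideal_nz g x 0); rewrite mulrC.
  - exact: chart_ideal_f.
  - by rewrite -rmorphM; exact: chart_ideal_T.
move: cx; rewrite nx0 => -[p [_ _ kp]].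
have /kp[s [es [q hq]]] : p 1 = 0 by rewrite [p 1]thinmx0.
apply: (chart_ideal_local (s := s - emb3 x * q)); last by move: hq; rewrite !mulr1.
by rewrite /= mevalB mevalM ev3_emb3 evx mul0r subr0.
Qed.

(** The [l]-th power of the ideal [(w, g) = (u, g)]. *)
Fixpoint Ip (l : nat) (h : A) : Prop :=
  if l is k.+1 then exists a b, [/\ Ip k a, Ip k b & h = w * a + g * b] else True.

Lemma Ip_ideal l : ideal (Ip l).
Proof.
elim: l => [|l IH]; first by split.
split.
- by exists 0, 0; rewrite !mulr0 addr0; split=> //; apply: ideal0.
- move=> p q [a [b [ha hb ->]]] [a' [b' [ha' hb' ->]]].
  by exists (a + a'), (b + b'); split; [apply: idealD|apply: idealD|ring].
- move=> p q [a [b [ha hb ->]]].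
  by exists (p * a), (p * b); split; [apply: idealM|apply: idealM|ring].
Qed.

Lemma Ip_g l h : Ip l h -> Ip l.+1 (g * h).
Proof.
by move=> H; exists 0, h; split=> //; [apply: ideal0; exact: Ip_ideal|rewrite mulr0 add0r].
Qed.

Lemma Ip_w l h : Ip l h -> Ip l.+1 (w * h).
Proof.
by move=> H; exists h, 0; split=> //; [apply: ideal0; exact: Ip_ideal|rewrite mulr0 addr0].
Qed.

Lemma Ip_u l h : Ip l h -> Ip l.+1 (u * h).
Proof.
move=> H; have -> : u * h = w * h - g * h by ring.
by apply: idealB; [exact: Ip_ideal | exact: Ip_w | exact: Ip_g].
Qed.

Lemma Ip_gX l k h : Ip l h -> Ip (k + l) (g ^+ k * h).
Proof.
move=> H; elim: k => [|k IH]; first by rewrite expr0 mul1r.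
by rewrite exprS -mulrA; apply: Ip_g.
Qed.

Lemma Ip_mul k l a b : Ip k a -> Ip l b -> Ip (k + l) (a * b).
Proof.
elim: k a => [|k IH] a; first by move=> _; apply: idealM; exact: Ip_ideal.
move=> [a1 [a2 [h1 h2 ->]]] hb.
by exists (a1 * b), (a2 * b); split; [exact: IH|exact: IH|ring].
Qed.

(** Among the monomials of degree [l.+1] in [w] and [g], only the pure power of [g] has no factor
    [w]. *)
Lemma Ip_split l a : Ip l a -> exists z q, Ip l z /\ g * a = w * z + g ^+ l.+1 * q.
Proof.
elim: l a => [|l IH] a; first by exists 0, a; split=> //; rewrite mulr0 add0r expr1.
move=> [a1 [a2 [h1 /IH[z [q [hz e]]] ->]]].
exists (g * (a1 + z)), q; split.
  by apply: Ip_g; apply: idealD => //; exact: Ip_ideal.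
by rewrite mulrDr e [g ^+ l.+2]exprS; ring.
Qed.

Local Notation Fr := {fraction A}.
Local Notation "%f a" := (tofrac a) (at level 5, a at level 5).

Definition fracpt (k : 'I_3) : Fr :=
  if val k == 0%N then %f x else if val k == 1%N then %f y else %f u / %f g.

Definition fC : K -> Fr := (@tofrac A \o @mpolyC 2 K).
HB.instance Definition _ := GRing.RMorphism.copy fC (@tofrac A \o @mpolyC 2 K).
(** The substitution [T = u / g], which kills [u - T g] and brings a membership in the chart ideal
    back to the plane. *)
Definition tau : Q -> Fr := mmap fC fracpt.
HB.instance Definition _ := GRing.RMorphism.copy tau (mmap fC fracpt).

Lemma tau_emb3 h : tau (emb3 h) = %f h.
Proof.
elim/mpoly_alg_ind: h => [c|j|p q hp hq|p q hp hq].
- by rewrite emb3C /tau mmapC.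
- by case: (I2P j) => ->; rewrite ?emb3x ?emb3y /tau mmapX mmap1U /fracpt /= inordK.
- by rewrite [emb3 _]rmorphD [tau _]rmorphD /= hp hq [RHS]rmorphD.
- by rewrite [emb3 _]rmorphM [tau _]rmorphM /= hp hq [RHS]rmorphM.
Qed.

Lemma tauT : tau T = %f u / %f g.
Proof. by rewrite /tau mmapX mmap1U /fracpt /= inordK. Qed.

Let fg0 : %f g != 0. Proof. by rewrite tofrac_eq0. Qed.

Lemma tau_denom (h : Q) : exists l z, Ip l z /\ %f (g ^+ l) * tau h = %f z.
Proof.
elim/mpoly_alg_ind: h => [c|j|p q [l [z [hz e]]] [l' [z' [hz' e']]]
  |p q [l [z [hz e]]] [l' [z' [hz' e']]]].
- by exists 0%N, c%:MP; split=> //; rewrite expr0 rmorph1 mul1r -tau_emb3 emb3C.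
- case: (I3P j) => ->.
  + by exists 0%N, x; split=> //; rewrite expr0 rmorph1 mul1r -tau_emb3 emb3x.
  + by exists 0%N, y; split=> //; rewrite expr0 rmorph1 mul1r -tau_emb3 emb3y.
  + exists 1%N, (u * 1); split; first exact: Ip_u.
    by rewrite expr1 tauT mulr1 mulrC divfK.
- exists (l' + l)%N, (g ^+ l' * z + z' * g ^+ l); split.
    apply: idealD; [exact: Ip_ideal | exact: Ip_gX |].
    by apply: Ip_mul => //; rewrite -[_ ^+ l]mulr1 -[l in Ip l]addn0; apply: Ip_gX.
  by rewrite rmorphD rmorphD !rmorphM /= -e -e' exprD rmorphM; ring.
- exists (l + l')%N, (z * z'); split; first exact: Ip_mul.
  by rewrite !rmorphM /= -e -e' exprD rmorphM /=; ring.
Qed.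

(** On the polar curve [w] generates a reduction of [(w, g)] near the origin. By [chart_trivial]
    some [s] that is nonzero at the point becomes a member of [B0] after multiplication by a power
    of [x g]. Writing [s = s1 + (T + 1) s2] and substituting [T + 1 = w / g] gives the relation once
    denominators are cleared. *)
Lemma polar_relation : exists l s z, [/\ ev s != 0, Ip l z & J0 (s * g ^+ l.+1 - w * z)].
Proof.
have [s [j [es]]] := chart_trivial; rewrite mulr1 => -[B [A' /subr0_eq hAB]].
have e1 : s * emb3 (x * g) ^+ j = emb3 f * A' + (emb3 u - T * emb3 g) * B.
  by rewrite -hAB subrK.
have [s1 [s2 sE]] := T_decomp s.
have es1 : ev s1 != 0.
  by move: es; rewrite sE mevalD mevalM ev3_emb3 mevalD ev3T meval1 addNr mul0r addr0.
have [l [z [hz ez]]] := tau_denom s2; have [l' [a [_ ea]]] := tau_denom A'.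
have tM a1 a2 : tau (a1 * a2) = tau a1 * tau a2 by exact: rmorphM.
have tD a1 a2 : tau (a1 + a2) = tau a1 + tau a2 by exact: rmorphD.
have tB a1 a2 : tau (a1 - a2) = tau a1 - tau a2 by exact: rmorphB.
have t1 : tau 1 = 1 by exact: rmorph1.
have e2 : tau s * %f (x * g) ^+ j = %f f * tau A'.
  have := congr1 tau e1; rewrite -[emb3 (x * g) ^+ j]rmorphXn tM tau_emb3 rmorphXn /= => ->.
  by rewrite tD !tM tB tM !tau_emb3 tauT divfK // subrr mul0r addr0.
have ts : %f (g ^+ l.+1) * tau s = %f (s1 * g ^+ l.+1 + w * z).
  rewrite sE tD tM tau_emb3 tD t1 tauT exprS [%f (g * _)]rmorphM /=.
  have -> : %f (s1 * (g * g ^+ l) + w * z) =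
      %f s1 * (%f g * %f (g ^+ l)) + (%f g + %f u) * (%f (g ^+ l) * tau s2).
    by rewrite ez -[%f g + _]rmorphD -!rmorphM -rmorphD.
  exact: frac_id.
have e3 : x ^+ j * (s1 * g ^+ (l + j + l').+1 + w * (z * g ^+ (j + l'))) = f * (a * g ^+ l.+1).
  apply/eqP; rewrite -tofrac_eq; apply/eqP.
  have -> : x ^+ j * (s1 * g ^+ (l + j + l').+1 + w * (z * g ^+ (j + l'))) =
     (s1 * g ^+ l.+1 + w * z) * (x * g) ^+ j * g ^+ l'.
    by rewrite exprMn -[(l + j + l').+1]/((l.+1 + j + l')%N) !exprD; ring.
  have fM a1 a2 : %f (a1 * a2) = %f a1 * %f a2 by exact: rmorphM.
  have fX : %f ((x * g) ^+ j) = %f (x * g) ^+ j by exact: rmorphXn.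
  rewrite [LHS]fM [%f (_ * (x * g) ^+ j)]fM -ts fX [RHS]fM [%f (a * _)]fM -ea.
  rewrite -[X in X * _ = _]mulrA e2.
  exact: mulr_shuffle.
exists (l + j + l')%N, s1, (- (z * g ^+ (j + l'))); split=> //.
  apply: idealN; first exact: Ip_ideal.
  by rewrite mulrC -addnA [(l + _)%N]addnC; exact: Ip_gX.
rewrite mulrN opprK; apply: (cancel_x (k := j)) => //.
by apply/adj1E; exists (a * g ^+ l.+1).
Qed.

Lemma nonzerodivisor_mod_f e n : codim (loc ev (adj J0 e)) n ->
  forall h, loc ev J0 (e * h) -> loc ev J0 h.
Proof.
move=> cn h [t [et ht]]; have [a [b [[s [es [q hq]]] _]]] := powers_in (adj_ideal e i0) cn.
exists (s * t); split; first by rewrite rmorphM mulf_neq0.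
apply: (cancel_x (k := a)) => //.
have -> : x ^+ a * (s * t * h) = t * h * (s * x ^+ a - e * q) + q * (t * (e * h)) by ring.
by apply: idealD => //; apply: idealM.
Qed.

(* Along a branch of the polar curve [f = 0] one has [dg = g1 dx], so [u / g] tends to the
   positive number [ord g / ord x], never to [-1]: the sum [w = g + u] does not cancel. *)
Lemma polar_comparison nw nu : codim (loc ev (adj J0 w)) nw -> codim (loc ev (adj J0 u)) nu ->
  (nw <= nu)%N.
Proof.
move=> cw cu; have [l [s [z [es hz hs]]]] := polar_relation.
have iI := Ip_ideal l.
(* [M e] is [e I^l + (f)] with [I = (w, g)]. Locally [I^(l+1)], hence [u I^l], lies in [w I^l]
   modulo [f]. The colengths of [w I^l] and [u I^l] are estimated by those of [w] and [u] plus that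
   of [I^l], which cancels. *)
pose M e (h : A) := exists2 a, Ip l a & J0 (h - e * a).
have iM e : ideal (M e).
  split.
  - by exists 0; [exact: ideal0 | rewrite mulr0 subr0; exact: ideal0].
  - move=> p q [a ha hp] [b hb hq]; exists (a + b); first exact: idealD.
    by rewrite mulrDr opprD addrACA; exact: idealD.
  - move=> p q [a ha hq]; exists (p * a); first exact: idealM.
    have -> : p * q - e * (p * a) = p * (q - e * a) by ring.
    exact: idealM.
have iN e := loc_ideal ev (iM e); have lN e := @loc_local _ _ ev (M e).
have M0 e h : J0 h -> M e h.
  by move=> hh; exists 0; [exact: ideal0 | rewrite mulr0 subr0].
have gl q : loc ev (M w) (g ^+ l.+1 * q).
  exists s; split=> //; exists (z * q); first exact: idealMr.
  have -> : s * (g ^+ l.+1 * q) - w * (z * q) = (s * g ^+ l.+1 - w * z) * q by ring.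
  exact: idealMr.
have uw h : M u h -> loc ev (M w) h.
  move=> [a ha hh]; have [z' [q [hz' e]]] := Ip_split ha.
  have -> : h = (h - u * a) + w * a - g * a by ring.
  have ww b : Ip l b -> loc ev (M w) (w * b).
    by move=> hb; apply: loc_sub; exists b => //; rewrite subrr; exact: ideal0.
  apply: idealB => //.
    by apply: idealD => //; [apply: loc_sub; exact: M0 | exact: ww].
  by rewrite e; apply: idealD => //; exact: ww.
have w1 h : M w h -> M 1 h.
  by move=> [a ha hh]; exists (w * a); [exact: idealM | rewrite mul1r].
have [nNu cNu] : exists n, codim (loc ev (M u)) n.
  have [a [b [ha hb]]] := powers_in (adj_ideal u i0) cu.
  have sub h : loc ev (adj J0 (u ^+ l.+1)) h -> loc ev (M u) h.
    apply: loc_mono => v [q hq]; exists (u ^+ l * q); last by rewrite mulrA -exprS.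
    apply: idealMr => //; elim: (l) => // k IH; rewrite exprS; exact: Ip_u.
  by apply: (loc_finite (a := a * l.+1) (b := b * l.+1)) => //; apply: sub;
     rewrite exprM; exact: loc_adjX.
have uwL h : loc ev (M u) h -> loc ev (M w) h by apply: loc_min.
have [nNw [_ cNw]] := codimS (ideal_subspace (iN w)) uwL cNu.
have [nN [_ cN]] := codimS (ideal_subspace (iN 1)) (fun h => @loc_mono _ _ ev _ _ h w1) cNw.
have h1 : (nw + nN <= nNw)%N.
  apply: (codim_super_additive (f := fun v => w * v) _ _ _ _ cNw cw cN).
  - exact: mul_linear.
  - move=> h; apply: loc_mono => v [a ha hv]; by exists a.
  - by move=> v; apply: loc_sub; apply: adj_gen.
  - move=> v; split=> [[t [et [a ha]]]|[t [et [a ha hv]]]].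
      rewrite mul1r => hv; exists t; split=> //; exists a => //.
      have -> : t * (w * v) - w * a = w * (t * v - a) by ring.
    exact: idealM.
    have : loc ev J0 (w * (t * v - a)).
      by apply: loc_sub; have -> : w * (t * v - a) = t * (w * v) - w * a by ring.
    move=> /(nonzerodivisor_mod_f cw)[t' [et' ht']].
    exists (t' * t); split; first by rewrite rmorphM mulf_neq0.
    exists (t' * a); first exact: idealM.
    by rewrite mul1r -mulrA -mulrBr.
have h2 : (nNu <= nu + nN)%N.
  apply: (local_sub_additive (a := u) _ _ cNu _ _ cu cN) => //.
  - by move=> v [q hq]; exists q; apply: loc_sub; exact: M0.
  - move=> v [a ha]; rewrite mul1r => hv; apply: loc_sub; exists a => //.
    by rewrite -mulrBr; exact: idealM.
have h3 := codim_mono uwL cNu cNw.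
lia.
Qed.

End Polar.

(** * Milnor and Tjurina numbers after adding the line [x = 0] *)

Lemma dvdp_unit0 (K : fieldType) (s h : {poly K}) j : s.[0] != 0 -> 'X^j %| s * h -> 'X^j %| h.
Proof.
move=> s0; rewrite Gauss_dvdpr // coprimep_expl // coprimep_sym coprimepX.
by rewrite rootE.
Qed.

Section LocalBound.
Variable K : fieldType.
Hypothesis ch : [pchar K] =i pred0.
Local Notation A := {mpoly K[2]}.
Local Notation x := ('X_0 : A).
Local Notation ev := (meval (fun _ : 'I_2 => @GRing.zero K)).
Local Notation Z := (@zero_ideal K A).
Variables (g : A) (i : nat).
Hypothesis og : ordy g i.+1.
Local Notation g1 := (g^`M(0)).
Local Notation g2 := (g^`M(1)).
Local Notation w := (g + x * g1).

Lemma adj3i (a b c : A) : ideal (adj (adj (adj Z a) b) c).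
Proof. by do 3 apply: adj_ideal; exact: Zi. Qed.

(** As [w] is the [x]-derivative of [x g], the Milnor number splits into the intersections of [w]
    with [x] and with [g2]. The first is at most [i.+1] because [w] restricts to [g] on [x = 0]; the
    second is at most [i + mu'] by [polar_comparison] and [codim_u]. *)
Lemma milnor_bound mu' muC : codim (loc ev (adj (adj Z g2) g1)) mu' ->
  codim (loc ev (adj (adj Z (x * g2)) w)) muC -> (muC <= i.+1 + (i + mu'))%N.
Proof.
move=> c' cC.
have [nw [_ cw]] : exists n, (n <= muC)%N /\ codim (loc ev (adj (adj Z g2) w)) n.
  apply: codimS cC; first by apply: ideal_subspace; apply: loc_ideal; exact: adj2i.
  move=> v; apply: loc_mono => h /adj2E[q [r ->]]; apply/adj2E.
  by exists (x * q), r; ring.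
have [nu [leu cu]] := codim_u ch og c'.
have le1 := polar_comparison ch og c' cw cu.
have ow : ordy w i.+1.
  by have [c rg c0] := og; exists c => //; rewrite rmorphD rmorphM /= rhox mul0r addr0.
have [nx [lex cx]] := codim_le_ordy ow.
suff : (muC <= nx + nw)%N by lia.
apply: (local_sub_additive (a := x) _ _ cC _ _ cx cw).
- by apply: loc_ideal; exact: adj2i.
- exact: loc_local.
- move=> v /adj2E[q [r ->]]; exists q; rewrite addrAC subrr add0r.
  by apply: loc_sub; apply: adj_gen; apply: adj_ideal; exact: Zi.
- move=> v /adj2E[q [r ->]]; apply: loc_sub; apply/adj2E; exists q, (x * r); ring.
Qed.

(** The Tjurina algebra of [x g] is filtered by [x] and then by [g1]. The three pieces account for
    [i.+1], for [tau'] and for the colength of the ideal [J3] of those [h] with [g1 h] in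
    [(g, x g1, g2)], and [q] is the least order of [J3] along [x = 0]. An element of order [q]
    provides a logarithmic derivation of [g] to be compared with [(A1, A2)]. *)
Lemma tjurina_bound tau' tauC :
  codim (loc ev (adj (adj (adj Z g) g1) g2)) tau' ->
  codim (loc ev (adj (adj (adj Z (x * g)) w) (x * g2))) tauC ->
  exists q, (tau' + i.+1 + q <= tauC)%N /\
    forall A1 A2 e : A, rho A1 = 0 -> A1 * g1 + A2 * g2 = e * g -> 'X^(i.+1 - q) %| rho A2.
Proof.
move=> c' cC.
have rg0 := ordy_neq0 og; have [cg rg cg0] := og.
pose J2 := loc ev (adj (adj (adj Z g) (x * g1)) g2).
have i2 : ideal J2 by apply: loc_ideal; exact: adj3i.
have sub2 h : loc ev (adj (adj (adj Z (x * g)) w) (x * g2)) h -> J2 h.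
  apply: loc_mono => v /adj3E[q [r [t ->]]]; apply/adj3E.
  by exists (x * q + r), r, (x * t); ring.
have [n2 [_ c2]] := codimS (ideal_subspace i2) sub2 cC.
have iX : ideal (loc ev (adj (adj Z x) g)) by apply: loc_ideal; exact: adj2i.
have subX h : loc ev (adj (adj (adj Z (x * g)) w) (x * g2)) h -> loc ev (adj (adj Z x) g) h.
  apply: loc_mono => v /adj3E[q [r [t ->]]]; apply/adj2E.
  by exists (g * q + g1 * r + g2 * t), r; ring.
have [nX [_ cX]] := codimS (ideal_subspace iX) subX cC.
have leX : (i.+1 <= nX)%N.
  apply: (codim_ge_ordy cX) => h [s [es /adj2E[q [r e]]]].
  apply: (@dvdp_unit0 _ (rho s)); first by rewrite -ev_rho.
  by rewrite -rmorphM e rmorphD !rmorphM /= rhox mul0r add0r rg -mulrA dvdp_mulr.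
have le1 : (nX + n2 <= tauC)%N.
  apply: (codim_super_additive (f := fun v => x * v) _ subX _ _ cC cX c2).
  - exact: mul_linear.
  - by move=> v; apply: loc_sub; apply/adj2E; exists v, 0; rewrite mulr0 addr0.
  - move=> v; split=> [[s [es /adj3E[q [r [t e]]]]]|[s [es /adj3E[q [r [t e]]]]]]; exists s; split=> //.
      apply/adj3E; exists (q - r), (x * r), t.
      by rewrite mulrCA e; ring.
    have : rho g * rho r = 0.
      have := congr1 (@rho K) e; rewrite !(rmorphM, rmorphD) /= rhox !(mul0r, mulr0, add0r, addr0).
      by move=> <-.
    move/eqP; rewrite mulf_eq0 (negPf rg0) => /eqP /rho_eq0[r' rE].
    apply/adj3E; exists (q + r'), r', t; apply: (mulfI (x_neq0 K)).
    by rewrite mulrCA e rE; ring.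
pose J3 h := J2 (g1 * h).
have i3 : ideal J3.
  split; first by rewrite /J3 mulr0; exact: ideal0.
    by move=> u v hu hv; rewrite /J3 mulrDr; exact: idealD.
  by move=> a u hu; rewrite /J3 mulrCA; exact: idealM.
have [n3 [_ c3]] := codimS (ideal_subspace i3) (fun h (H : J2 h) => idealM g1 i2 H) c2.
have le2 : (tau' + n3 <= n2)%N.
  apply: (codim_super_additive (f := fun v => g1 * v) _ _ _ _ c2 c' c3) => //.
  - exact: mul_linear.
  - move=> v; apply: loc_mono => h /adj3E[q [r [t ->]]]; apply/adj3E.
    by exists q, (x * r), t; ring.
  - move=> v; apply: loc_sub; apply/adj3E; exists 0, v, 0; ring.
have [h0 h0J h0n] : exists2 h, J3 h & rho h != 0.
  apply: NNPP => no; have : (n3.+1 <= n3)%N; last by rewrite ltnn.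
  apply: (codim_ge_ordy c3) => h hh; have -> : rho h = 0; last exact: dvdp0.
  by apply/eqP/negP => /negP nz; apply: no; exists h.
have [j0 oj0] := ordy_exists h0n.
have [|q [[h hJ oh] qmin]] := @ex_min_nat (fun q => exists2 h, J3 h & ordy h q) j0.
  by exists h0.
exists q; split.
  have : (q <= n3)%N; last by lia.
  apply: (codim_ge_ordy c3) => h' hJ'; have [->|nz] := eqVneq (rho h') 0; first exact: dvdp0.
  have [j oj] := ordy_exists nz; have lej : (q <= j)%N by apply: qmin; exists h'.
  have [c -> _] := oj; apply: dvdp_mulr; exact: dvdp_exp2l.
move=> A1 A2 e rA1 hA.
have [s [es /adj3E[a [b [c hs]]]]] := hJ.
(* [(p1, - c)] is a second logarithmic derivation of [g], and [D] is its determinant with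
   [(A1, A2)]. By Cramer's rule [g1 D] and [g2 D] lie in [(g)]. *)
pose p1 := s * h - x * b; pose D := A1 * (- c) - A2 * p1.
have hp : p1 * g1 - c * g2 = a * g.
  have -> : p1 * g1 - c * g2 = s * (g1 * h) - x * g1 * b - g2 * c by rewrite /p1; ring.
  by rewrite hs; ring.
have D1 : g1 * D = g * (- c * e - A2 * a).
  have -> : g1 * D = - c * (A1 * g1 + A2 * g2) - A2 * (p1 * g1 - c * g2) by rewrite /D; ring.
  by rewrite hA hp; ring.
have D2 : g2 * D = g * (A1 * a - p1 * e).
  have -> : g2 * D = A1 * (p1 * g1 - c * g2) - p1 * (A1 * g1 + A2 * g2) by rewrite /D; ring.
  by rewrite hA hp; ring.
have [k hk] := local_nilpotent (@evZ2 K _) (loc_ideal ev (adj3i g g1 g2))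
  (@loc_local _ _ ev _) c' (evx K).
have [t [et /adj3E[a1 [a2 [a3 ht]]]]] := hk.
(* Up to the factor [t], a power of [x] lies in [(g, g1, g2)], hence multiplies [D] into [(g)]; it
   cancels because [x] does not divide [g]. *)
have /adj1E[r hr] : adj Z g (t * D).
  apply: (cancel_x (k := k)) => //; apply/adj1E.
  exists (a1 * D + a2 * (- c * e - A2 * a) + a3 * (A1 * a - p1 * e)).
  have -> : x ^+ k * (t * D) = (t * x ^+ k) * D by ring.
  rewrite ht.
  have -> : (g * a1 + g1 * a2 + g2 * a3) * D = g * (a1 * D) + a2 * (g1 * D) + a3 * (g2 * D).
    by ring.
  by rewrite D1 D2; ring.
have [chh rh ch0] := oh.
(* On [x = 0] the component [A1] vanishes and [p1] becomes [s h], so [D] restricts to [- s h A2]. *)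
have : 'X^(i.+1) %| (rho t * rho s * chh) * ('X^q * rho A2).
  have -> : rho t * rho s * chh * ('X^q * rho A2) = - (rho g * rho r).
    have -> : rho g * rho r = rho t * rho D by rewrite -[LHS]rmorphM -hr rmorphM.
    by rewrite /D /p1 !(rmorphB, rmorphM, rmorphN) /= rA1 rhox rh; ring.
  by rewrite rg dvdpNr -mulrA dvdp_mulr.
move/dvdp_unit0; rewrite !hornerM !mulf_neq0 -?ev_rho // => /(_ isT).
have [leq|/ltnW leq] := leqP q i.+1; last first.
  by move=> _; rewrite (eqP (leq : (_ - _ == 0)%N)) expr0 dvd1p.
by rewrite -{1}(subnKC leq) exprD dvdp_mul2l // expf_neq0 // polyX_eq0.
Qed.

End LocalBound.

(** * Affine charts *)

Section MpolyFacts.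
Variable K : fieldType.
Local Notation P := {mpoly K[3]}.
Local Notation Fr := {fraction P}.

Lemma homog1E (l : P) : l \is 1.-homog -> l = \sum_i l@_U_(i) *: 'X_i.
Proof.
move=> hl; apply/mpolyP => m; rewrite raddf_sum /=.
have [/eqP/mdeg1P[j /eqP ->]|nm] := eqVneq (mdeg m) 1%N.
  rewrite (bigD1 j) //= mcoeffZ mcoeffXU eqxx mulr1 big1 ?addr0 // => i ni.
  by rewrite mcoeffZ mcoeffXU (negPf ni) mulr0.
rewrite (dhomog_nemf_coeff hl) // big1 // => i _; rewrite mcoeffZ mcoeffX.
by case: eqP => [e|]; rewrite ?mulr0 //; case/eqP: nm; rewrite -e mdeg1.
Qed.

Lemma meval_homog1 (l : P) v : l \is 1.-homog -> l.@[v] = \sum_i l@_U_(i) * v i.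
Proof.
move=> hl; rewrite {1}(homog1E hl) raddf_sum /=; apply: eq_bigr => i _.
by rewrite mevalZ mevalXU.
Qed.

Lemma mmap_homog (S : comNzRingType) (f : {rmorphism K -> S}) (v : 'I_3 -> S) (c : S) e (h : P) :
  h \is e.-homog -> mmap f (fun i => c * v i) h = c ^+ e * mmap f v h.
Proof.
move=> hh; rewrite /mmap mulr_sumr big_seq [RHS]big_seq; apply: eq_bigr => m /(dhomog_mf hh) em.
rewrite /mmap1 mulrCA; congr (_ * _).
rewrite (eq_bigr (fun i => c ^+ m i * v i ^+ m i)); last by move=> i _; rewrite exprMn.
by rewrite big_split /= prodrXr -mdegE em.
Qed.

Lemma meval_homog (v : 'I_3 -> K) c e (h : P) : h \is e.-homog ->
  h.@[fun i => c * v i] = c ^+ e * h.@[v].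
Proof. exact: (mmap_homog idfun). Qed.

(* the restriction of [h] to the parametrized line [p + t b] *)
Definition linepoly (p b : 'I_3 -> K) : P -> {poly K} :=
  mmap (@polyC K) (fun i => (p i)%:P + (b i)%:P * 'X).
HB.instance Definition _ p b := GRing.RMorphism.copy (linepoly p b)
  (mmap (@polyC K) (fun i => (p i)%:P + (b i)%:P * 'X)).

Lemma linepolyC p b c : linepoly p b c%:MP = c%:P.
Proof. exact: mmapC. Qed.

Lemma linepolyX p b i : linepoly p b 'X_i = (p i)%:P + (b i)%:P * 'X.
Proof. by rewrite /linepoly mmapX mmap1U. Qed.

Lemma horner_linepoly p b h t : (linepoly p b h).[t] = h.@[fun i => p i + b i * t].
Proof.
elim/mpoly_alg_ind: h => [c|i|f g hf hg|f g hf hg].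
- by rewrite linepolyC hornerC mevalC.
- by rewrite linepolyX mevalXU !hornerE.
- by rewrite rmorphD hornerD /= hf hg mevalD.
- by rewrite rmorphM hornerM /= hf hg mevalM.
Qed.

Lemma size_linepoly p b h e : h \is e.-homog -> (size (linepoly p b h) <= e.+1)%N.
Proof.
move=> hh; rewrite /linepoly /mmap big_seq; apply: (leq_trans (size_sum _ _ _)).
apply/bigmax_leqP_seq => m hm _; rewrite mul_polyC; apply: leq_trans (size_scale_leq _ _) _.
have em : mdeg m = e := dhomog_mf hh hm.
rewrite -em /mmap1 mdegE.
apply: (leq_trans (size_prod_leq _ _)); rewrite card_ord leq_subLR addnS ltnS.
pose L i : {poly K} := (p i)%:P + (b i)%:P * 'X.
have le1 i : (size (L i) <= 2)%N.
  apply: (leq_trans (size_polyD _ _)); rewrite geq_max; apply/andP; split.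
    exact: leq_trans (size_polyC_leq1 _) _.
  by rewrite mul_polyC; apply: (leq_trans (size_scale_leq _ _)); rewrite size_polyX.
have leX i k : (size (L i ^+ k)%R <= k.+1)%N.
  apply: (leq_trans (size_poly_exp_leq _ _)); rewrite ltnS.
  by have := le1 i; case: (size _) => [|[|[|//]]] //=; rewrite ?mul0n ?mul1n.
apply: (@leq_trans (\sum_(i < 3) (m i).+1)%N); first by apply: leq_sum => i _; exact: leX.
by rewrite (eq_bigr (fun i => 1 + m i)%N) // big_split /= sum1_card card_ord.
Qed.

Lemma euler_homog (h : P) e : h \is e.-homog -> \sum_i 'X_i * h^`M(i) = e%:R * h.
Proof.
move=> hh; rewrite {2}[h]mpolyE mulr_sumr.
rewrite (eq_bigr (fun i => \sum_(m <- msupp h) h@_m *: ((m i)%:R *: 'X_[m]))).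
  rewrite exchange_big /= big_seq [RHS]big_seq; apply: eq_bigr => m hm.
  have em : mdeg m = e := dhomog_mf hh hm.
  rewrite -scaler_sumr -scaler_suml -natr_sum -mdegE em.
  by rewrite -scalerAr -mpolyC_nat mul_mpolyC.
move=> i _; rewrite {1}[h]mpolyE raddf_sum /= mulr_sumr; apply: eq_bigr => m _.
rewrite mderivZ mderivX -!scalerAr; congr (_ *: _).
have [->|nz] := eqVneq (m i) 0%N; first by rewrite !scale0r.
by rewrite -mpolyXD addmC submK // lep1mP.
Qed.

End MpolyFacts.

(** * Linear frames and dehomogenization *)

Section Frame.
Variable K : fieldType.
Local Notation P := {mpoly K[3]}.
Local Notation A := {mpoly K[2]}.
Local Notation x := ('X_0 : A).
Local Notation y := ('X_1 : A).
Local Notation ev := (meval (fun _ : 'I_2 => @GRing.zero K)).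
Local Notation Fr := {fraction P}.
Variables (p a b : 'I_3 -> K) (ka al be : P).

(** Dual bases: vectors [p, a, b] and linear forms [ka, al, be]. The line [al = 0] is spanned by [p]
    and [b], and [ka = 1] is an affine chart centred at [p] with coordinates [al] and [be]. *)
Record frame := Frame {
  frame_homog : [/\ ka \is 1.-homog, al \is 1.-homog & be \is 1.-homog];
  frame_X : forall i, 'X_i = (p i)%:MP * ka + (a i)%:MP * al + (b i)%:MP * be;
  frame_ka : [/\ ka.@[p] = 1, ka.@[a] = 0 & ka.@[b] = 0];
  frame_al : [/\ al.@[p] = 0, al.@[a] = 1 & al.@[b] = 0];
  frame_be : [/\ be.@[p] = 0, be.@[a] = 0 & be.@[b] = 1] }.

Hypothesis fr : frame.

Definition deltat : 3.-tuple A :=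
  [tuple (p i)%:MP + (a i)%:MP * x + (b i)%:MP * y | i < 3].
Definition delta : P -> A := comp_mpoly deltat.
HB.instance Definition _ := GRing.RMorphism.copy delta (comp_mpoly deltat).

Lemma deltaC c : delta c%:MP = c%:MP. Proof. exact: comp_mpolyC. Qed.
Lemma deltaX i : delta 'X_i = (p i)%:MP + (a i)%:MP * x + (b i)%:MP * y.
Proof. by rewrite /delta /comp_mpoly mmapX mmap1U tnth_mktuple. Qed.

Lemma deltaD f g : delta (f + g) = delta f + delta g. Proof. exact: rmorphD. Qed.
Lemma deltaM f g : delta (f * g) = delta f * delta g. Proof. exact: rmorphM. Qed.
Lemma deltaB f g : delta (f - g) = delta f - delta g. Proof. exact: rmorphB. Qed.
Lemma delta_sum (I : Type) (r : seq I) (Q : pred I) (F : I -> P) :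
  delta (\sum_(i <- r | Q i) F i) = \sum_(i <- r | Q i) delta (F i).
Proof. exact: rmorph_sum. Qed.
Lemma deltaXn f n : delta (f ^+ n) = delta f ^+ n. Proof. exact: rmorphXn. Qed.

Lemma deltaZ c h : delta (c *: h) = c *: delta h.
Proof. exact: comp_mpolyZ. Qed.

Lemma delta_homog1 l : l \is 1.-homog ->
  delta l = (l.@[p])%:MP + (l.@[a])%:MP * x + (l.@[b])%:MP * y.
Proof.
move=> hl; rewrite {1}(homog1E hl) raddf_sum /= !(meval_homog1 _ hl).
rewrite !raddf_sum /= !mulr_suml -!big_split /=; apply: eq_bigr => i _.
by rewrite deltaZ deltaX -mul_mpolyC !mpolyCM; ring.
Qed.

Lemma delta_ka : delta ka = 1.
Proof.
have [hk _ _] := frame_homog fr; rewrite delta_homog1 //.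
by have [-> -> ->] := frame_ka fr; rewrite mpolyC0 mpolyC1; ring.
Qed.

Lemma delta_al : delta al = x.
Proof.
have [_ hk _] := frame_homog fr; rewrite delta_homog1 //.
by have [-> -> ->] := frame_al fr; rewrite mpolyC0 mpolyC1; ring.
Qed.

Lemma delta_be : delta be = y.
Proof.
have [_ _ hk] := frame_homog fr; rewrite delta_homog1 //.
by have [-> -> ->] := frame_be fr; rewrite mpolyC0 mpolyC1; ring.
Qed.

Lemma ev_delta h : ev (delta h) = h.@[p].
Proof.
elim/mpoly_alg_ind: h => [c|i|f g hf hg|f g hf hg].
- by rewrite deltaC !mevalC.
- by rewrite deltaX !(mevalD, mevalM, mevalC, mevalXU) !mulr0 !addr0.
- by rewrite [delta _]rmorphD !mevalD hf hg.
- by rewrite [delta _]rmorphM !mevalM hf hg.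
Qed.

Lemma rho_delta h : rho (delta h) = linepoly p b h.
Proof.
elim/mpoly_alg_ind: h => [c|i|f g hf hg|f g hf hg].
- by rewrite deltaC rhoC linepolyC.
- rewrite deltaX linepolyX !(rmorphD, rmorphM) /= !rhoC rhox rhoy; ring.
- by rewrite [delta _]rmorphD !rmorphD /= hf hg.
- by rewrite [delta _]rmorphM !rmorphM /= hf hg.
Qed.

Lemma ka_neq0 : ka != 0.
Proof.
have [h _ _] := frame_ka fr; apply: contraTneq (oner_neq0 K) => k0.
by rewrite -h k0 meval0 eqxx.
Qed.

Definition fCP : K -> Fr := (@tofrac P \o @mpolyC 3 K).
HB.instance Definition _ := GRing.RMorphism.copy fCP (@tofrac P \o @mpolyC 3 K).
Definition epspt (i : 'I_2) : Fr := if i == 0 then tofrac al / tofrac ka else tofrac be / tofrac ka.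
(* the inverse substitution [x = al / ka], [y = be / ka] *)
Definition eps : A -> Fr := mmap fCP epspt.
HB.instance Definition _ := GRing.RMorphism.copy eps (mmap fCP epspt).

Lemma eps_delta e h : h \is e.-homog -> eps (delta h) = (tofrac ka)^-1 ^+ e * tofrac h.
Proof.
move=> hh.
have -> : tofrac h = mmap fCP (fun i => tofrac 'X_i) h.
  elim/mpoly_alg_ind: h {hh} => [c|i|f g hf hg|f g hf hg].
  - by rewrite mmapC.
  - by rewrite mmapX mmap1U.
  - by rewrite [RHS]mmapD -hf -hg rmorphD.
  - by rewrite [RHS]rmorphM /= -hf -hg rmorphM.
rewrite -(mmap_homog _ _ _ hh).
elim/mpoly_alg_ind: h {hh} => [c|i|f g hf hg|f g hf hg].
- by rewrite deltaC /eps !mmapC.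
- have k0 : tofrac ka != 0 by rewrite tofrac_eq0 ka_neq0.
  rewrite deltaX mmapX mmap1U (frame_X fr i).
  have eC c : eps c%:MP = tofrac c%:MP by exact: mmapC.
  have eM u v : eps (u * v) = eps u * eps v by exact: rmorphM.
  have eD u v : eps (u + v) = eps u + eps v by exact: rmorphD.
  have ex : eps x = tofrac al / tofrac ka by rewrite /eps mmapX mmap1U.
  have ey : eps y = tofrac be / tofrac ka by rewrite /eps mmapX mmap1U.
  have tM (u v : P) : tofrac (u * v) = tofrac u * tofrac v by exact: rmorphM.
  have tD (u v : P) : tofrac (u + v) = tofrac u + tofrac v by exact: rmorphD.
  rewrite !eD !eM !eC ex ey !tD !tM !mulrDr [in RHS]mulrCA mulVf // mulr1.
  by congr (_ + _ + _); rewrite [RHS]mulrCA; congr (_ * _); exact: mulrC.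
- by rewrite [delta _]rmorphD [eps _]rmorphD /= hf hg [RHS]mmapD.
- by rewrite [delta _]rmorphM [eps _]rmorphM /= hf hg [RHS]rmorphM.
Qed.

(** On forms of a fixed degree [eps] recovers [h] up to a power of [ka]. *)
Lemma delta_inj e h : h \is e.-homog -> delta h = 0 -> h = 0.
Proof.
move=> hh d0; apply/eqP; rewrite -tofrac_eq0.
have := eps_delta hh; rewrite d0 [eps 0]rmorph0 => /esym/eqP; rewrite mulf_eq0 => /orP[|//].
by rewrite expf_eq0 invr_eq0 [tofrac ka == 0]tofrac_eq0 (negPf ka_neq0) andbF.
Qed.

Lemma delta_lift (q : A) : exists e h, h \is e.-homog /\ delta h = q.
Proof.
have [hka hal hbe] := frame_homog fr.
have kaX n : ka ^+ n \is n.-homog by have := dhomogMn n hka; rewrite mul1n.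
elim/mpoly_alg_ind: q => [c|i|f g [e [h [hh <-]]] [e' [h' [hh' <-]]]
   |f g [e [h [hh <-]]] [e' [h' [hh' <-]]]].
- by exists 0%N, c%:MP; rewrite deltaC -[c%:MP]mulr1 mul_mpolyC dhomogZ // dhomog1.
- case: (I2P i) => ->; exists 1%N; first by exists al; rewrite delta_al.
  by exists be; rewrite delta_be.
- exists (e + e')%N, (h * ka ^+ e' + h' * ka ^+ e); split.
    by apply: dhomogD; [exact: dhomogM | rewrite addnC; exact: dhomogM].
  by rewrite [LHS]rmorphD !rmorphM !rmorphXn /= delta_ka !expr1n !mulr1.
- by exists (e + e')%N, (h * h'); split; [exact: dhomogM | rewrite [LHS]rmorphM].
Qed.

Definition planet : 3.-tuple P := [tuple (p i)%:MP * ka + (b i)%:MP * be | i < 3].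

Lemma plane_decomp h : exists q, h = q * al + (h \mPo planet).
Proof.
elim/mpoly_alg_ind: h => [c|i|f g [q hf] [q' hg]|f g [q hf] [q' hg]].
- by exists 0; rewrite mul0r add0r comp_mpolyC.
- exists (a i)%:MP; rewrite [X in _ + X]mmapX mmap1U tnth_mktuple {1}(frame_X fr i); ring.
- by exists (q + q'); rewrite rmorphD {1}hf {1}hg /=; ring.
- exists (q * g + (f \mPo planet) * q'); rewrite rmorphM /=.
  by move: (f \mPo planet) (g \mPo planet) hf hg => F G -> ->; ring.
Qed.

(* Projecting along [a] onto the plane [al = 0] detects divisibility by [al]. *)
Lemma al_divP h : (exists q, h = q * al) <-> h \mPo planet = 0.
Proof.
split=> [[q ->]|h0].
  have [_ hal _] := frame_homog fr; have [e1 _ e2] := frame_al fr.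
  have e : al \mPo planet = (al.@[p])%:MP * ka + (al.@[b])%:MP * be.
    rewrite {1}(homog1E hal) !(meval_homog1 _ hal) !raddf_sum !mulr_suml -big_split /=.
    apply: eq_bigr => i _; rewrite comp_mpolyZ [X in _ *: X]mmapX mmap1U tnth_mktuple.
    by rewrite -mul_mpolyC !mpolyCM; ring.
  by rewrite rmorphM /= e e1 e2 mpolyC0 !mul0r addr0 mulr0.
have [q hq] := plane_decomp h.
by exists q; rewrite {1}hq h0 addr0.
Qed.

(** Substituting [planet] is a ring morphism into a domain with kernel [(al)]. *)
Lemma al_prime f g : (exists q, f * g = q * al) -> (exists q, f = q * al) \/ (exists q, g = q * al).
Proof.
move=> /al_divP; rewrite rmorphM /= => /eqP; rewrite mulf_eq0 => /orP[]/eqP/al_divP; by [left|right].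
Qed.

(** On the plane [al = 0] a form of degree [e] equals [ka ^+ e] times its [linepoly] evaluated at
    [be / ka]. *)
Lemma linepoly_eq0 e h : h \is e.-homog -> linepoly p b h = 0 -> exists q, h = q * al.
Proof.
move=> hh h0; apply/al_divP; pose s := planet.
have k0 : tofrac ka != 0 by rewrite tofrac_eq0 ka_neq0.
have tM (u v : P) : tofrac (u * v) = tofrac u * tofrac v by exact: rmorphM.
have tD (u v : P) : tofrac (u + v) = tofrac u + tofrac v by exact: rmorphD.
pose t := tofrac be / tofrac ka.
have e1 (u : P) : tofrac (u \mPo s) = mmap fCP (fun i => tofrac ka * (fCP (p i) + fCP (b i) * t)) u.
  elim/mpoly_alg_ind: u => [c|i|f g hf hg|f g hf hg].
  - by rewrite comp_mpolyC mmapC.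
  - rewrite /comp_mpoly !mmapX !mmap1U tnth_mktuple tD !tM mulrDr.
    congr (_ + _); first exact: mulrC.
    by rewrite mulrCA /t mulrC [X in _ = _ * X]mulrC divfK // mulrC.
  - by rewrite rmorphD /= tD hf hg [RHS]mmapD.
  - by rewrite rmorphM /= tM hf hg [RHS]rmorphM.
have e2 (u : P) : mmap fCP (fun i => fCP (p i) + fCP (b i) * t) u = (map_poly fCP (linepoly p b u)).[t].
  elim/mpoly_alg_ind: u => [c|i|f g hf hg|f g hf hg].
  - by rewrite mmapC linepolyC map_polyC hornerC.
  - by rewrite mmapX mmap1U linepolyX rmorphD rmorphM /= !map_polyC map_polyX !hornerE.
  - by rewrite [LHS]mmapD hf hg rmorphD rmorphD hornerD.
  - by rewrite [LHS]rmorphM /= hf hg rmorphM rmorphM hornerM.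
apply/eqP; rewrite -tofrac_eq0 e1 (mmap_homog _ _ _ hh) e2 h0 rmorph0 horner0 mulr0 //.
Qed.

Lemma delta_deriv0 h : (delta h)^`M(0) = \sum_i a i *: delta h^`M(i).
Proof.
elim/mpoly_alg_ind: h => [c|i|f g hf hg|f g hf hg].
- by rewrite deltaC mderivC big1 // => i _; rewrite mderivC [delta 0]rmorph0 scaler0.
- rewrite deltaX !mderivD !mderivM !mderivC !mderivXU /= (bigD1 i) //= mderivXU eqxx.
  rewrite [delta 1]rmorph1 big1 ?addr0; last first.
    by move=> j nj; rewrite mderivXU eq_sym (negPf nj) [delta 0]rmorph0 scaler0.
  by rewrite !(mul0r, mulr0, mulr1, addr0, add0r) -alg_mpolyC.
- rewrite [delta _]rmorphD mderivD hf hg -big_split /=; apply: eq_bigr => i _.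
  by rewrite mderivD [delta (_ + _)]rmorphD scalerDr.
- rewrite [delta _]rmorphM mderivM hf hg /= mulr_suml mulr_sumr -big_split /=.
  apply: eq_bigr => i _; rewrite mderivM deltaD !deltaM.
  by rewrite scalerDr -scalerAl -scalerAr.
Qed.

Lemma delta_deriv1 h : (delta h)^`M(1) = \sum_i b i *: delta h^`M(i).
Proof.
elim/mpoly_alg_ind: h => [c|i|f g hf hg|f g hf hg].
- by rewrite deltaC mderivC big1 // => i _; rewrite mderivC [delta 0]rmorph0 scaler0.
- rewrite deltaX !mderivD !mderivM !mderivC !mderivXU /= (bigD1 i) //= mderivXU eqxx.
  rewrite [delta 1]rmorph1 big1 ?addr0; last first.
    by move=> j nj; rewrite mderivXU eq_sym (negPf nj) [delta 0]rmorph0 scaler0.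
  by rewrite !(mul0r, mulr0, mulr1, addr0, add0r) -alg_mpolyC.
- rewrite [delta _]rmorphD mderivD hf hg -big_split /=; apply: eq_bigr => i _.
  by rewrite mderivD [delta (_ + _)]rmorphD scalerDr.
- rewrite [delta _]rmorphM mderivM hf hg /= mulr_suml mulr_sumr -big_split /=.
  apply: eq_bigr => i _; rewrite mderivM deltaD !deltaM.
  by rewrite scalerDr -scalerAl -scalerAr.
Qed.

Lemma frame_dual i j :
  (i == j)%:R = p i * ka@_U_(j) + a i * al@_U_(j) + b i * be@_U_(j).
Proof.
have := congr1 (mcoeff U_(j)) (frame_X fr i).
by rewrite mcoeffXU !mcoeffD !mcoeffCM.
Qed.

End Frame.

(** * Colength in homogeneous coordinates and in an affine chart *)

Section Colength.
Variable K : fieldType.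
Local Notation P := {mpoly K[3]}.
Local Notation A := {mpoly K[2]}.
Local Notation x := ('X_0 : A).
Local Notation y := ('X_1 : A).
Local Notation ev := (meval (fun _ : 'I_2 => @GRing.zero K)).
Local Notation Z := (@zero_ideal K A).

Definition idl (R : comNzRingType) (L : seq R) (h : R) :=
  exists c : nat -> R, h = \sum_(j < size L) c j * L`_j.

Lemma idl_ideal (L : seq A) : ideal (idl L).
Proof.
split.
- by exists (fun _ => 0); rewrite big1 // => j _; rewrite mul0r.
- move=> u v [c ->] [d ->]; exists (fun j => c j + d j).
  by rewrite -big_split /=; apply: eq_bigr => j _; rewrite mulrDl.
- move=> a u [c ->]; exists (fun j => a * c j).
  by rewrite mulr_sumr; apply: eq_bigr => j _; rewrite mulrA.
Qed.

Lemma idl_mem (L : seq A) a : a \in L -> idl L a.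
Proof.
move=> /(nthP 0)[j lt <-]; exists (fun k => (k == j)%:R).
rewrite (bigD1 (Ordinal lt)) //= eqxx mul1r big1 ?addr0 // => k nk.
have -> : (k == j :> nat) = false by apply/negbTE; apply: contraNneq nk => e; apply/eqP/val_inj.
by rewrite mul0r.
Qed.

Lemma idl_min (L : seq A) (J : A -> Prop) h : ideal J -> (forall a, a \in L -> J a) -> idl L h -> J h.
Proof.
move=> iJ hL [c ->]; apply: ideal_sum => // j _; apply: idealM => //; apply: hL.
exact: mem_nth.
Qed.

Lemma codim_ext (V : lmodType K) (J J' : V -> Prop) n : (forall v, J v <-> J' v) -> codim J n -> codim J' n.
Proof.
by move=> e [q [lq sq kq]]; exists q; split=> // v; rewrite -e.
Qed.

Lemma dhomog_mderiv e (h : P) j : h \is e.-homog -> h^`M(j) \is e.-1.-homog.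
Proof.
move=> hh; apply/dhomogP => m; rewrite mcoeff_msupp mcoeff_deriv => nz.
have hm : (m + U_(j))%MM \in msupp h.
  by rewrite mcoeff_msupp; apply: contraNneq nz => ->; rewrite mul0rn.
have : mdeg (m + U_(j))%MM = e := dhomog_mf hh hm.
by rewrite mdegD mdeg1 addn1 => <-.
Qed.

Variables (p a b : 'I_3 -> K) (ka al be : P).
Hypothesis fr : frame p a b ka al be.
Local Notation delta := (delta p a b).

Lemma loc_mem_delta G h : loc_mem p G h -> loc ev (idl (map delta G)) (delta h).
Proof.
move=> [w [k [hw wp [c e]]]]; exists (delta w); split; first by rewrite /= ev_delta.
exists (fun j => delta (c j)); rewrite -deltaM e size_map delta_sum.
by apply: eq_bigr => j _; rewrite (nth_map 0) // deltaM.
Qed.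

(** The coefficients are homogenized and padded with powers of [ka], which become 1 in the chart,
    until all terms have degree [N]; then [delta_inj] applies. *)
Lemma delta_loc_mem G h D (Dg : nat -> nat) : h \is D.-homog ->
  (forall j, (j < size G)%N -> G`_j \is (Dg j).-homog) ->
  loc ev (idl (map delta G)) (delta h) -> loc_mem p G h.
Proof.
move=> hh hG [s [es [c e]]]; rewrite size_map in e.
have [es' [S [hS sE]]] := delta_lift fr s.
have lift j : exists t : nat * P, t.2 \is t.1.-homog /\ delta t.2 = c j.
  by have [e0 [q [hq qE]]] := delta_lift fr (c j); exists (e0, q).
pose T j := proj1_sig (constructive_indefinite_description _ (lift j)).
have hT j : (T j).2 \is (T j).1.-homog /\ delta (T j).2 = c j.
  by rewrite /T; case: constructive_indefinite_description.
have [hka _ _] := frame_homog fr.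
have kaX n : ka ^+ n \is n.-homog by have := dhomogMn n hka; rewrite mul1n.
have dk n : delta (ka ^+ n) = 1 by rewrite deltaXn (delta_ka fr) expr1n.
pose N := (es' + D + \sum_(j < size G) ((T j).1 + Dg j))%N.
have leN (j : 'I_(size G)) : ((T j).1 + Dg j <= N)%N.
  by rewrite /N (bigD1 j) //=; lia.
pose n0 := (\sum_(j < size G) ((T j).1 + Dg j))%N.
exists (S * ka ^+ n0), (es' + n0)%N; split.
- exact: dhomogM.
- by rewrite -(ev_delta p a b) deltaM dk mulr1 sE.
exists (fun j => (T j).2 * ka ^+ (N - ((T j).1 + Dg j))).
apply/eqP; rewrite -subr_eq0; apply/eqP; apply: (delta_inj fr (e := N)).
  apply: rpredB.
    have -> : N = (es' + n0 + D)%N by rewrite /N -/n0; lia.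
    by apply: dhomogM => //; exact: dhomogM.
  apply: rpred_sum => j _; have [h1 _] := hT j.
  have := dhomogM (dhomogM h1 (kaX (N - ((T j).1 + Dg j))%N)) (hG j (ltn_ord j)).
  by rewrite addnAC subnKC.
rewrite deltaB !deltaM dk mulr1 sE e delta_sum.
apply/eqP; rewrite subr_eq0; apply/eqP; apply: eq_bigr => j _.
by rewrite (nth_map 0) // !deltaM dk mulr1; have [_ ->] := hT j.
Qed.

(** The fractions [h i / u i] are replaced by the polynomials [H i] over the common denominator [U],
    which is nonzero at [p]. Spanning gives one inequality and independence the other. *)
Lemma colength_codim G n (Dg : nat -> nat) :
  (forall j, (j < size G)%N -> G`_j \is (Dg j).-homog) ->
  colength p G n -> codim (loc ev (idl (map delta G))) n.
Proof.
move=> hG [h [u [hu ind span]]].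
have iL : ideal (loc ev (idl (map delta G))) by apply: loc_ideal; exact: idl_ideal.
have lL := @loc_local _ _ ev (idl (map delta G)).
pose H (i : 'I_n) := h i * \prod_(j < n | j != i) u j.
pose U := \prod_(j < n) u j.
have U0 : ev (delta U) != 0.
  rewrite ev_delta /U rmorph_prod; apply/prodf_neq0 => j _.
  by have [_] := hu j (ltn_ord j).
have [n' [le cn']] : exists n', (n' <= n)%N /\ codim (loc ev (idl (map delta G))) n'.
  apply: bounded_codim; first exact: ideal_subspace.
  move=> m v iv.
  have hc (i : 'I_m) : exists c : nat -> K,
      loc ev (idl (map delta G)) (v i * delta U - \sum_(j < n) c j *: delta (H j)).
    have [e [q [hq qE]]] := delta_lift fr (v i).
    have [hka _ _] := frame_homog fr; have [kp _ _] := frame_ka fr.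
    have kaX : ka ^+ e \is e.-homog by have := dhomogMn e hka; rewrite mul1n.
    have [|c hc] := span q (ka ^+ e) e hq kaX.
      by rewrite rmorphXn /= kp expr1n oner_neq0.
    exists c; have := loc_mem_delta hc.
    rewrite deltaB !deltaM qE deltaXn (delta_ka fr) expr1n mul1r.
    congr (loc _ _ (_ - _)); rewrite delta_sum; apply: eq_bigr => j _.
    exact: deltaZ.
  pose c i := proj1_sig (constructive_indefinite_description _ (hc i)).
  have hcc i : loc ev (idl (map delta G)) (v i * delta U - \sum_(j < n) c i j *: delta (H j)).
    by rewrite /c; case: constructive_indefinite_description.
  have : row_free (\matrix_(i < m, j < n) c i j).
    apply: inj_row_free => w hw; apply: iv; apply: (lL (delta U)) => //.
    have -> : delta U * \sum_i w 0 i *: v i =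
       \sum_i w 0 i *: (v i * delta U - \sum_(j < n) c i j *: delta (H j)).
      have -> : \sum_i w 0 i *: (v i * delta U - \sum_(j < n) c i j *: delta (H j)) =
         \sum_i w 0 i *: (v i * delta U) - \sum_i \sum_(j < n) (w 0 i * c i j) *: delta (H j).
        rewrite -sumrB; apply: eq_bigr => i _; rewrite scalerBr; congr (_ - _).
        by rewrite scaler_sumr; apply: eq_bigr => j _; rewrite scalerA.
      rewrite exchange_big /= [X in _ - X]big1 ?subr0.
        by rewrite mulr_sumr; apply: eq_bigr => i _; rewrite -scalerAr mulrC.
      move=> j _; rewrite -scaler_suml.
      have := congr1 (fun M : 'rV_n => M 0 j) hw; rewrite !mxE => e.
      by rewrite (eq_bigr (fun i => w 0 i * (\matrix_(i < m, j < n) c i j) i j)) ?e ?scale0r // => i _; rewrite mxE.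
    by apply: ideal_sum => // i _; apply: idealZ.
  by move=> /eqP <-; exact: rank_leq_col.
suff len : (n <= n')%N by have /eqP <- : n' == n by rewrite eqn_leq le len.
apply: (indep_le (h := fun i : 'I_n => delta (H i)) cn') => c hc.
pose c' (i : nat) := if insub i is Some j then c 0 j else 0 : K.
have c'E (i : 'I_n) : c' i = c 0 i by rewrite /c' valK.
apply/rowP => i; rewrite mxE -c'E; apply: (ind c') => //.
have dgE (j : 'I_n) : exists k, h j \is k.-homog /\ u j \is k.-homog.
  by have [] := hu j (ltn_ord j).
pose dg j := proj1_sig (constructive_indefinite_description _ (dgE j)).
have hdg (j : 'I_n) : h j \is (dg j).-homog /\ u j \is (dg j).-homog.
  by rewrite /dg; case: constructive_indefinite_description.
apply: (delta_loc_mem (D := (\sum_(j < n) dg j)%N) _ hG).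
  apply: rpred_sum => j _; apply: dhomogZ.
  have -> : (\sum_(k < n) dg k = dg j + \sum_(k < n | k != j) dg k)%N by rewrite (bigD1 j).
  apply: dhomogM; first by have [] := hdg j.
  elim/big_rec2: _ => [|k d q nk hq]; first exact: dhomog1.
  by apply: dhomogM => //; have [] := hdg k.
move: hc; congr (loc _ _ _); rewrite delta_sum; apply: eq_bigr => j _.
by rewrite c'E -deltaZ.
Qed.

Lemma delta_partial h j : delta h^`M(j) =
  ka@_U_(j) *: (\sum_i p i *: delta h^`M(i)) + al@_U_(j) *: (delta h)^`M(0)
   + be@_U_(j) *: (delta h)^`M(1).
Proof.
rewrite delta_deriv0 delta_deriv1 !scaler_sumr -!big_split /=.
rewrite (bigD1 j) //= [X in _ = _ + X]big1 ?addr0.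
  rewrite !scalerA -!scalerDl.
  have := frame_dual fr j j; rewrite eqxx => e.
  by rewrite [_ * p j]mulrC [_ * a j]mulrC [_ * b j]mulrC -e scale1r.
move=> i ni; rewrite !scalerA -!scalerDl.
have := frame_dual fr i j; rewrite (negPf ni) => e.
by rewrite [_ * p i]mulrC [_ * a i]mulrC [_ * b i]mulrC -e scale0r.
Qed.

(** The conditions on [ka], [a] and [b] adapt the frame to the coordinate chart of [milnor]: the two
    affine derivatives and the partials of index other than [chart p] then generate the same
    ideal. *)
Lemma milnor_codim h D n : h \is D.-homog -> (forall j, j != chart p -> ka@_U_(j) = 0) ->
  a (chart p) = 0 -> b (chart p) = 0 -> milnor p h n ->
  codim (loc ev (adj (adj Z (delta h)^`M(1)) (delta h)^`M(0))) n.
Proof.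
move=> hh kaj a0 b0 /(@colength_codim _ _ (fun _ => D.-1)) hc.
have /hc cn : forall j, (j < size [seq h^`M(j) | j <- enum 'I_3 & j != chart p])%N ->
    [seq h^`M(j) | j <- enum 'I_3 & j != chart p]`_j \is D.-1.-homog.
  move=> j lt; have /mapP[i _ ->] := mem_nth 0 lt; exact: dhomog_mderiv.
apply: codim_ext cn => v; split; apply: loc_mono => {}v.
  apply: idl_min; first exact: adj2i.
  move=> _ /mapP[_ /mapP[i hi ->] ->]; rewrite mem_filter in hi; have /andP[ni _] := hi.
  rewrite delta_partial kaj // scale0r add0r; apply/adj2E.
  by exists (be@_U_(i))%:MP, (al@_U_(i))%:MP; rewrite -!mul_mpolyC; ring.
have iI := idl_ideal (map delta [seq h^`M(j) | j <- enum 'I_3 & j != chart p]).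
have mem i : i != chart p -> idl (map delta [seq h^`M(j) | j <- enum 'I_3 & j != chart p]) (delta h^`M(i)).
  move=> ni; apply: idl_mem; apply: map_f; apply: map_f; by rewrite mem_filter ni mem_enum.
have comb c : c (chart p) = 0 -> idl (map delta [seq h^`M(j) | j <- enum 'I_3 & j != chart p])
    (\sum_i c i *: delta h^`M(i)).
  move=> c0; apply: ideal_sum => // i _; have [->|ni] := eqVneq i (chart p).
    by rewrite c0 scale0r; exact: ideal0.
  by apply: idealZ => //; exact: mem.
apply: adj_min => //; last by rewrite delta_deriv0; exact: comb.
move=> u; apply: adj_min => //; last by rewrite delta_deriv1; exact: comb.
by move=> _ ->; exact: ideal0.
Qed.

(** Modulo [h], Euler's relation expresses the three partials through the two affine ones, whatever
    the frame. *)
Lemma tjurina_codim h D n : h \is D.-homog -> tjurina p h n ->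
  codim (loc ev (adj (adj (adj Z (delta h)) (delta h)^`M(0)) (delta h)^`M(1))) n.
Proof.
move=> hh; rewrite /tjurina; set G := (X in colength p X n).
move=> /(@colength_codim _ _ (fun j => if j is 0%N then D else D.-1)) hc.
have /hc cn : forall j, (j < size G)%N -> G`_j \is (if j is 0%N then D else D.-1).-homog.
  by move=> [|[|[|[|//]]]] _ //=; exact: dhomog_mderiv.
have GM j : h^`M(j) \in G by case: (I3P j) => ->; rewrite !inE eqxx ?orbT.
have Gh : h \in G by rewrite inE eqxx.
apply: codim_ext cn => v; split; apply: loc_mono => {}v.
  apply: idl_min; first exact: adj3i.
  have J0 : adj (adj (adj Z (delta h)) (delta h)^`M(0)) (delta h)^`M(1) (delta h).
    by apply/adj3E; exists 1, 0, 0; ring.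
  have part j : adj (adj (adj Z (delta h)) (delta h)^`M(0)) (delta h)^`M(1) (delta h^`M(j)).
    rewrite delta_partial.
    have -> : \sum_i p i *: delta h^`M(i) =
       D%:R * delta h - x * (delta h)^`M(0) - y * (delta h)^`M(1).
      have -> : D%:R * delta h = delta (D%:R * h) by rewrite deltaM [delta D%:R]rmorph_nat.
      rewrite -(euler_homog hh) delta_sum delta_deriv0 delta_deriv1 /=.
      rewrite !mulr_sumr -!sumrB; apply: eq_bigr => i _.
      by rewrite deltaM deltaX -!mul_mpolyC; ring.
    apply/adj3E; exists ((ka@_U_(j))%:MP * D%:R), ((al@_U_(j))%:MP - (ka@_U_(j))%:MP * x),
      ((be@_U_(j))%:MP - (ka@_U_(j))%:MP * y).
    by rewrite -!mul_mpolyC; ring.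
  by move=> _ /mapP[u hu ->]; move: hu; rewrite !inE => /or4P[]/eqP->.
have iI := idl_ideal (map delta G).
have mem i : idl (map delta G) (delta h^`M(i)) by apply: idl_mem; apply: map_f.
have comb c : idl (map delta G) (\sum_i c i *: delta h^`M(i)).
  by apply: ideal_sum => // i _; apply: idealZ => //; exact: mem.
apply: adj_min => //; last by rewrite delta_deriv1; exact: comb.
move=> u; apply: adj_min => //; last by rewrite delta_deriv0; exact: comb.
move=> t; apply: adj_min => //; last by apply: idl_mem; apply: map_f.
by move=> _ ->; exact: ideal0.
Qed.

End Colength.

(** * Orders of vanishing along the line *)

Definition det3 (R : comNzRingType) (u v w : 'I_3 -> R) : R :=
  let i0 := inord 0 in let i1 := inord 1 in let i2 := inord 2 in
  u i0 * (v i1 * w i2 - v i2 * w i1) - u i1 * (v i0 * w i2 - v i2 * w i0)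
  + u i2 * (v i0 * w i1 - v i1 * w i0).

Lemma eq_det3 (R : comNzRingType) (u v w u' v' w' : 'I_3 -> R) :
  u =1 u' -> v =1 v' -> w =1 w' -> det3 u v w = det3 u' v' w'.
Proof. by move=> eu ev ew; rewrite /det3 !eu !ev !ew. Qed.

Lemma rmorph_det3 (R S : comNzRingType) (f : {rmorphism R -> S}) (u v w : 'I_3 -> R) :
  f (det3 u v w) = det3 (f \o u) (f \o v) (f \o w).
Proof. by rewrite /det3 /= !(rmorphB, rmorphD, rmorphM). Qed.

Section Order.
Variable K : fieldType.
Local Notation P := {mpoly K[3]}.
Local Notation A := {mpoly K[2]}.
Local Notation x := ('X_0 : A).
Local Notation y := ('X_1 : A).
Local Notation ev := (meval (fun _ : 'I_2 => @GRing.zero K)).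

(* the bivector [theta_E /\ theta], contracted with a constant vector [v] *)
Definition Om (v : 'I_3 -> K) (th : der K) : P := det3 (fun i => (v i)%:MP) (fun i => 'X_i) th.

Lemma apply_derM (th : der K) f g : apply_der th (f * g) = apply_der th f * g + f * apply_der th g.
Proof.
rewrite /apply_der mulr_suml mulr_sumr -big_split /=; apply: eq_bigr => i _.
by rewrite mderivM; ring.
Qed.

Lemma mderiv_homog1 (l : P) i : l \is 1.-homog -> l^`M(i) = (l@_U_(i))%:MP.
Proof.
move=> hl; rewrite {1}(homog1E hl) raddf_sum /= (bigD1 i) //= big1 ?addr0.
  by rewrite mderivZ mderivXU eqxx -alg_mpolyC.
by move=> j nj; rewrite mderivZ mderivXU (negPf nj) scaler0.
Qed.

Variables (p a b : 'I_3 -> K) (ka al be : P).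
Hypothesis fr : frame p a b ka al be.
Local Notation delta := (delta p a b).

Lemma in_D_split f th : ~ (exists q, f = q * al) -> in_D (f * al) th ->
  exists c d, apply_der th al = c * al /\ apply_der th f = d * f.
Proof.
move=> ndv [g]; rewrite apply_derM => e.
have [//|[c hc]] : (exists q, f = q * al) \/ (exists q, apply_der th al = q * al).
  apply: (al_prime fr); exists (g * f - apply_der th f).
  by rewrite mulrBl -mulrA -e; ring.
exists c, (g - c); split=> //.
have al0 : al != 0.
  have [_ h _] := frame_al fr; apply: contraTneq (oner_neq0 K) => k0.
  by rewrite -h k0 meval0 eqxx.
apply: (mulIf al0); rewrite -mulrA mulrBl -e hc; ring.
Qed.

Lemma linepoly_al : linepoly p b al = 0.
Proof.
by rewrite -(rho_delta p a b) (delta_al fr) rhox.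
Qed.

Lemma local_order (f : P) (n mC tC mC' tC' : nat) : [pchar K] =i pred0 ->
  (forall j, j != chart p -> ka@_U_(j) = 0) -> a (chart p) = 0 -> b (chart p) = 0 ->
  f \is n.-homog -> f.@[p] = 0 -> linepoly p b f != 0 ->
  milnor p (f * al) mC -> tjurina p (f * al) tC -> milnor p f mC' -> tjurina p f tC' ->
  exists e : nat, (((mC%:Z - tC%:Z) - (mC'%:Z - tC'%:Z)) + 1 <= e%:Z) /\
    forall v th, in_D (f * al) th -> 'X^e %| linepoly p b (Om v th).
Proof.
move=> ch kaj a0 b0 hf fp lf hmC htC hmC' htC'.
pose g := delta f.
have [_ hal _] := frame_homog fr.
have ndv : ~ exists q, f = q * al.
  by move=> [q e]; move: lf; rewrite e rmorphM /= linepoly_al mulr0 eqxx.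
have rg : rho g != 0 by rewrite rho_delta.
have [i og] : exists i, ordy g i.+1.
  have [[|i] og] := ordy_exists rg; last by exists i.
  have [c rc c0] := og; case/negP: c0; rewrite -[c]mul1r -[1](expr0 'X) -rc.
  by rewrite -ev_rho ev_delta fp.
have hfa : f * al \is (n + 1).-homog by exact: dhomogM.
have dfa : delta (f * al) = g * x by rewrite deltaM (delta_al fr).
have cM' := milnor_codim fr hf kaj a0 b0 hmC'.
have cT' := tjurina_codim fr hf htC'.
have := milnor_codim fr hfa kaj a0 b0 hmC; have := tjurina_codim fr hfa htC.
rewrite dfa !mderivM !mderivXU /= mulr0 addr0 mulr1.
rewrite [g * x]mulrC [_^`M(1) * x]mulrC [_^`M(0) * x]mulrC [_ * _ + g]addrC => cT cM.
have leM := milnor_bound ch og cM' cM.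
have [q [leT dv]] := tjurina_bound og cT' cT.
(* This is [(i.+1 + i) - (i.+1 + q) + 1], from the bounds on the Milnor and Tjurina numbers. *)
exists (i.+1 - q)%N; split; first by lia.
move=> v th /(in_D_split ndv)[c [d [hc hd]]].
(* Subtracting [m] times the Euler derivation, which does not affect [Om], makes the field tangent
   to the chart [ka = 1], with components [A1] along [a] and [A2] along [b]. *)
pose m := \sum_j ka@_U_(j) *: delta (th j).
pose tt i := delta (th i) - m * delta 'X_i.
pose A1 := \sum_j al@_U_(j) *: tt j; pose A2 := \sum_j be@_U_(j) *: tt j.
have lin (l : P) : l \is 1.-homog -> \sum_j l@_U_(j) *: tt j =
    \sum_j l@_U_(j) *: delta (th j) - m * delta l.
  move=> hl; rewrite {3}(homog1E hl) delta_sum mulr_sumr -sumrB; apply: eq_bigr => j _.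
  by rewrite /tt deltaZ scalerBr -scalerAr.
have ttE k : tt k = (a k)%:MP * A1 + (b k)%:MP * A2.
  have ka0 : \sum_j ka@_U_(j) *: tt j = 0.
    by have [hka _ _] := frame_homog fr; rewrite lin // (delta_ka fr) mulr1 subrr.
  have -> : tt k = \sum_j (k == j)%:R *: tt j.
    rewrite (bigD1 k) //= eqxx scale1r big1 ?addr0 // => j nj.
    by rewrite eq_sym (negPf nj) scale0r.
  transitivity ((p k)%:MP * (\sum_j ka@_U_(j) *: tt j) + (a k)%:MP * A1 + (b k)%:MP * A2).
    rewrite /A1 /A2 !mulr_sumr -!big_split /=; apply: eq_bigr => j _.
    by rewrite (frame_dual fr k j) !mul_mpolyC !scalerA -!scalerDl.
  by rewrite ka0 mulr0 add0r.
have rA1 : rho A1 = 0.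
  rewrite /A1 lin // (delta_al fr) rmorphB rmorphM /= rhox mulr0 subr0.
  have -> : \sum_j al@_U_(j) *: delta (th j) = delta (apply_der th al).
    rewrite /apply_der delta_sum; apply: eq_bigr => j _.
    by rewrite mderiv_homog1 // deltaM deltaC mulrC mul_mpolyC.
  by rewrite hc deltaM (delta_al fr) rmorphM /= rhox mulr0.
have hA : A1 * g^`M(0) + A2 * g^`M(1) = (delta d - m * n%:R) * g.
  rewrite delta_deriv0 delta_deriv1 [A1 * _]mulr_sumr [A2 * _]mulr_sumr -big_split /=.
  transitivity (\sum_i tt i * delta f^`M(i)).
    by apply: eq_bigr => k _; rewrite ttE -!mul_mpolyC; ring.
  transitivity (delta (apply_der th f) - m * delta (\sum_i 'X_i * f^`M(i))).
    rewrite /apply_der !delta_sum mulr_sumr -sumrB; apply: eq_bigr => k _.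
    by rewrite !deltaM /tt; ring.
  by rewrite hd (euler_homog hf) !deltaM [delta n%:R]rmorph_nat -/g mulrBl mulrA.
have dvA := dv _ _ _ rA1 hA.
(* On the line the position vector is [p + y b], and the field is [A2 b] because [A1] vanishes
   there. *)
have -> : linepoly p b (Om v th) = (det3 v p b)%:P * rho A2; last exact: dvdp_mull.
rewrite -(rho_delta p a b).
have -> : delta (Om v th) = det3 (fun k => (v k)%:MP) (fun k => delta 'X_k) tt.
  have -> : delta (Om v th) = det3 (fun k => (v k)%:MP) (fun k => delta 'X_k) (fun k => delta (th k)).
    rewrite /Om [LHS]rmorph_det3; apply: eq_det3 => k //=; exact: deltaC.
  by rewrite /det3 /tt; ring.
rewrite (eq_det3 (fun _ => erefl) (fun _ => erefl) ttE) [LHS]rmorph_det3.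
have e1 : (@rho K) \o (fun k => (v k)%:MP) =1 (fun k => (v k)%:P) by move=> k; rewrite /= rhoC.
have e2 : (@rho K) \o (fun k => delta 'X_k) =1 (fun k => (p k)%:P + (b k)%:P * 'X).
  by move=> k; rewrite /= rho_delta linepolyX.
have e3 : (@rho K) \o (fun k => (a k)%:MP * A1 + (b k)%:MP * A2) =1 (fun k => (b k)%:P * rho A2).
  by move=> k; rewrite /= rmorphD !rmorphM /= rA1 mulr0 add0r rhoC.
by rewrite (eq_det3 e1 e2 e3) /det3 !(polyCD, polyCB, polyCM); ring.
Qed.

End Order.

(** * Existence of frames and change of parameter on the line *)

Section Frames.
Variable K : fieldType.
Local Notation P := {mpoly K[3]}.

Lemma third_index (j k : 'I_3) : j != k -> exists l, [/\ l != j, l != k &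
  forall (V : nmodType) (F : 'I_3 -> V), \sum_i F i = F j + F k + F l].
Proof.
move=> njk; have [l hl] : exists l, (l != j) && (l != k).
  apply/existsP; move: j k njk => [[|[|[|//]]] hj] [[|[|[|//]]] hk] // _; apply/existsP.
  - by exists (inord 2); rewrite -!val_eqE /= inordK.
  - by exists (inord 1); rewrite -!val_eqE /= inordK.
  - by exists (inord 2); rewrite -!val_eqE /= inordK.
  - by exists (inord 0); rewrite -!val_eqE /= inordK.
  - by exists (inord 1); rewrite -!val_eqE /= inordK.
  - by exists (inord 0); rewrite -!val_eqE /= inordK.
have /andP[lj lk] := hl; exists l; split=> // V F.
rewrite (bigD1 j) //= (bigD1 k) ?(eq_sym k) //= (bigD1 l) /=; last by rewrite lj lk.
rewrite big1 ?addr0 ?addrA // => i /andP[/andP[ij ik] il].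
have : (#|[set j; k; l; i]| <= 3)%N by rewrite -[X in (_ <= X)%N](card_ord 3); exact: max_card.
have -> : #|[set j; k; l; i]| = 4; last by [].
rewrite setUC cardsU1 !inE (negPf ij) (negPf ik) (negPf il) /=.
by rewrite setUC cardsU1 !inE (negPf lj) (negPf lk) /= cards2 njk.
Qed.

Lemma chart_nonzero (p : 'I_3 -> K) : nonzero_pt p -> p (chart p) != 0.
Proof.
move=> [i pi]; rewrite /chart; case: ifP => // /negbFE/eqP p0; case: ifP => // /negbFE/eqP p1.
by move: pi; case: (I3P i) => ->; rewrite ?p0 ?p1 ?eqxx.
Qed.

Lemma frame_identity (u v w pj pk pl : K) (Xj Xk Xl ka : P) :
  u != 0 -> u * pj + v * pk + w * pl = 0 -> Xk = pk%:MP * ka ->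
  Xj = pj%:MP * ka + u^-1%:MP * (u%:MP * Xj + v%:MP * Xk + w%:MP * Xl)
   + (- (w / u))%:MP * (Xl - pl%:MP * ka).
Proof.
move=> u0 e ->.
have -> : pj = - (u^-1 * (v * pk + w * pl)).
  by apply/eqP; rewrite -addr_eq0 -(inj_eq (mulfI u0)) mulr0 mulrDr mulVKf // addrA e.
rewrite !(mpolyCN, mpolyCM, mpolyCD).
transitivity (u%:MP * u^-1%:MP * Xj); last by ring.
by rewrite -mpolyCM mulfV // mpolyC1 mul1r.
Qed.

Lemma chart_frame (p : 'I_3 -> K) (al : P) : nonzero_pt p -> al \is 1.-homog -> al != 0 ->
  al.@[p] = 0 -> exists a b ka be, [/\ frame p a b ka al be,
    forall j, j != chart p -> ka@_U_(j) = 0, a (chart p) = 0 & b (chart p) = 0].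
Proof.
move=> np hal al0 ep; have pk := chart_nonzero np; move: pk; set k := chart p => pk.
(* A nonzero multiple of [X_k] alone would not vanish at [p], so [al] involves another variable. *)
have [j hj] : exists j, (j != k) && (al@_U_(j) != 0).
  apply: NNPP => no; have z j : j != k -> al@_U_(j) = 0.
    by move=> njk; apply/eqP/negP => /negP h; apply: no; exists j; rewrite njk.
  move: ep; rewrite (meval_homog1 _ hal) (bigD1 k) //= big1 ?addr0; last first.
    by move=> i /z ->; rewrite mul0r.
  move/eqP; rewrite mulf_eq0 (negPf pk) orbF => /eqP zk.
  case/eqP: al0; rewrite (homog1E hal) big1 // => i _.
  by have [->|/z ->] := eqVneq i k; rewrite ?zk scale0r.
have /andP[njk aj] := hj; have [l [lj lk sum3]] := third_index njk.
have jl : (j == l) = false by rewrite eq_sym (negPf lj).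
have kl : (k == l) = false by rewrite eq_sym (negPf lk).
have kj : (k == j) = false by rewrite eq_sym (negPf njk).
have alE (v : 'I_3 -> K) : al.@[v] = al@_U_(j) * v j + al@_U_(k) * v k + al@_U_(l) * v l.
  by rewrite (meval_homog1 _ hal) sum3.
pose a (i : 'I_3) : K := (i == j)%:R / al@_U_(j).
pose b (i : 'I_3) : K := (i == l)%:R - al@_U_(l) / al@_U_(j) * (i == j)%:R.
pose ka : P := (p k)^-1%:MP * 'X_k.
pose be : P := 'X_l - (p l)%:MP * ka.
have hX i : ('X_i : P) \is 1.-homog by rewrite dhomogX; apply/eqP; exact: mdeg1.
have hka : ka \is 1.-homog by rewrite /ka mul_mpolyC dhomogZ.
have hbe : be \is 1.-homog by rewrite /be mul_mpolyC rpredB // dhomogZ.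
have kaE v : ka.@[v] = v k / p k by rewrite /ka mevalM mevalC mevalXU mulrC.
have beE v : be.@[v] = v l - p l * (v k / p k) by rewrite /be mevalB mevalM mevalC kaE mevalXU.
exists a, b, ka, be; split.
- split=> //.
  + have I i : [\/ i = j, i = k | i = l].
      have := sum3 _ (fun i' : 'I_3 => (i' == i)%:R : int).
      rewrite (bigD1 i) //= eqxx big1 ?addr0; last by move=> i' /negPf ->.
      have [<-|_] := eqVneq j i; first by constructor 1.
      have [<-|_] := eqVneq k i; first by constructor 2.
      have [<-|_ //] := eqVneq l i; by constructor 3.
    have alX : al = (al@_U_(j))%:MP * 'X_j + (al@_U_(k))%:MP * 'X_k + (al@_U_(l))%:MP * 'X_l.
      by rewrite {1}(homog1E hal) sum3 !mul_mpolyC.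
    have Xk : 'X_k = (p k)%:MP * ka by rewrite /ka mulrA -mpolyCM mulfV // mpolyC1 mul1r.
    move=> i; case: (I i) => ->.
    * rewrite /a /b eqxx jl mul1r sub0r mulr1 {2}alX /be.
      by apply: (@frame_identity _ _ _ (p j) (p k) (p l)) => //; rewrite -(alE p).
    * by rewrite /a /b kj kl !(mul0r, mulr0, subr0, mpolyC0) !addr0.
    * rewrite /a /b (negPf lj) eqxx mul0r mulr0 subr0 mpolyC0 mpolyC1 mul0r mul1r addr0.
      by rewrite /be addrC subrK.
  + by rewrite !kaE /a /b kj kl !(mul0r, mulr0, subr0) divff.
  + rewrite ep !alE /a /b !eqxx kj kl (negPf lj) jl !(mul0r, mulr0, subr0, addr0, sub0r, mulr1, mul1r).
    by split=> //; [rewrite divff | field].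
  + rewrite !beE /a /b !eqxx kj kl (negPf lj) !(mul0r, mulr0, subr0, addr0, mulr1).
    by rewrite divff // mulr1 subrr.
- move=> i ni; rewrite /ka mcoeffCM mcoeffXU eq_sym (negPf ni) mulr0 //.
- by rewrite /a kj mul0r.
- by rewrite /b kj kl mulr0 subr0.
Qed.

(** The line is now parametrized from [b], with [p + t b] as its point at infinity. *)
Lemma frame_shear (p a b : 'I_3 -> K) (ka al be : P) t : frame p a b ka al be ->
  frame b a (fun i => p i + t * b i) (be - t%:MP * ka) al ka.
Proof.
move=> fr; have [hka hal hbe] := frame_homog fr.
have [k1 k2 k3] := frame_ka fr; have [a1 a2 a3] := frame_al fr; have [b1 b2 b3] := frame_be fr.
have lin (l : P) : l \is 1.-homog -> l.@[fun i => p i + t * b i] = l.@[p] + t * l.@[b].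
  move=> hl; rewrite !(meval_homog1 _ hl) mulr_sumr -big_split /=; apply: eq_bigr => i _; ring.
split=> //.
- by split=> //; rewrite mul_mpolyC rpredB // dhomogZ.
- by move=> i; rewrite (frame_X fr i) mpolyCD mpolyCM; ring.
- by rewrite !mevalB !mevalM !mevalC !lin // k1 k2 k3 b1 b2 b3; split; ring.
- by rewrite lin // a1 a3 mulr0 addr0.
- by rewrite lin // k1 k3 mulr0 addr0.
Qed.

Lemma frame_eval (p a b : 'I_3 -> K) (ka al be : P) (v : 'I_3 -> K) i : frame p a b ka al be ->
  v i = p i * ka.@[v] + a i * al.@[v] + b i * be.@[v].
Proof.
move=> fr; have := congr1 (meval v) (frame_X fr i).
by rewrite mevalXU !mevalD !mevalM !mevalC.
Qed.

Hypothesis ch : [pchar K] =i pred0.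

Lemma poly_nonroot (q : {poly K}) : q != 0 -> exists t, q.[t] != 0.
Proof.
move=> q0; apply: NNPP => no.
have := max_poly_roots q0 (rs := [seq n%:R | n <- iota 0 (size q)]).
rewrite size_map size_iota ltnn => /(_ _ _)/notF; apply.
  apply/allP => t _; rewrite rootE; apply/negP => /negP h; apply: no; by exists t.
rewrite map_inj_uniq ?iota_uniq // => m n /eqP.
wlog le : m n / (m <= n)%N.
  by move=> H; have [/H//|/ltnW/H h] := leqP m n; rewrite eq_sym => /h.
rewrite -subr_eq0 -opprB oppr_eq0 -natrB // (iffLR (pcharf0P K) ch) subn_eq0 => le'.
by apply/eqP; rewrite eqn_leq le.
Qed.

Lemma poly_all0 (q : {poly K}) : (forall t, q.[t] = 0) -> q = 0.
Proof. by move=> h; apply/eqP/negP => /negP /poly_nonroot[t]; rewrite h eqxx. Qed.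

(** The parameters differ by a homography: [c (p1 + t p0) = L(t) p + M(t) b], with [M] a multiple of
    [t - tau]. Thus the form becomes the sum of the terms [H_j M^j L^(N-j)], and the terms with
    [j < e] vanish. *)
Lemma order_transfer (p b p0 p1 : 'I_3 -> K) (bt gm c tau : K) (h : P) N e :
  h \is N.-homog -> c != 0 -> (forall i, p i = c * (p1 i + tau * p0 i)) ->
  (forall i, p0 i = bt * p i + gm * b i) -> 'X^e %| linepoly p b h ->
  ('X - tau%:P) ^+ e %| linepoly p1 p0 h.
Proof.
move=> hh c0 pE p0E dv; pose H := linepoly p b h.
have sH : (size H <= N.+1)%N by exact: size_linepoly.
pose s : {poly K} := c%:P * ('X - tau%:P).
pose L : {poly K} := 1 + bt%:P * s; pose M : {poly K} := gm%:P * s.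
pose S : {poly K} := \sum_(j < N.+1) H`_j *: (M ^+ j * L ^+ (N - j)).
have L0 : L != 0.
  have L1 : L.[tau] = 1 by rewrite /L /s !(hornerD, hornerM, hornerC, hornerN, hornerX) subrr !mulr0 addr0.
  by apply: contraTneq (oner_neq0 K) => Lz; rewrite -L1 Lz horner0 eqxx.
have eS : (c ^+ N)%:P * linepoly p1 p0 h = S.
  (* The extra factor [L] allows the identity to be checked only where [L] does not vanish. *)
  apply/subr0_eq/(mulIf L0); rewrite mul0r; apply: poly_all0 => t.
  rewrite hornerM; have [->|Lt] := eqVneq L.[t] 0; first by rewrite mulr0.
  rewrite hornerD hornerN hornerM hornerC horner_linepoly.
  have -> : c ^+ N * h.@[fun i => p1 i + p0 i * t] = h.@[fun i => L.[t] * (p i + b i * (M.[t] / L.[t]))].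
    rewrite -(meval_homog _ _ hh); apply: meval_eq => i.
    have -> : L.[t] * (p i + b i * (M.[t] / L.[t])) = L.[t] * p i + b i * M.[t] by field.
    have -> : L.[t] = 1 + bt * (c * (t - tau)).
      by rewrite /L /s !(hornerD, hornerM, hornerC, hornerN, hornerX).
    have -> : M.[t] = gm * (c * (t - tau)).
      by rewrite /M /s !(hornerD, hornerM, hornerC, hornerN, hornerX).
    have -> : p1 i = p i / c - tau * p0 i by rewrite pE mulrC mulKf // addrK.
    rewrite p0E; field; exact: c0.
  rewrite (meval_homog _ _ hh) -horner_linepoly -/H.
  have -> : S.[t] = L.[t] ^+ N * H.[M.[t] / L.[t]]; last by rewrite subrr mul0r.
  rewrite (horner_coef_wide _ sH) mulr_sumr horner_sum; apply: eq_bigr => j _.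
  rewrite hornerZ hornerM !horner_exp expr_div_n.
  have -> : L.[t] ^+ N = L.[t] ^+ (N - j) * L.[t] ^+ j by rewrite -exprD subnK // -ltnS.
  by field; rewrite expf_neq0.
have : ('X - tau%:P) ^+ e %| S.
  rewrite /S; elim/big_ind: _ => [|q r hq hr|j _]; first exact: dvdp0.
    exact: dvdp_add.
  have [lt|le] := ltnP j e.
    have -> : H`_j = 0; last by rewrite scale0r dvdp0.
    have /dvdpP[q qE] := dv; rewrite /H qE mulrC coefXnM lt //.
  rewrite -mul_polyC; apply: dvdp_mull; apply: dvdp_mulr.
  by rewrite /M /s !exprMn; do 2 apply: dvdp_mull; exact: dvdp_exp2l.
by rewrite -eS mul_polyC dvdpZr // expf_neq0.
Qed.

End Frames.

Lemma prod_XsubC_dvd (K : fieldType) m (tau : 'I_m -> K) (e : 'I_m -> nat) (h : {poly K}) :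
  injective tau -> (forall i, ('X - (tau i)%:P) ^+ e i %| h) ->
  \prod_(i < m) ('X - (tau i)%:P) ^+ e i %| h.
Proof.
elim: m tau e => [|m IH] tau e inj dv; first by rewrite big_ord0 dvd1p.
rewrite big_ord_recr /= Gauss_dvdp.
  rewrite dv andbT; apply: (IH (fun i => tau (widen_ord (leqnSn m) i))) => // i j /inj/(congr1 val) /= e0.
  exact: val_inj.
apply: coprimep_expr; rewrite coprimep_XsubC rootE horner_prod; apply/prodf_neq0 => i _.
rewrite horner_exp hornerXsubC expf_neq0 // subr_eq0; apply/negP => /eqP/inj/(congr1 val) /= e0.
by have := ltn_ord i; rewrite -e0 ltnn.
Qed.

Lemma size_prod_XsubCX (K : fieldType) m (tau : 'I_m -> K) (e : 'I_m -> nat) :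
  size (\prod_(i < m) ('X - (tau i)%:P) ^+ e i) = (\sum_(i < m) e i).+1.
Proof.
elim: m tau e => [|m IH] tau e; first by rewrite !big_ord0 size_poly1.
rewrite !big_ord_recr /= size_Mmonic; first by rewrite IH size_exp_XsubC addSn addnS.
  by rewrite -size_poly_eq0 IH.
by rewrite monic_exp // monicXsubC.
Qed.

Section Points.
Variable K : fieldType.

Lemma proportional_sym (p q : pt K) : proportional p q -> proportional q p.
Proof.
move=> [c [c0 e]]; exists c^-1; split; first by rewrite invr_eq0.
by move=> i; rewrite e mulKf.
Qed.

Lemma proportional_trans (p q r : pt K) : proportional p q -> proportional q r -> proportional p r.
Proof.
move=> [c [c0 e]] [d [d0 e']]; exists (d * c); split; first by rewrite mulf_neq0.
by move=> i; rewrite e' e mulrA.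
Qed.

(** Used in both directions: the number of points and [epsilon_CL] come with separate lists of the
    intersection points. *)
Lemma points_list_leq (Q : pt K -> Prop) ps qs : points_list Q ps -> points_list Q qs ->
  (size ps <= size qs)%N.
Proof.
move=> [hp dp _] [_ _ cq].
have h (i : 'I_(size ps)) : exists j : 'I_(size qs), proportional (nth (@pt0 K) qs j) (nth (@pt0 K) ps i).
  have [np Qp] := hp i (ltn_ord i); have [j lt hj] := cq _ np Qp; by exists (Ordinal lt).
pose F i := proj1_sig (constructive_indefinite_description _ (h i)).
have hF i : proportional (nth (@pt0 K) qs (F i)) (nth (@pt0 K) ps i).
  by rewrite /F; case: constructive_indefinite_description.
have inj : injective F.
  move=> i j e; apply: val_inj; apply: NNPP => ne.
  apply: (dp i j (ltn_ord i) (ltn_ord j) ne).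
  apply: proportional_trans (proportional_sym (hF i)) _; rewrite e; exact: hF.
by have := leq_card F inj; rewrite !card_ord.
Qed.

End Points.

(** * Counting degrees of binary forms on the line *)

Section DerivationBound.
Variable K : fieldType.
Hypothesis ch : [pchar K] =i pred0.
Local Notation P := {mpoly K[3]}.

Lemma Om_homog v k (th : der K) : homog_der k th -> Om v th \is k.+1.-homog.
Proof.
move=> hth; have hX i : ('X_i : P) \is 1.-homog by rewrite dhomogX; apply/eqP; exact: mdeg1.
have hXt i j : 'X_i * th j \is k.+1.-homog by exact: (dhomogM (hX i) (hth j)).
rewrite /Om /det3 !mul_mpolyC; apply: rpredD; [apply: rpredB|]; apply: dhomogZ; apply: rpredB; exact: hXt.
Qed.

Lemma Om_sub v (th th' : der K) (c : P) : Om v (fun i => th' i - c * th i) = Om v th' - c * Om v th.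
Proof. by rewrite /Om /det3; ring. Qed.

Definition in_image (al h : P) := exists q, h = q * al.

Lemma derivation_bound (f al : P) n d : f \is n.-homog -> al \is 1.-homog -> al != 0 ->
  ~ in_image al f ->
  (exists (m : nat) (e : int),
     [/\ num_points (meet_pts f al) m, epsilon_CL f al e & m%:Z + e = (d + 1)%:Z]) ->
  exists p a b ka be, frame p a b ka al be /\ (0 < n)%N /\
   (forall v k th, homog_der k th -> in_D (f * al) th -> ~ in_image al (Om v th) -> (d <= k)%N) /\
   (forall v th th', homog_der d th -> homog_der d th' -> in_D (f * al) th -> in_D (f * al) th' ->
     ~ in_image al (Om v th) ->
     exists c : K, in_image al (Om v (fun i => th' i - c%:MP * th i))).
Proof.
move=> hf hal al0 ndv [m [e [[ps' [hps' <-]] [ps [hps [mC [tC [mC' [tC' [hmt eE]]]]]]] sumE]]].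
have sz : size ps' = size ps by apply/eqP; rewrite eqn_leq !(points_list_leq (Q := meet_pts f al)).
have [hp dp _] := hps.
pose pp (i : 'I_(size ps)) := nth (@pt0 K) ps i.
have loc (i : 'I_(size ps)) : exists t : ('I_3 -> K) * ('I_3 -> K) * P * P * nat,
    [/\ frame (pp i) t.1.1.1.1 t.1.1.1.2 t.1.1.2 al t.1.2,
     (((mC i)%:Z - (tC i)%:Z) - ((mC' i)%:Z - (tC' i)%:Z) + 1 <= t.2%:Z) &
     forall v th, in_D (f * al) th -> 'X^(t.2) %| linepoly (pp i) t.1.1.1.2 (Om v th)].
  have [np [fp ap]] := hp i (ltn_ord i); have [h1 h2 h3 h4] := hmt i (ltn_ord i).
  have [a [b [ka [be [fr kaj a0 b0]]]]] := chart_frame np hal al0 ap.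
  have lf : linepoly (pp i) b f != 0.
    by apply/eqP => /(linepoly_eq0 fr hf).
  have [e0 [le dv]] := local_order fr ch kaj a0 b0 hf fp lf h1 h2 h3 h4.
  by exists (a, b, ka, be, e0).
pose D i := proj1_sig (constructive_indefinite_description _ (loc i)).
have hD i : [/\ frame (pp i) (D i).1.1.1.1 (D i).1.1.1.2 (D i).1.1.2 al (D i).1.2,
     (((mC i)%:Z - (tC i)%:Z) - ((mC' i)%:Z - (tC' i)%:Z) + 1 <= (D i).2%:Z) &
     forall v th, in_D (f * al) th -> 'X^((D i).2) %| linepoly (pp i) (D i).1.1.1.2 (Om v th)].
  by rewrite /D; case: constructive_indefinite_description.
have sumD : (d + 1 <= \sum_i (D i).2)%N.
  rewrite -lez_nat -sumE sz eE (big_morph Posz PoszD (erefl (Posz 0))).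
  have : \sum_(i < size ps) (((mC i)%:Z - (tC i)%:Z) - ((mC' i)%:Z - (tC' i)%:Z) + 1) <= \sum_(i < size ps) (D i).2%:Z.
    by apply: Num.Theory.ler_sum => i _; case: (hD i).
  by rewrite big_split /= sumr_const card_ord natz addrC.
(* The total order is at least [d + 1], hence positive, so an intersection point exists and its
   frame serves as the base frame. *)
have s0 : (0 < size ps)%N.
  rewrite lt0n; apply/eqP => z; move: sumD; rewrite big1 ?addn1 // => i _.
  by have := ltn_ord i; rewrite {2}z.
pose i0 := Ordinal s0.
have [fr _ _] := hD i0; have [_ [fp0 _]] := hp i0 (ltn_ord i0).
move: fr; set p := pp i0; set a := (D i0).1.1.1.1; set b := (D i0).1.1.1.2.
set ka := (D i0).1.1.2; set be := (D i0).1.2 => fr.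
have n0 : (0 < n)%N.
  rewrite lt0n; apply/eqP => nz; apply: ndv; exists 0; rewrite mul0r.
  move: hf; rewrite nz => hf; have : f = (f@_0%MM)%:MP.
    apply: msize1_polyC; rewrite msizeE; apply/bigmax_leqP_seq => mm hm _.
    by have -> : mdeg mm = 0%N := dhomog_mf hf hm.
  by move=> fC; move: fp0; rewrite fC mevalC => ->; rewrite mpolyC0.
exists p, a, b, ka, be; split=> //; split=> //.
(* [p + t0 b] is a point of the line other than all the intersection points. Sent to infinity, it
   leaves each of them a finite parameter [tau i]. *)
have [t0 ht0] : exists t0, forall i, be.@[pp i] - t0 * ka.@[pp i] != 0.
  have nz : \prod_i ((be.@[pp i])%:P - (ka.@[pp i])%:P * 'X) != 0 :> {poly K}.
    apply/prodf_neq0 => i _; apply/eqP => /polyP E.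
    have [[j nj] [_ ai]] := hp i (ltn_ord i); case/negP: nj; apply/eqP.
    rewrite -/(pp i) (frame_eval (pp i) j fr) ai mulr0 addr0.
    have := E 0%N; rewrite coefB coefC coefCM coefX mulr0 subr0 coef0 => ->.
    have := E 1%N; rewrite coefB coefC coefCM coefX mulr1 sub0r coef0 => /eqP.
    by rewrite oppr_eq0 => /eqP ->; rewrite !mulr0 addr0.
  have [t ht] := poly_nonroot ch nz; exists t => i.
  move: ht; rewrite horner_prod => /prodf_neq0 /(_ i isT).
  by rewrite !hornerE mulrC.
have fr' := frame_shear t0 fr.
move: fr'; set p0 := (fun i => p i + t0 * b i) => fr'.
pose c i := (be - t0%:MP * ka).@[pp i].
have c0 i : c i != 0 by rewrite /c mevalB mevalM mevalC.
pose tau i := ka.@[pp i] / c i.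
have al_pp i : al.@[pp i] = 0 by have [_ [_]] := hp i (ltn_ord i).
have ppE i j : pp i j = c i * (b j + tau i * p0 j).
  rewrite (frame_eval (pp i) j fr') al_pp mulr0 addr0 mulrDr mulrA [c i * tau i]mulrC /tau divfK //.
  by rewrite mulrC [p0 j * _]mulrC.
have tau_inj : injective tau.
  move=> i j e0; apply: val_inj; apply: NNPP => ne.
  apply: (dp i j (ltn_ord i) (ltn_ord j) ne); exists (c j / c i); split.
    by rewrite mulf_neq0 // invr_eq0.
  by move=> k; rewrite -!/(pp _) !ppE e0 mulrA divfK.
pose H v th := linepoly b p0 (Om v th).
pose DD := \prod_i ('X - (tau i)%:P) ^+ (D i).2.
have sDD : size DD = (\sum_i (D i).2).+1 by exact: size_prod_XsubCX.
have dvH v k th : homog_der k th -> in_D (f * al) th -> DD %| H v th.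
  move=> hk hin; apply: prod_XsubC_dvd => // i; have [fri _ dvi] := hD i.
  have alp0 : al.@[p0] = 0 by have [] := frame_al fr'.
  apply: (order_transfer ch (bt := (D i).1.1.2.@[p0]) (gm := (D i).1.2.@[p0])
    (Om_homog v hk) (c0 i) (ppE i) _ (dvi v th hin)).
  move=> j; rewrite {1}(frame_eval p0 j fri) alp0 mulr0 addr0.
  by rewrite mulrC [_ * (D i).1.2.@[p0]]mulrC.
have sH v k th : homog_der k th -> (size (H v th) <= k.+2)%N.
  by move=> hk; apply: size_linepoly; exact: Om_homog.
have H0 v k th : homog_der k th -> H v th = 0 -> in_image al (Om v th).
  by move=> hk; exact: (linepoly_eq0 fr' (Om_homog v hk)).
split.
  move=> v k th hk hin nim.
  have nz : H v th != 0 by apply/eqP => /(H0 _ _ _ hk).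
  have := dvdp_leq nz (dvH v k th hk hin); rewrite sDD => le.
  by have := leq_trans le (sH v k th hk); rewrite !ltnS => le'; have := leq_trans sumD le'; rewrite addn1.
move=> v th th' hk hk' hin hin' nim.
(* [H v w] has degree at most [d + 1] and [DD] at least [d + 1], so the quotient is constant. *)
have const w : homog_der d w -> in_D (f * al) w -> exists u : K, H v w = u *: DD.
  move=> hw inw; have [->|nz] := eqVneq (H v w) 0; first by exists 0; rewrite scale0r.
  have /dvdpP[q qE] := dvH v d w hw inw.
  have q0 : q != 0 by apply: contraNneq nz => z; rewrite qE z mul0r.
  have DD0 : DD != 0 by rewrite -size_poly_eq0 sDD.
  have sq : (size q <= 1)%N.
    have := sH v d w hw; rewrite qE size_mul // sDD addnS /=.
    by move: (\sum_i (D i).2)%N (size q) sumD => S k; lia.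
  by exists q`_0; rewrite qE {1}(size1_polyC sq) mul_polyC.
have [u uE] := const th hk hin; have [u' uE'] := const th' hk' hin'.
have u0 : u != 0.
  by apply/negP => /eqP z; apply: nim; apply: (H0 _ _ _ hk); rewrite uE z scale0r.
exists (u' / u); rewrite Om_sub.
apply: (linepoly_eq0 fr' (e := d.+1)).
  by apply: rpredB; rewrite ?mul_mpolyC ?dhomogZ //; exact: Om_homog.
rewrite rmorphB rmorphM /= linepolyC -!/(H _ _) uE uE' mul_polyC scalerA divfK // subrr //.
Qed.

End DerivationBound.

(** * Plus-one generated curves *)

Section Homogeneous.
Variable K : fieldType.
Local Notation P := {mpoly K[3]}.

Lemma pihomogM_homog d c (f g : P) : g \is c.-homog ->
  pihomog mdeg (d + c) (f * g) = pihomog mdeg d f * g.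
Proof.
move=> hg; rewrite [f]mpolyE mulr_suml !raddf_sum mulr_suml /=; apply: eq_bigr => m _.
rewrite -scalerAl !linearZ /= -scalerAl; congr (_ *: _); rewrite pihomogX.
have hm : 'X_[m] * g \is (mdeg m + c).-homog by apply: dhomogM => //; rewrite dhomogX.
case: eqP => [e|ne]; first by rewrite pihomog_dE // -e.
rewrite mul0r; apply: pihomog_ne0 hm; apply/eqP => e; apply: ne; exact: addIn e.
Qed.

Lemma pihomogM_small d c (f g : P) : g \is c.-homog -> (d < c)%N -> pihomog mdeg d (f * g) = 0.
Proof.
move=> hg lt; rewrite [f]mpolyE mulr_suml raddf_sum /= big1 // => m _.
rewrite -scalerAl linearZ /=.
have hm : 'X_[m] * g \is (mdeg m + c).-homog by apply: dhomogM => //; rewrite dhomogX.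
rewrite (pihomog_ne0 _ hm) ?scaler0 //; apply/eqP; lia.
Qed.

Lemma homog_quotient e c (f g : P) : g != 0 -> g \is c.-homog -> f * g \is e.-homog ->
  f != 0 -> (c <= e)%N /\ f \is (e - c).-homog.
Proof.
move=> g0 hg hfg f0; have e0 := pihomog_dE hfg.
have [lt|le] := ltnP e c.
  by move: e0; rewrite (pihomogM_small _ hg lt) => /esym/eqP; rewrite mulf_eq0 (negPf f0) (negPf g0).
split=> //; rewrite homog_piE; apply/eqP; apply: (mulIf g0).
by rewrite -(pihomogM_homog _ _ hg) subnK.
Qed.

Lemma homog0_const (f : P) : f \is 0.-homog -> f = (f@_0%MM)%:MP.
Proof.
move=> hf; apply: msize1_polyC; rewrite msizeE; apply/bigmax_leqP_seq => m hm _.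
by have -> : mdeg m = 0%N := dhomog_mf hf hm.
Qed.

Lemma homog_unit_const e (f : P) : f \is e.-homog -> f.@[fun _ => 0] != 0 ->
  exists2 c : K, c != 0 & f = c%:MP.
Proof.
move=> hf nz; have e0 : e = 0%N.
  apply/eqP/negP => /negP ne; case/negP: nz.
  have := meval_homog (fun _ => 0) 0 hf; rewrite expr0n (negPf ne) [RHS]mul0r => h.
  by apply/eqP; rewrite -[RHS]h; apply: meval_eq => i; rewrite mul0r.
rewrite e0 in hf; exists (f@_0%MM); last exact: homog0_const.
by move: nz; rewrite {1}(homog0_const hf) mevalC.
Qed.

End Homogeneous.

Lemma det3M (R : comNzRingType) (p a b k l m : 'I_3 -> R) :
  det3 (fun j => p (inord 0) * k j + a (inord 0) * l j + b (inord 0) * m j)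
       (fun j => p (inord 1) * k j + a (inord 1) * l j + b (inord 1) * m j)
       (fun j => p (inord 2) * k j + a (inord 2) * l j + b (inord 2) * m j) =
  det3 p a b * det3 k l m.
Proof.
rewrite /det3; move: (inord 0) (inord 1) (inord 2) => i j n.
move: (p i) (p j) (p n) (a i) (a j) (a n) (b i) (b j) (b n) => p0 p1 p2 a0 a1 a2 b0 b1 b2.
move: (k i) (k j) (k n) (l i) (l j) (l n) (m i) (m j) (m n) => k0 k1 k2 l0 l1 l2 m0 m1 m2.
ring.
Qed.

(** * Division of a derivation by the equation of the line *)

Section Division.
Variable K : fieldType.
Local Notation P := {mpoly K[3]}.

Lemma linear_frame (l : P) : l \is 1.-homog -> l != 0 ->
  exists p a b ka be, frame p a b ka l be.
Proof.
move=> hl l0; have [j lj] : exists j, l@_U_(j) != 0.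
  apply: NNPP => no; case/eqP: l0; rewrite (homog1E hl) big1 // => i _.
  have -> : l@_U_(i) = 0; last by rewrite scale0r.
  by apply/eqP/negP => /negP h; apply: no; exists i.
have [k nkj] : exists k : 'I_3, j != k.
  by case: (eqVneq j (inord 0)) => [->|ne]; [exists (inord 1); rewrite -val_eqE /= !inordK | exists (inord 0)].
have [m [mj mk sum3]] := third_index nkj.
pose p (i : 'I_3) : K := if i == k then 1 else if i == j then - (l@_U_(k) / l@_U_(j)) else 0.
have [||a [b [ka [be [fr _ _ _]]]]] := chart_frame (p := p) _ hl l0.
- by exists k; rewrite /p eqxx oner_neq0.
- rewrite (meval_homog1 _ hl) sum3 /p !eqxx (negPf nkj) (negPf mk) (negPf mj).
  by rewrite mulrN mulr0 addr0 mulr1 mulrCA divff // mulr1 addNr.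
by exists p, a, b, ka, be.
Qed.

Lemma frame_swap (p a b : 'I_3 -> K) (ka al be : P) : frame p a b ka al be -> frame a p b al ka be.
Proof.
move=> fr; have [hka hal hbe] := frame_homog fr; have [k1 k2 k3] := frame_ka fr.
have [a1 a2 a3] := frame_al fr; have [b1 b2 b3] := frame_be fr; split=> //.
by move=> i; rewrite (frame_X fr i); congr (_ + _); exact: addrC.
Qed.

Variables (p a b : 'I_3 -> K) (ka al be : P).
Hypothesis fr : frame p a b ka al be.

Lemma frame_det : det3 a p b != 0.
Proof.
have e : det3 p a b * det3 (fun j => ka@_U_(j)) (fun j => al@_U_(j)) (fun j => be@_U_(j)) = 1.
  pose M i j : K := p i * ka@_U_(j) + a i * al@_U_(j) + b i * be@_U_(j).
  have ME i j : M i j = (i == j)%:R by rewrite /M -(frame_dual fr).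
  have -> : det3 p a b * det3 (fun j => ka@_U_(j)) (fun j => al@_U_(j)) (fun j => be@_U_(j)) =
      det3 (M (inord 0)) (M (inord 1)) (M (inord 2)) by rewrite -det3M.
  rewrite /det3 !ME !eqxx -!val_eqE /= !inordK //=.
  by rewrite !(mul0r, mulr0, mul1r, mulr1, subr0, addr0, sub0r, add0r).
apply: contraTneq (oner_neq0 K) => z; rewrite -e.
have -> : det3 p a b = - det3 a p b by rewrite /det3; ring.
by rewrite z oppr0 mul0r eqxx.
Qed.

Lemma plane_homog1 (l : P) : l \is 1.-homog ->
  l \mPo planet p b ka be = (l.@[p])%:MP * ka + (l.@[b])%:MP * be.
Proof.
move=> hl; rewrite {1}(homog1E hl) !(meval_homog1 _ hl) !raddf_sum !mulr_suml -big_split /=.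
apply: eq_bigr => i _; rewrite comp_mpolyZ [X in _ *: X]mmapX mmap1U tnth_mktuple.
by rewrite -mul_mpolyC !mpolyCM; ring.
Qed.

Lemma frame_al_neq0 : al != 0.
Proof.
have [_ h _] := frame_al fr; apply: contraTneq (oner_neq0 K) => k0.
by rewrite -h k0 meval0 eqxx.
Qed.

(** On the plane [al = 0] the hypothesis on [Om] reads [ka * co be = be * co ka]. As [ka] and [be]
    are coprime there, [co ka] and [co be] are the same multiple [a0] of [ka] and [be], so [th]
    minus [a0] times the Euler derivation vanishes on the plane. *)
Lemma divide_derivation (th : der K) : in_image al (apply_der th al) -> in_image al (Om a th) ->
  exists a0 (phi : der K), forall i, th i = a0 * 'X_i + al * phi i.
Proof.
move=> [c3 hc3] hOm; have [hka hal hbe] := frame_homog fr.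
pose co (l : P) := \sum_j (l@_U_(j))%:MP * th j.
have thE i : th i = (p i)%:MP * co ka + (a i)%:MP * co al + (b i)%:MP * co be.
  transitivity (\sum_j (i == j)%:R%:MP * th j).
    rewrite (bigD1 i) //= eqxx mpolyC1 mul1r big1 ?addr0 // => j nj.
    by rewrite eq_sym (negPf nj) mpolyC0 mul0r.
  rewrite /co !mulr_sumr -!big_split /=; apply: eq_bigr => j _.
  by rewrite (frame_dual fr i j) !mpolyCD !mpolyCM; ring.
have coal : co al = c3 * al.
  by rewrite -hc3; apply: eq_bigr => j _; rewrite mderiv_homog1 // mulrC.
have OmE : Om a th = (det3 a p b)%:MP * (ka * co be - be * co ka).
  rewrite /Om (eq_det3 (fun _ => erefl) (frame_X fr) thE).
  by rewrite /det3 !(mpolyCD, mpolyCB, mpolyCM); ring.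
have ext : in_image al (ka * co be - be * co ka).
  move: hOm => [q]; rewrite OmE => e; exists ((det3 a p b)^-1%:MP * q).
  by rewrite -mulrA -e mulrA -mpolyCM mulVf ?frame_det // mpolyC1 mul1r.
have [k1 k2 k3] := frame_ka fr; have [b1 b2 b3] := frame_be fr.
have eS : ka * (co be \mPo planet p b ka be) = be * (co ka \mPo planet p b ka be).
  have /(al_divP fr) := ext; rewrite rmorphB !rmorphM /= (plane_homog1 hka) (plane_homog1 hbe) k1 k3 b1 b3.
  by rewrite mpolyC0 mpolyC1 !mul0r !mul1r addr0 add0r => /subr0_eq.
have ka0 := ka_neq0 fr.
have [a0 ha0] : exists a0, co ka \mPo planet p b ka be = a0 * ka.
  have [[q e]|//] : (exists q, be = q * ka) \/ (exists q, co ka \mPo planet p b ka be = q * ka).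
    by apply: (al_prime (frame_swap fr)); exists (co be \mPo planet p b ka be); rewrite -eS mulrC.
  by have := b3; rewrite e mevalM k3 mulr0 => /eqP; rewrite eq_sym oner_eq0.
have hb0 : co be \mPo planet p b ka be = a0 * be.
  by apply: (mulfI ka0); rewrite eS ha0; ring.
have [c1 e1] := plane_decomp fr (co ka); have [c2 e2] := plane_decomp fr (co be).
exists a0, (fun i => (p i)%:MP * c1 + (a i)%:MP * (c3 - a0) + (b i)%:MP * c2) => i.
by rewrite thE coal {1}e1 {1}e2 ha0 hb0 (frame_X fr i); ring.
Qed.

(** Homogeneous components are taken. In degree 0 the right-hand side has none, which explains the
    first alternative. *)
Lemma divide_derivation_homog k (th : der K) : homog_der k th ->
  in_image al (apply_der th al) -> in_image al (Om a th) ->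
  (forall i, th i = 0) \/ exists k' a0 (phi : der K),
     [/\ k = k'.+1, homog_der k' phi & forall i, th i = a0 * 'X_i + al * phi i].
Proof.
move=> hk h1 h2; have [a0 [phi e]] := divide_derivation h1 h2.
have [_ hal _] := frame_homog fr.
have hX i : ('X_i : P) \is 1.-homog by rewrite dhomogX; apply/eqP; exact: mdeg1.
case: k hk => [|k] hk; [left|right].
  move=> i; rewrite -(pihomog_dE (hk i)) e pihomogD mulrC [al * _]mulrC.
  by rewrite mulrC !(pihomogM_small _ (hX i)) // (pihomogM_small _ hal) // addr0.
exists k, (pihomog mdeg k a0), (fun i => pihomog mdeg k (phi i)); split=> //.
  by move=> i; exact: pihomogP.
move=> i; rewrite -{1}(pihomog_dE (hk i)) e pihomogD -[k.+1]addn1.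
by rewrite (pihomogM_homog _ _ (hX i)) [al * _]mulrC (pihomogM_homog _ _ hal) [al * _]mulrC.
Qed.

End Division.

Section PlusOneGenerated.
Variable K : fieldType.
Local Notation P := {mpoly K[3]}.

Definition upd (b : 'I_3 -> P) k e : 'I_3 -> P := fun j => b j + (j == k)%:R * e.

Lemma sum_upd b k e (X : 'I_3 -> P) : \sum_j upd b k e j * X j = \sum_j b j * X j + e * X k.
Proof.
rewrite (eq_bigr (fun j => b j * X j + (j == k)%:R * e * X j)); last by move=> j _; rewrite -mulrDl.
rewrite big_split /=; congr (_ + _); rewrite (bigD1 k) //= eqxx mul1r big1 ?addr0 // => j nj.
by rewrite (negPf nj) !mul0r.
Qed.

(* Generators of [D(F)] besides the Euler derivation, with their unique relation. *)
Record pog3 (F : P) (T : 'I_3 -> der K) (r0 : P) (r : 'I_3 -> P) := Pog3 {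
  pog_D : forall j, in_D F (T j);
  pog_gen : forall th, in_D F th -> exists a c, forall i, th i = a * 'X_i + \sum_j c j * T j i;
  pog_rel : forall i, r0 * 'X_i + \sum_j r j * T j i = 0;
  pog_uniq : forall a c, (forall i, a * 'X_i + \sum_j c j * T j i = 0) ->
     exists h, a = h * r0 /\ forall j, c j = h * r j }.

Definition irredundant (T : 'I_3 -> der K) k :=
  ~ exists a c, c k = 0 /\ forall i, T k i = a * 'X_i + \sum_j c j * T j i.

Lemma in_D_sub F (th th' : der K) (c : P) : in_D F th -> in_D F th' ->
  in_D F (fun i => th' i - c * th i).
Proof.
move=> [g hg] [g' hg']; exists (g' - c * g).
have -> : apply_der (fun i => th' i - c * th i) F = apply_der th' F - c * apply_der th F.
  by rewrite /apply_der mulr_sumr -sumrB; apply: eq_bigr => i _; ring.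
by rewrite hg hg'; ring.
Qed.

(** Rewriting the relation in the new generators collects the multiples [c j * r j] in the
    coefficient of [T k] and leaves the others unchanged. *)
Lemma pog_change_basis F T r0 r k (c : 'I_3 -> K) : pog3 F T r0 r -> c k = 0 ->
  let T' j := (fun i => T j i - (c j)%:MP * T k i) in
  pog3 F T' r0 (upd r k (\sum_j (c j)%:MP * r j)) /\
  forall j, j != k -> irredundant T j -> irredundant T' j.
Proof.
move=> pg ck T'.
have sT' (b : 'I_3 -> P) i : \sum_j b j * T' j i = \sum_j b j * T j i - (\sum_j b j * (c j)%:MP) * T k i.
  by rewrite mulr_suml -sumrB; apply: eq_bigr => j _; rewrite /T'; ring.
have T'k i : T' k i = T k i by rewrite /T' ck mpolyC0 mul0r subr0.
split; last first.
  move=> j njk irr [a [b [bj e]]]; apply: irr.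
  exists a, (upd b k ((c j)%:MP - \sum_j b j * (c j)%:MP)); split.
    by rewrite /upd bj (negPf njk) mul0r addr0.
  move=> i; rewrite sum_upd; have := e i; rewrite sT' /T' => /(canRL (subrK _)) ->; ring.
split.
- by move=> j; apply: in_D_sub; exact: (pog_D pg).
- move=> th /(pog_gen pg)[a [b e]]; exists a, (upd b k (\sum_j b j * (c j)%:MP)) => i.
  by rewrite sum_upd sT' T'k e; ring.
- move=> i; rewrite sum_upd sT' T'k -[RHS](pog_rel pg i).
  have -> : \sum_j r j * (c j)%:MP = \sum_j (c j)%:MP * r j by apply: eq_bigr => j _; exact: mulrC.
  by ring.
- move=> a b e; set s := \sum_j b j * (c j)%:MP.
  have [|h [ha hb]] := pog_uniq pg (a := a) (c := upd b k (- s)).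
    by move=> i; rewrite sum_upd -[RHS](e i) sT' -/s; ring.
  have hbj j : j != k -> b j = h * r j.
    by move=> nj; rewrite -hb /upd (negPf nj) mul0r addr0.
  have sE : s = h * \sum_j (c j)%:MP * r j.
    rewrite /s mulr_sumr; apply: eq_bigr => j _.
    have [->|nj] := eqVneq j k; first by rewrite ck mpolyC0 mul0r !mulr0.
    by rewrite hbj //; ring.
  exists h; split=> // j; rewrite /upd mulrDr mulrCA -sE.
  by rewrite -hb /upd; ring.
Qed.

Hypothesis ch : [pchar K] =i pred0.

Lemma natr_neq0 n : (0 < n)%N -> (n%:R : K) != 0.
Proof. by move=> n0; rewrite (iffLR (pcharf0P K) ch) -lt0n. Qed.

Lemma natr_invK n : (0 < n)%N -> (n%:R : P) * (n%:R^-1)%:MP = 1.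
Proof.
by move=> n0; rewrite -(mpolyC_nat 3 K n) -mpolyCM mulfV ?mpolyC1 // natr_neq0.
Qed.

(* Modulo the Euler derivation, a relation with a vanishing coefficient reads
   [r_t T_t = - l T_q] with [l] prime, which makes one generator redundant. *)
Lemma pog_coefficient_neq0 F N T r0 r (z q t : 'I_3) :
  F \is N.-homog -> (0 < N)%N -> F != 0 -> pog3 F T r0 r ->
  (forall (V : nmodType) (X : 'I_3 -> V), \sum_i X i = X z + X q + X t) ->
  q != t -> z != q -> z != t -> r q \is 1.-homog -> r q != 0 -> irredundant T q -> irredundant T t ->
  ((r t).@[fun _ => 0] != 0 -> exists2 c : K, c != 0 & r t = c%:MP) -> r z != 0.
Proof.
move=> hF N0 F0 pg sum3 nqt nzq nzt hq rq0 irq irt ct; apply/eqP => rz.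
have [p [a [b [ka [be fr]]]]] := linear_frame hq rq0.
pose ni : P := (N%:R^-1)%:MP.
have niE : N%:R * ni = 1 by exact: natr_invK.
have [gq hgq] := pog_D pg q; have [gt hgt] := pog_D pg t.
have rel i : r0 * 'X_i + r q * T q i + r t * T t i = 0.
  by have := pog_rel pg i; rewrite sum3 rz mul0r add0r addrA.
have r0E : r0 * N%:R + r q * gq + r t * gt = 0.
  apply: (mulIf F0); rewrite mul0r !mulrDl -!mulrA -hgq -hgt -(euler_homog hF) /apply_der.
  rewrite !mulr_sumr -!big_split /= big1 // => i _.
  have -> : r0 * ('X_i * F^`M(i)) + r q * (T q i * F^`M(i)) + r t * (T t i * F^`M(i)) =
    (r0 * 'X_i + r q * T q i + r t * T t i) * F^`M(i) by ring.
  by rewrite rel mul0r.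
pose U g (th : der K) : der K := fun i => th i - ni * g * 'X_i.
have rU i : r t * U gt (T t) i = - (r q * U gq (T q) i).
  apply/eqP; rewrite -addr_eq0; apply/eqP; rewrite /U.
  have -> : r t * (T t i - ni * gt * 'X_i) + r q * (T q i - ni * gq * 'X_i) =
    (r0 * 'X_i + r q * T q i + r t * T t i) - ni * (r0 * N%:R + r q * gq + r t * gt) * 'X_i
     + (N%:R * ni - 1) * r0 * 'X_i by ring.
  by rewrite rel r0E niE subrr !mul0r mulr0 mul0r subr0 addr0.
have tq : t == q = false by rewrite eq_sym (negPf nqt).
have qz : q == z = false by rewrite eq_sym (negPf nzq).
have tz : t == z = false by rewrite eq_sym (negPf nzt).
have [[v vE]|ndv] := classic (exists v, r t = v * r q).
  apply: irq; exists (ni * gq + v * ni * gt), (fun j => if j == t then - v else 0).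
  rewrite (negPf nqt); split=> // i; rewrite sum3 (negPf nzt) (negPf nqt) eqxx !mul0r !add0r.
  have : r q * (v * U gt (T t) i + U gq (T q) i) = 0.
    by rewrite mulrDr mulrA [r q * v]mulrC -vE rU addNr.
  move/eqP; rewrite mulf_eq0 (negPf rq0) /U => /eqP e.
  by apply/eqP; rewrite -subr_eq0; apply/eqP; rewrite -[RHS]e; ring.
have [phi phiE] : exists phi : der K, forall i, U gt (T t) i = phi i * r q.
  have h i : exists v, U gt (T t) i = v * r q.
    have [||] // := al_prime fr (f := r t) (g := U gt (T t) i).
    by exists (- U gq (T q) i); rewrite rU; ring.
  by exists (fun i => proj1_sig (constructive_indefinite_description _ (h i))) => i;
    case: constructive_indefinite_description.
(* [phi] still kills [F], so it is a combination of the generators. Multiplied back by [r q], this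
   gives a relation whose coefficient at [T t] is [r q * c t - 1], nonzero at the origin; as a
   multiple of [r t], it forces [r t] to be a constant. *)
have [|a0 [c cE]] := pog_gen pg (th := phi).
  exists 0; rewrite mul0r; apply: (mulIf rq0); rewrite mul0r.
  have -> : apply_der phi F * r q = apply_der (U gt (T t)) F.
    by rewrite /apply_der mulr_suml; apply: eq_bigr => i _; rewrite phiE; ring.
  have -> : apply_der (U gt (T t)) F = apply_der (T t) F - ni * gt * (N%:R * F).
    rewrite -(euler_homog hF) /apply_der mulr_sumr -sumrB; apply: eq_bigr => i _.
    by rewrite /U; ring.
  rewrite hgt; have -> : ni * gt * (N%:R * F) = (N%:R * ni) * (gt * F) by ring.
  by rewrite niE mul1r subrr.
have [|h [_ hc]] := pog_uniq pg (a := ni * gt + r q * a0) (c := upd (fun j => r q * c j) t (-1)).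
  move=> i; rewrite sum_upd.
  have -> : \sum_j r q * c j * T j i = r q * (\sum_j c j * T j i).
    by rewrite mulr_sumr; apply: eq_bigr => j _; rewrite mulrA.
  have -> : (ni * gt + r q * a0) * 'X_i + (r q * (\sum_j c j * T j i) + -1 * T t i) =
     (a0 * 'X_i + \sum_j c j * T j i) * r q - U gt (T t) i by rewrite /U; ring.
  by rewrite -cE phiE subrr.
have rt0 : (r t).@[fun _ => 0] != 0.
  apply: contraTneq (oner_neq0 K) => z0.
  have := congr1 (meval (fun _ => 0)) (hc t).
  rewrite /upd eqxx mul1r mevalD !mevalM z0 mulr0 mevalN meval1 (meval_homog1 _ hq).
  rewrite big1; last by move=> i _; rewrite mulr0.
  by rewrite mul0r add0r => /eqP; rewrite oppr_eq0 => /eqP ->; rewrite eqxx.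
have [k k0 rtE] := ct rt0.
apply: irt; exists (- (k^-1)%:MP * r0), (fun j => if j == q then - (k^-1)%:MP * r q else 0).
rewrite tq; split=> // i; rewrite sum3 (negPf nzq) eqxx tq !mul0r add0r addr0.
have : T t i = (k^-1)%:MP * (r t * T t i).
  by rewrite rtE mulrA -mpolyCM mulVf // mpolyC1 mul1r.
have -> : r t * T t i = - (r0 * 'X_i + r q * T q i).
  by apply/eqP; rewrite -addr_eq0 addrC; apply/eqP; exact: rel.
by move=> ->; ring.
Qed.

End PlusOneGenerated.

(** * Freeness of the curve without the line *)

Section Deletion.
Variable K : fieldType.
Hypothesis ch : [pchar K] =i pred0.
Local Notation P := {mpoly K[3]}.

Lemma Om_comb v (T : 'I_3 -> der K) (a0 : P) (c : 'I_3 -> P) :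
  Om v (fun i => a0 * 'X_i + \sum_j c j * T j i) = \sum_j c j * Om v (T j).
Proof.
have n01 : (inord 0 : 'I_3) != inord 1 by rewrite -val_eqE /= !inordK.
have [l [_ _ sum3]] := third_index n01; rewrite /Om /det3 !sum3; ring.
Qed.

Lemma eq_Om v (th th' : der K) : th =1 th' -> Om v th = Om v th'.
Proof. by move=> e; apply: eq_det3. Qed.

Lemma normalize_derivation f n k (psi : der K) : f \is n.-homog -> (0 < n)%N -> homog_der k psi ->
  in_D f psi ->
  exists c, in_D0 f (fun i => psi i - c * 'X_i) /\ homog_der k (fun i => psi i - c * 'X_i).
Proof.
move=> hf n0 hk [g hg].
have hX i : ('X_i : P) \is 1.-homog by rewrite dhomogX; apply/eqP; exact: mdeg1.
have hD : apply_der psi f \is (k + n.-1).-homog.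
  by apply: rpred_sum => i _; apply: dhomogM; [exact: hk | exact: dhomog_mderiv].
have D0E c : apply_der (fun i => psi i - c * 'X_i) f = apply_der psi f - c * (n%:R * f).
  rewrite -(euler_homog hf) /apply_der mulr_sumr -sumrB; apply: eq_bigr => i _; ring.
case: k hk hD => [|k] hk hD.
  exists 0; split; last by move=> i; rewrite mul0r subr0.
  rewrite /in_D0 D0E mul0r subr0 -(pihomog_dE hD) hg (pihomogM_small _ hf) //.
  by rewrite add0n prednK.
have e : apply_der psi f = pihomog mdeg k g * f.
  by rewrite -(pihomogM_homog _ _ hf) -hg pihomog_dE //; move: hD; rewrite addSnnS prednK.
exists ((n%:R^-1)%:MP * pihomog mdeg k g); split.
  rewrite /in_D0 D0E e; set q := pihomog _ _ _.
  have -> : (n%:R^-1)%:MP * q * (n%:R * f) = (n%:R * (n%:R^-1)%:MP) * (q * f) by ring.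
  by rewrite natr_invK // mul1r subrr.
move=> i; apply: rpredB; first exact: hk.
have hq : (n%:R^-1)%:MP * pihomog mdeg k g \is k.-homog.
  by rewrite mul_mpolyC; apply: dhomogZ; exact: pihomogP.
by have := dhomogM hq (hX i); rewrite addn1.
Qed.

Section Core.
Variables (p a b : 'I_3 -> K) (ka al be : P) (fr : frame p a b ka al be).
Variables (f : P) (n d : nat).
Hypotheses (hf : f \is n.-homog) (n0 : (0 < n)%N) (ndv : ~ in_image al f).

Let hal : al \is 1.-homog. Proof. by have [] := frame_homog fr. Qed.
Let al0 : al != 0. Proof. exact: frame_al_neq0 fr. Qed.
Let f0 : f != 0.
Proof. by apply/eqP => z; apply: ndv; exists 0; rewrite mul0r. Qed.

(** [al] vanishes at [p], which has a nonzero coordinate, so [al] does not divide the corresponding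
    variable. *)
Lemma al_dvd_X (B : P) : (forall i, in_image al (B * 'X_i)) -> in_image al B.
Proof.
move=> h; have [[m pm]|no] := classic (exists m, p m != 0); last first.
  have [k1 _ _] := frame_ka fr; have [hka _ _] := frame_homog fr.
  move: k1; rewrite (meval_homog1 _ hka) big1 => [/esym/eqP|i _]; first by rewrite oner_eq0.
  have -> : p i = 0; last by rewrite mulr0.
  by apply/eqP/negP => /negP nz; apply: no; exists i.
have [//|[q e]] := al_prime fr (h m).
have [ap _ _] := frame_al fr.
by have := congr1 (meval p) e; rewrite mevalXU mevalM ap mulr0 => z; rewrite z eqxx in pm.
Qed.

Lemma in_D_quotient (T phi : der K) (A : P) : in_D (f * al) T ->
  (forall i, T i = A * 'X_i + al * phi i) -> in_D f phi.
Proof.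
move=> /(in_D_split fr ndv)[_ [g [_ hg]]] TE.
have e : al * apply_der phi f = (g - A * n%:R) * f.
  rewrite mulrBl -hg -mulrA -(euler_homog hf) /apply_der !mulr_sumr -sumrB.
  by apply: eq_bigr => i _; rewrite TE; ring.
have im : exists q, f * (g - A * n%:R) = q * al.
  by exists (apply_der phi f); rewrite mulrC -e mulrC.
have [//|[q qE]] := al_prime fr im.
exists q; apply: (mulfI al0); rewrite e qE; ring.
Qed.

Lemma deletion_core (T : 'I_3 -> der K) r0 r (dg : 'I_3 -> nat) (k j l : 'I_3) :
  pog3 (f * al) T r0 r -> (forall i, homog_der (dg i) (T i)) -> (forall i, irredundant T i) ->
  (forall i, r i != 0) -> (forall i, (dg i <= d)%N /\ r i \is (d + 1 - dg i).-homog) ->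
  (forall v e th, homog_der e th -> in_D (f * al) th -> ~ in_image al (Om v th) -> (d <= e)%N) ->
  (forall v th th', homog_der d th -> homog_der d th' -> in_D (f * al) th -> in_D (f * al) th' ->
     ~ in_image al (Om v th) ->
     exists c : K, in_image al (Om v (fun i => th' i - c%:MP * th i))) ->
  (forall (V : nmodType) (X : 'I_3 -> V), \sum_i X i = X k + X j + X l) ->
  j != l -> k != j -> k != l -> ~ in_image al (Om a (T k)) ->
  dg k = d /\ exists x y, [/\ dg j = x.+1, dg l = y.+1 & free_with_exponents f x y].
Proof.
move=> pg hT irr rn0 hr bound1 bound2 sum3 njl nkj nkl nk.
have dgk : dg k = d.
  apply/eqP; rewrite eqn_leq; have [-> _] := hr k; exact: (bound1 _ _ _ (hT k) (pog_D pg k) nk).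
split=> //.
(* For [dg i < d] the form is already divisible by [al] and [c] is 0; a nonzero [c] occurs only in
   degree [d], which keeps the new generators homogeneous. *)
have hc i : exists c : K, [/\ i = k -> c = 0, c != 0 -> dg i = d &
    i != k -> in_image al (Om a (fun m => T i m - c%:MP * T k m))].
  have [->|nik] := eqVneq i k; first by exists 0; rewrite eqxx.
  have [e|ne] := eqVneq (dg i) d.
    have [||c im] := bound2 a (T k) (T i) _ _ (pog_D pg k) (pog_D pg i) nk.
    - by rewrite -dgk; exact: hT.
    - by rewrite -e; exact: hT.
    - by exists c; split=> // e'; rewrite e' eqxx in nik.
  exists 0; rewrite eqxx; split=> // _.
  rewrite (@eq_Om _ _ (T i)); last by move=> m; rewrite mpolyC0 mul0r subr0.
  apply: NNPP => nim; have := bound1 _ _ _ (hT i) (pog_D pg i) nim.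
  by have [le _] := hr i; rewrite leqNgt ltn_neqAle ne le.
pose c i := proj1_sig (constructive_indefinite_description _ (hc i)).
have cP i : [/\ i = k -> c i = 0, c i != 0 -> dg i = d &
    i != k -> in_image al (Om a (fun m => T i m - (c i)%:MP * T k m))].
  by rewrite /c; case: constructive_indefinite_description.
have ck : c k = 0 by have [h _ _] := cP k; exact: h.
have [pg' irr'] := pog_change_basis pg ck.
move: pg' irr'; set T' := (fun j0 => _); set S := \sum_j0 _; set r' := upd r k S => pg' irr'.
have T'k i : T' k i = T k i by rewrite /T' ck mpolyC0 mul0r subr0.
have r'E i : i != k -> r' i = r i by move=> ni; rewrite /r' /upd (negPf ni) mul0r addr0.
have r'k : r' k = r k + S by rewrite /r' /upd eqxx mul1r.
have njk : j != k by rewrite eq_sym.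
have nlk : l != k by rewrite eq_sym.
have hr1 i : dg i = d -> r i \is 1.-homog.
  by move=> e; have [_] := hr i; rewrite e addnC addnK.
have hF : f * al \is (n + 1).-homog by exact: dhomogM.
have F0 : f * al != 0 by rewrite mulf_neq0.
have hr'k : r' k \is 1.-homog.
  rewrite r'k; apply: rpredD; first exact: hr1.
  apply: rpred_sum => i _; have [->|ci] := eqVneq (c i) 0; first by rewrite mpolyC0 mul0r dhomog0.
  by rewrite mul_mpolyC; apply: dhomogZ; apply: hr1; have [_ h _] := cP i; exact: h.
(* The change of generators might cancel this coefficient. If some [c i] is nonzero, then [dg i = d]
   and [r i] is linear, so [pog_coefficient_neq0] applies with [q = i]; otherwise [r' k = r k]. *)
have r'k0 : r' k != 0.
  have cst i : i != k -> (r' i).@[fun _ => 0] != 0 -> exists2 c0 : K, c0 != 0 & r' i = c0%:MP.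
    by move=> ni; rewrite r'E // => /(homog_unit_const (proj2 (hr i))).
  have [cj|cj] := eqVneq (c j) 0; last first.
    have dj : dg j = d by have [_ h _] := cP j; exact: h.
    apply: (pog_coefficient_neq0 ch hF _ F0 pg' (q := j) (t := l)) => //.
    - by rewrite addn1.
    - by rewrite r'E //; exact: hr1.
    - by rewrite r'E.
    - exact: irr'.
    - exact: irr'.
    - exact: cst.
  have [cl|cl] := eqVneq (c l) 0; last first.
    have dl : dg l = d by have [_ h _] := cP l; exact: h.
    apply: (pog_coefficient_neq0 ch hF _ F0 pg' (q := l) (t := j)) => //.
    - by rewrite addn1.
    - by move=> V X; rewrite sum3 addrAC.
    - by rewrite eq_sym.
    - by rewrite r'E //; exact: hr1.
    - by rewrite r'E.
    - exact: irr'.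
    - exact: irr'.
    - exact: cst.
  by rewrite r'k /S sum3 ck cj cl mpolyC0 !mul0r !addr0.
have OmT' i : i != k -> in_image al (Om a (T' i)) by have [_ _] := cP i.
have OmT'k : Om a (T' k) = Om a (T k) by exact: eq_Om.
(* Modulo [al] only the term of [T k] survives, and its form is not divisible by the prime [al]. *)
have al_coef (cc : 'I_3 -> P) : in_image al (\sum_i cc i * Om a (T' i)) -> in_image al (cc k).
  rewrite sum3 OmT'k => -[q hq].
  have [qj hj] := OmT' j njk; have [ql hl] := OmT' l nlk.
  have [||] // := al_prime fr (f := cc k) (g := Om a (T k)).
  exists (q - cc j * qj - cc l * ql); rewrite !mulrBl -hq -!mulrA -hj -hl; ring.
have [c0' c0E] : in_image al (r' k).
  apply: al_coef; rewrite -(Om_comb a T' r0 r'); exists 0; rewrite mul0r.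
  by rewrite (@eq_Om _ _ (fun _ => 0)); [rewrite /Om /det3; ring | exact: (pog_rel pg')].
have [c0 c00 c0C] : exists2 c0 : K, c0 != 0 & c0' = c0%:MP.
  have c0'0 : c0' != 0 by apply: contraNneq r'k0 => z; rewrite c0E z mul0r.
  have h1 : c0' * al \is 1.-homog by rewrite -c0E.
  have [_ h] := homog_quotient al0 hal h1 c0'0.
  have e := homog0_const h; exists (c0'@_0%MM) => //.
  by apply: contraNneq c0'0 => z; rewrite e z mpolyC0.
have hT' i : homog_der (dg i) (T' i).
  move=> m; apply: rpredB; first exact: hT.
  have [->|ci] := eqVneq (c i) 0; first by rewrite mpolyC0 mul0r dhomog0.
  rewrite mul_mpolyC; apply: dhomogZ.
  have -> : dg i = dg k by rewrite dgk; have [_ h _] := cP i; exact: h.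
  exact: hT.
have quot i : i != k -> exists x A (phi : der K), [/\ dg i = x.+1, homog_der x phi,
    in_D0 f phi & forall m, T' i m = A * 'X_m + al * phi m].
  move=> ni; have inD := pog_D pg' i.
  have [g1 [_ [hg1 _]]] := in_D_split fr ndv inD.
  have [z|[x [a0 [phi [dgE hphi TE]]]]] :=
    divide_derivation_homog fr (hT' i) (ex_intro _ g1 hg1) (OmT' i ni).
    exfalso; apply: (irr' i ni (irr i)); exists 0, (fun _ => 0); split=> // m.
    by rewrite z mul0r big1 ?addr0 // => m' _; rewrite mul0r.
  have [e [e0 eh]] := normalize_derivation hf n0 hphi (in_D_quotient inD TE).
  exists x, (a0 + al * e), (fun m => phi m - e * 'X_m); split=> // m.
  by rewrite TE; ring.
have [x [Aj [phj [dgj hphj D0j TjE]]]] := quot j njk.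
have [y [Al [phl [dgl hphl D0l TlE]]]] := quot l nlk.
exists x, y; split=> //; exists phj, phl; split=> //; last first.
  (* Multiplied by [al], a relation between [phj] and [phl] becomes one between the generators
     without [T' k]; it is [h] times the unique one, and [r' k != 0] forces [h = 0]. *)
  move=> g1 g2 e.
  have [|h [_ hh]] := pog_uniq pg' (a := - (g1 * Aj + g2 * Al))
    (c := fun i => if i == j then g1 else if i == l then g2 else 0).
    move=> i; rewrite sum3 (negPf nkj) (negPf nkl) eqxx [l == j]eq_sym (negPf njl) eqxx TjE TlE.
    have -> : - (g1 * Aj + g2 * Al) * 'X_i + (0 * T' k i + g1 * (Aj * 'X_i + al * phj i) +
       g2 * (Al * 'X_i + al * phl i)) = al * (g1 * phj i + g2 * phl i) by ring.
    by rewrite e mulr0.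
  have h0 : h = 0.
    have := hh k; rewrite (negPf nkj) (negPf nkl) => /esym/eqP.
    by rewrite mulf_eq0 (negPf r'k0) orbF => /eqP.
  split; first by have := hh j; rewrite eqxx h0 mul0r.
  by have := hh l; rewrite eq_sym (negPf njl) eqxx h0 mul0r.
move=> th D0th.
pose ic : P := (c0^-1)%:MP.
have icE : c0%:MP * ic = 1 by rewrite -mpolyCM mulfV // mpolyC1.
have relm m : (r0 + r' j * Aj + r' l * Al) * 'X_m + al * (c0%:MP * T k m + r' j * phj m + r' l * phl m) = 0.
  by have := pog_rel pg' m; rewrite sum3 TjE TlE T'k c0E c0C => e; rewrite -[RHS]e; ring.
have [B BE] : in_image al (r0 + r' j * Aj + r' l * Al).
  apply: al_dvd_X => m; exists (- (c0%:MP * T k m + r' j * phj m + r' l * phl m)).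
  by apply/eqP; rewrite mulNr -addr_eq0 [X in _ + X]mulrC; apply/eqP; exact: relm.
have TkE m : T k m = - ic * (B * 'X_m + r' j * phj m + r' l * phl m).
  have : c0%:MP * T k m + (B * 'X_m + r' j * phj m + r' l * phl m) = 0.
    by apply: (mulfI al0); rewrite mulr0 -[RHS](relm m) BE; ring.
  move/eqP; rewrite addr_eq0 => /eqP e.
  by rewrite -[T k m]mul1r -icE [c0%:MP * ic]mulrC -mulrA e; ring.
have [|a0 [cc ccE]] := pog_gen pg' (th := fun i => al * th i).
  have [] : in_D (f * al) (fun i => al * th i); last by move=> g hg; exists g.
  exists (apply_der th al); rewrite apply_derM.
  have e h : apply_der (fun i => al * th i) h = al * apply_der th h.
    by rewrite /apply_der mulr_sumr; apply: eq_bigr => i _; rewrite mulrA.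
  by rewrite !e D0th; ring.
have [e eE] : in_image al (cc k).
  apply: al_coef; rewrite -(Om_comb a T' a0 cc) -(eq_Om _ ccE).
  by exists (Om a th); rewrite /Om /det3; ring.
have ccm m : al * th m = (a0 + cc j * Aj + cc l * Al) * 'X_m
    + al * (cc j * phj m + cc l * phl m + e * T k m).
  by rewrite ccE sum3 TjE TlE T'k eE; ring.
have [B2 B2E] : in_image al (a0 + cc j * Aj + cc l * Al).
  apply: al_dvd_X => m; exists (th m - (cc j * phj m + cc l * phl m + e * T k m)).
  by rewrite mulrBl [th m * al]mulrC ccm; ring.
have thE m : th m = (B2 - e * ic * B) * 'X_m + ((cc j - e * ic * r' j) * phj m
   + (cc l - e * ic * r' l) * phl m).
  by apply: (mulfI al0); rewrite ccm B2E TkE; ring.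
(* Applying both sides to [f], which [th], [phj] and [phl] kill, leaves only the Euler component. *)
have z : B2 - e * ic * B = 0.
  have : apply_der th f = (B2 - e * ic * B) * (n%:R * f) + ((cc j - e * ic * r' j) * apply_der phj f
     + (cc l - e * ic * r' l) * apply_der phl f).
    rewrite -(euler_homog hf) /apply_der !mulr_sumr -!big_split /=; apply: eq_bigr => m _.
    by rewrite thE; ring.
  rewrite D0th D0j D0l !mulr0 !addr0 => /esym/eqP; rewrite !mulf_eq0 (negPf f0) orbF.
  by rewrite -mpolyC_nat mpolyC_eq0 (negPf (natr_neq0 ch n0)) orbF => /eqP.
exists (cc j - e * ic * r' j), (cc l - e * ic * r' l) => m.
by rewrite thE z mul0r add0r.
Qed.

End Core.
End Deletion.

Section PlusOneGeneratedDeletion.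
Variable K : fieldType.
Hypothesis ch : [pchar K] =i pred0.
Local Notation P := {mpoly K[3]}.

Lemma plus_one_generated_pog3 (F : P) d2 d3 d : plus_one_generated F d2 d3 d ->
  exists T r0 r, [/\ pog3 F T r0 r, forall j : 'I_3, homog_der (nth 0%N [:: d2; d3; d] j) (T j),
    forall j, irredundant T j, r (inord 2) \is 1.-homog & r (inord 2) != 0].
Proof.
move=> [th2 [th3 [psi [[D2 [D3 Dpsi]] [h2 [h3 hpsi]] gen irr [r [hr r0 rel uniq]]]]]].
pose T (j : 'I_3) := four_gens th2 th3 psi (lift ord0 j).
have lincombE g i : lincomb g (four_gens th2 th3 psi) i =
    g ord0 * 'X_i + \sum_j g (lift ord0 j) * T j i by rewrite /lincomb big_ord_recl.
pose ext (a : P) (c : 'I_3 -> P) k := if unlift ord0 k is Some j then c j else a.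
have ext0 a c : ext a c ord0 = a by rewrite /ext unlift_none.
have extS a c j : ext a c (lift ord0 j) = c j by rewrite /ext liftK.
have lincomb_ext a c i : lincomb (ext a c) (four_gens th2 th3 psi) i =
    a * 'X_i + \sum_j c j * T j i.
  by rewrite lincombE ext0; congr (_ + _); apply: eq_bigr => j _; rewrite extS.
have e3 : inord 3 = lift ord0 (inord 2 : 'I_3) :> 'I_4 by apply: val_inj; rewrite /= !inordK.
exists T, (r ord0), (fun j => r (lift ord0 j)); split.
- split.
  + by case=> -[|[|[|//]]].
  + by move=> th /gen[g e]; exists (g ord0), (fun j => g (lift ord0 j)) => i; rewrite e lincombE.
  + by move=> i; rewrite -lincombE.
  + move=> a c e; have [|h hE] := uniq (ext a c); first by move=> i; rewrite lincomb_ext.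
    by exists h; split=> [|j]; rewrite -hE ?ext0 ?extS.
- by case=> -[|[|[|//]]].
- move=> j [a [c [cj e]]]; apply: (irr (lift ord0 j)); exists (ext a c); rewrite extS; split=> // i.
  by rewrite lincomb_ext -e.
- by rewrite -e3.
- by rewrite -e3.
Qed.

(** The component of degree [dg q + 1] of the relation is again a relation, hence [h] times the
    given one; at [q], where the coefficient already has the right degree, this gives [h = 1]. *)
Lemma pog_relation_homog (F : P) (T : 'I_3 -> der K) r0 r (dg : 'I_3 -> nat) q : pog3 F T r0 r ->
  (forall j, homog_der (dg j) (T j)) -> r q \is 1.-homog -> r q != 0 -> forall j, r j != 0 ->
  (dg j <= dg q + 1)%N /\ r j \is (dg q + 1 - dg j).-homog.
Proof.
move=> pg hT hq rq0; set e := (dg q + 1)%N.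
have hX i : ('X_i : P) \is 1.-homog by rewrite dhomogX; apply/eqP; exact: mdeg1.
pose s j := if (dg j <= e)%N then pihomog mdeg (e - dg j) (r j) else 0.
have sE j i : pihomog mdeg e (r j * T j i) = s j * T j i.
  rewrite /s; case: leqP => [le|lt]; last by rewrite mul0r (pihomogM_small _ (hT j i)).
  by rewrite -(pihomogM_homog _ _ (hT j i)) subnK.
have [|h [_ hs]] := pog_uniq pg (a := pihomog mdeg (dg q) r0) (c := s).
  move=> i; have /(congr1 (pihomog mdeg e)) := pog_rel pg i.
  rewrite raddfD raddf_sum raddf0 /= => rel; rewrite -[RHS]rel.
  by congr (_ + _); [rewrite -(pihomogM_homog _ _ (hX i)) | apply: eq_bigr => j _; rewrite -sE].
have h1 : h = 1.
  apply: (mulIf rq0); rewrite mul1r -hs /s leq_addr /e addKn; exact: pihomog_dE.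
move=> j rj0; have := hs j; rewrite h1 mul1r /s; case: leqP => [le <-|_ z].
  by split=> //; exact: pihomogP.
by rewrite -z eqxx in rj0.
Qed.

Lemma pog_relation_nonconst (F : P) (T : 'I_3 -> der K) r0 r k (c : K) : pog3 F T r0 r -> irredundant T k ->
  c != 0 -> r k <> c%:MP.
Proof.
move=> pg irr c0 rk; apply: irr; pose ic : P := (c^-1)%:MP.
have icE : ic * r k = 1 by rewrite rk -mpolyCM mulVf // mpolyC1.
exists (- ic * r0), (upd (fun i => - ic * r i) k 1); split.
  by rewrite /upd eqxx mulNr icE mul1r addNr.
move=> i; rewrite sum_upd mul1r.
have -> : \sum_j - ic * r j * T j i = - ic * (\sum_j r j * T j i).
  by rewrite mulr_sumr; apply: eq_bigr => j _; rewrite mulrA.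
by rewrite addrA -mulrA -mulrDr (pog_rel pg i) mulr0 add0r.
Qed.

(* The constant derivation along the direction [b] of the line, multiplied by [f],
   lies in [D(f al)] and is transverse to the Euler derivation along the line. *)
Lemma exists_transverse_generator p a b (ka al be f : P) (T : 'I_3 -> der K) r0 r : frame p a b ka al be ->
  ~ in_image al f -> pog3 (f * al) T r0 r -> exists k, ~ in_image al (Om a (T k)).
Proof.
move=> fr ndv pg; apply: NNPP => no.
have all k : in_image al (Om a (T k)) by apply: NNPP => h; apply: no; exists k.
have [_ hal _] := frame_homog fr; have [alp _ alb] := frame_al fr.
pose cb : der K := fun i => (b i)%:MP.
have scale g : apply_der (fun i => f * cb i) g = f * apply_der cb g.
  by rewrite /apply_der mulr_sumr; apply: eq_bigr => i _; rewrite mulrA.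
have cbal : apply_der cb al = 0.
  rewrite -(mpolyC0 3 K) -alb (meval_homog1 _ hal) raddf_sum /=.
  by apply: eq_bigr => i _; rewrite mderiv_homog1 // mpolyCM mulrC.
have [|a0 [c e]] := pog_gen pg (th := fun i => f * cb i).
  by exists (apply_der cb f); rewrite apply_derM !scale cbal; ring.
have im : in_image al (f * Om a cb).
  have -> : f * Om a cb = Om a (fun i => f * cb i) by rewrite /Om /det3; ring.
  rewrite (eq_Om _ e) Om_comb.
  pose g j := proj1_sig (constructive_indefinite_description _ (all j)).
  exists (\sum_j c j * g j); rewrite mulr_suml; apply: eq_bigr => j _; rewrite -mulrA; congr (_ * _).
  by rewrite /g; case: constructive_indefinite_description.
have [//|[q qE]] := al_prime fr im.
(* At [p], a point of the line, the form takes the value [det3 a p b], the nonzero determinant of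
   the frame. *)
have := congr1 (meval p) qE; rewrite mevalM alp mulr0 [meval p _]rmorph_det3 => z.
case/eqP: (frame_det fr); rewrite -[RHS]z; apply: eq_det3 => i /=.
- by rewrite mevalC.
- by rewrite mevalXU.
- by rewrite mevalC.
Qed.

Lemma plus_one_deletion (f al : P) n d2 d3 d : f \is n.-homog -> al \is 1.-homog -> al != 0 ->
  ~ in_image al f -> plus_one_generated (f * al) d2 d3 d ->
  (exists (m : nat) (e : int),
     [/\ num_points (meet_pts f al) m, epsilon_CL f al e & m%:Z + e = (d + 1)%:Z]) ->
  exists x y, [/\ d2 = x.+1, d3 = y.+1 & free_with_exponents f x y].
Proof.
move=> hf hal al0 ndv POG eps.
have [p [a [b [ka [be [fr [n0 [b1 b2]]]]]]]] := derivation_bound ch hf hal al0 ndv eps.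
have [T [r0 [r [pg hT irr hr2 r20]]]] := plus_one_generated_pog3 POG.
pose dg (j : 'I_3) := nth 0%N [:: d2; d3; d] j.
pose i0 : 'I_3 := inord 0; pose i1 : 'I_3 := inord 1; pose i2 : 'I_3 := inord 2.
have n01 : i0 != i1 by rewrite -val_eqE /= !inordK.
have n02 : i0 != i2 by rewrite -val_eqE /= !inordK.
have n12 : i1 != i2 by rewrite -val_eqE /= !inordK.
have sum012 (V : nmodType) (X : 'I_3 -> V) : \sum_i X i = X i0 + X i1 + X i2.
  rewrite !big_ord_recl big_ord0 addr0 addrA.
  by congr (X _ + X _ + X _); apply: val_inj; rewrite /= inordK.
have dg0 : dg i0 = d2 by rewrite /dg inordK.
have dg1 : dg i1 = d3 by rewrite /dg inordK.
have dg2 : dg i2 = d by rewrite /dg inordK.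
have hrel := pog_relation_homog pg hT hr2 r20; rewrite -/i2 -/(dg i2) dg2 in hrel.
have f0 : f != 0 by apply/eqP => z; apply: ndv; exists 0; rewrite mul0r.
have F0 : f * al != 0 by rewrite mulf_neq0.
have hF : f * al \is (n + 1).-homog by exact: dhomogM.
have cst j : (r j).@[fun _ => 0] != 0 -> exists2 c : K, c != 0 & r j = c%:MP.
  move=> nz; have rj0 : r j != 0 by apply: contraNneq nz => ->; rewrite meval0.
  by have [_ h] := hrel j rj0; exact: homog_unit_const h nz.
have rn0 j : r j != 0.
  case: (I3P j) => ->; last exact: r20.
    apply: (pog_coefficient_neq0 ch hF _ F0 pg (q := i2) (t := i1)) => //.
    - by rewrite addn1.
    - by move=> V X; rewrite sum012 addrAC.
    - by rewrite eq_sym.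
    - exact: cst.
  apply: (pog_coefficient_neq0 ch hF _ F0 pg (q := i2) (t := i0)) => //.
  - by rewrite addn1.
  - by move=> V X; rewrite sum012 -addrA addrC.
  - by rewrite eq_sym.
  - by rewrite eq_sym.
  - exact: cst.
(* A generator of degree [d + 1] would have a nonzero constant as its coefficient and be
   redundant. *)
have hr j : (dg j <= d)%N /\ r j \is (d + 1 - dg j).-homog.
  have [le h] := hrel j (rn0 j); split=> //.
  rewrite leqNgt; apply/negP => lt.
  have z : (d + 1 - dg j)%N = 0%N by apply/eqP; rewrite subn_eq0 addn1.
  rewrite z in h; have e := homog0_const h.
  apply: (pog_relation_nonconst pg (irr j) _ e).
  by apply: contraNneq (rn0 j) => z'; rewrite e z' mpolyC0.
have [k nk] := exists_transverse_generator fr ndv pg.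
have core := deletion_core (dg := dg) ch fr hf n0 ndv pg hT irr rn0 hr b1 b2.
(* If the transverse generator is one of the first two, its degree is [d]; then [psi], of the same
   degree, takes its place and the exponents are unchanged. *)
case: (I3P k) nk => -> nk.
- have [||||e [x [y [ex ey fe]]]] := core i0 i2 i1 _ _ _ _ nk.
  + by move=> V X; rewrite sum012 addrAC.
  + by rewrite eq_sym.
  + by [].
  + by [].
  exists x, y; split=> //; first by rewrite -dg0 e -dg2.
  by rewrite -dg1.
- have [||||e [x [y [ex ey fe]]]] := core i1 i0 i2 _ _ _ _ nk.
  + by move=> V X; rewrite sum012 [X i0 + _]addrC.
  + by [].
  + by rewrite eq_sym.
  + by [].
  exists x, y; split=> //; first by rewrite -dg0.
  by rewrite -dg1 e -dg2.
have [||||e [x [y [ex ey fe]]]] := core i2 i0 i1 _ _ _ _ nk.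
- by move=> V X; rewrite sum012 addrC addrA.
- by [].
- by rewrite eq_sym.
- by rewrite eq_sym.
by exists x, y; split; rewrite // -?dg0 -?dg1.
Qed.

End PlusOneGeneratedDeletion.

Theorem theorem3p1 (R : realType) (f' alpha : {mpoly R[i][3]}) (d2 d3 d : nat) :
  reduced_curve (f' * alpha) ->
  alpha \is 1.-homog -> alpha != 0 ->
  ~ (exists g, f' = g * alpha) ->
  plus_one_generated (f' * alpha) d2 d3 d ->
  (exists (m : nat) (e : int),
     [/\ num_points (meet_pts f' alpha) m, epsilon_CL f' alpha e &
         m%:Z + e = (d + 1)%:Z]) ->
  exists a b : nat, [/\ d2 = a.+1, d3 = b.+1 & free_with_exponents f' a b].
Proof.
move=> [_ [[k [_ hF]] _]] hal al0 ndv.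
have f0 : f' != 0 by apply/eqP => z; apply: ndv; exists 0; rewrite mul0r.
have [_ hf] := homog_quotient al0 hal hF f0.
exact: (plus_one_deletion (@Num.Theory.pchar_num _) hf hal al0 ndv).
Qed.
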